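(* Assume $\mathsf{IIA}$. Then for every infinite countable sequential topological group $\mathbb G$ there is exactly one ordinal $\alpha\le\omega_1$ such that $\mathbb G$ is homeomorphic to $\mathbb Q_{\omega^\alpha}$.
   Context: All topological spaces and groups are $T_1$ and completely regular. A sequence converging to $x$ is identified with an infinite set $C$ such that $C\setminus U$ is finite for every neighborhood $U$ of $x$ (written $C\to x$). $A\subseteq^* B$ means $A\setminus B$ is finite. A space $X$ is sequential if for every non-closed $A\subseteq X$ there is a sequence $C\subseteq A$ with $C\to x$ for some $x\notin A$. The spaces $\mathbb Q_{\omega^\alpha}$ ($\omega^\alpha$ is ordinal exponentiation; $\omega^{\omega_1}=\omega_1$). The Cantor-Bendixson rank $\mathrm{rank}_{CB}(K)$ of a scattered space $K$ is its height: the least ordinal $\gamma$ such that the $\gamma$-th iterated Cantor-Bendixson derivative of $K$ is empty (so non-empty finite sets have rank $1$). For each countable ordinal of the form $\beta=\omega^\alpha$, $\alpha<\omega_1$, fix a countable family $\mathcal K_\beta$ of non-empty compact subsets of the rationals $\mathbb Q$ (with the usual topology) closed under translations, additive inverse $K\mapsto -K$, and algebraic sums $K+L$, such that $\beta=\sup\{\mathrm{rank}_{CB}(K):K\in\mathcal K_\beta\}$. Let $\tau_\beta=\{U\subseteq\mathbb Q:\ U\cap K\text{ is open in }K\text{ for all }K\in\mathcal K_\beta\}$ and $\mathbb Q_\beta=(\mathbb Q,\tau_\beta)$. In particular $\mathbb Q_{\omega^0}=\mathbb Q_1$ is discrete. $\mathbb Q_{\omega_1}$ denotes $\mathbb Q$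 with its usual topology. An ideal on a set $X$ is a family of subsets of $X$ closed under subsets and finite unions; ideals are assumed to contain all finite sets (this convention does not apply to the ideals $\mathcal I_x$ defined below). $\mathcal I^+=\mathcal P(X)\setminus\mathcal I$. An ideal $\mathcal I$ on a group $\mathbb G$ is invariant if $g\cdot I$, $I\cdot g$ and $I^{-1}$ are in $\mathcal I$ for all $I\in\mathcal I$, $g\in\mathbb G$. An ideal $\mathcal I$ on $X$ is $\omega$-hitting if for every countable family $\mathcal Y$ of infinite subsets of $X$ there is $I\in\mathcal I$ with $Y\cap I$ infinite for every $Y\in\mathcal Y$. An ideal $\mathcal I$ is tame if for every $Y\in\mathcal I^+$, every $f:Y\to\omega$ and every $\omega$-hitting ideal $\mathcal J$ on $\omega$ there is $J\in\mathcal J$ with $f^{-1}[J]\notin\mathcal I$. An ideal $\mathcal I$ on a topological group $\mathbb G$ is weakly closed if for every $A\subseteq\mathbb G$ and every (infinite) sequence $C\subseteq\mathbb G$ converging to $1_{\mathbb G}$: $A\in\mathcal I$ if and only if $A\cup\{x: C\cdot x\subseteq^* A\}\in\mathcal I$. For a point $x$ of a space $X$ let $\mathcal I_x=\{A\subseteq X: x\notin\overline A\}$. A set $Y\subseteq X$ is entangled if $\mathcal I_x\restriction Y=\{A\subseteq Y:x\notin\overline A\}$ is $\omega$-hitting (on $Y$) for every $x\in X$. A space is groomed if it does not contain a dense entangled set. $\mathsf{IIA}$ (the Invariant Ideal Axiom) is the statement: for every countable groomed topological group $\mathbb G$ and every tame, weakly closed, invariant ideal $\mathcal I\subseteq\mathcal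 P(\mathbb G)$ one of the following holds: (1) there is a countable $\mathcal S\subseteq\mathcal I$ such that for every infinite sequence $C$ convergent in $\mathbb G$ there is $I\in\mathcal S$ with $C\cap I$ infinite; (2) there is a countable $\mathcal H\subseteq\mathcal I^+$ such that for every non-empty open $U\subseteq\mathbb G$ there is $H\in\mathcal H$ with $H\setminus U\in\mathcal I$. *)

(* Defs.v *)
From HB Require Import structures.
From mathcomp Require Import all_boot all_order all_algebra.
From mathcomp Require Import wochoice.
From mathcomp Require Import all_classical all_reals all_analysis.
Import numFieldNormedType.Exports.

Set Implicit Arguments.
Unset Strict Implicit.
Unset Printing Implicit Defensive.

Local Open Scope classical_set_scope.

(** An ordinal is represented by a well-ordered type; two representatives
    denote the same ordinal when they are order-isomorphic ([ord_eq]).  The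
    ordinals below [a] are the order types of the segments of [a], i.e. they
    are indexed by the elements of [a]. *)

Record Ord := MkOrd {
  ord_car :> Type;
  olt : ord_car -> ord_car -> Prop;
  olt_trans : forall x y z, olt x y -> olt y z -> olt x z;
  olt_total : forall x y, olt x y \/ x = y \/ olt y x;
  olt_wf : well_founded olt
}.

Definition ord_le (a b : Ord) :=
  exists f : a -> b, (forall x y, olt x y -> olt (f x) (f y)) /\
    (forall x z, olt z (f x) -> exists y, f y = z).

Definition ord_eq (a b : Ord) :=
  exists2 f : a -> b, bijective f & forall x y, olt x y <-> olt (f x) (f y).

Definition is_ord_sup (S : Ord -> Prop) (b : Ord) :=
  (forall c, S c -> ord_le c b) /\
  (forall b', (forall c, S c -> ord_le c b') -> ord_le b b').

Lemma olt_irr (a : Ord) (x : a) : ~ olt x x.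
Proof. by elim: (olt_wf x) => {}x _ IH xx; exact: (IH x xx xx). Qed.

Lemma finite_has_max (a : Ord) (A : set a) : finite_set A -> A !=set0 ->
  exists2 m, A m & forall y, A y -> ~ olt m y.
Proof.
move=> /(@finite_seqP {classic a})[s ->] {A}.
elim: s => [|x s IH] [z] //= zs.
have [s0|/set0P s0] := eqVneq [set` s] set0.
  have sE y : y \in s -> False by move=> ys; have : [set` s] y by []; rewrite s0.
  exists x; first by rewrite inE eqxx.
  by move=> y; rewrite inE => /orP[/eqP->|/sE//]; exact: olt_irr.
have [m ms mP] := IH s0.
have [mx|nmx] := pselect (olt m x).
  exists x; first by rewrite inE eqxx.
  move=> y; rewrite inE => /orP[/eqP->|ys xy]; first exact: olt_irr.
  exact: mP ys (olt_trans mx xy).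
exists m; first by rewrite inE orbC; apply/orP; left.
by move=> y; rewrite inE => /orP[/eqP->|ys] //; exact: mP.
Qed.

(** The standard order-theoretic model of ordinal exponentiation: functions
    [a -> omega] of finite support (the exponents of a Cantor normal form with
    their coefficients), compared at the largest argument where they differ. *)
Section OmegaPower.
Variable a : Ord.

Definition omega_pow_car := {f : a -> nat | finite_set [set x | f x <> 0%N]}.

Definition colex (f g : a -> nat) :=
  exists x, (f x < g x)%N /\ forall y, olt x y -> f y = g y.

Definition omega_pow_lt (f g : omega_pow_car) := colex (sval f) (sval g).

Lemma omega_pow_trans f g h :
  omega_pow_lt f g -> omega_pow_lt g h -> omega_pow_lt f h.
Proof.
move=> [x [fg xfg]] [y [gh ygh]].
case: (olt_total x y) => [xy|[xy|yx]].
- exists y; split; first by rewrite xfg.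
  by move=> z yz; rewrite xfg ?ygh //; exact: olt_trans yz.
- subst y; exists x; split; first exact: ltn_trans gh.
  by move=> z xz; rewrite xfg ?ygh.
- exists x; split; first by rewrite -ygh.
  by move=> z xz; rewrite xfg ?ygh //; exact: olt_trans xz.
Qed.

Lemma omega_pow_total f g :
  omega_pow_lt f g \/ f = g \/ omega_pow_lt g f.
Proof.
case: f g => [f ff] [g fg]; rewrite /omega_pow_lt /=.
have [fgE|/eqP fgN] := eqVneq f g.
  by right; left; subst g; congr exist; exact: Prop_irrelevance.
have fin : finite_set [set x | f x <> g x].
  apply: (@sub_finite_set _ _ ([set x | f x <> 0%N] `|` [set x | g x <> 0%N])).
    move=> x /= ne; have [f0|/eqP] := eqVneq (f x) 0%N; last by left.
    by right => g0; apply: ne; rewrite f0 g0.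
  by rewrite finite_setU.
have [|m /= ne mP] := finite_has_max fin.
  apply/set0P/eqP => E; apply: fgN; apply/funext => x; apply: contrapT => ne.
  by have : [set x | f x <> g x] x by []; rewrite E.
have mE y : olt m y -> f y = g y by move=> my; apply: contrapT => /mP; exact.
case: (ltngtP (f m) (g m)) => // lt.
- by left; exists m; split.
- by right; right; exists m; split=> // y /mE.
Qed.

Lemma omega_pow_wf : well_founded omega_pow_lt.
Proof.
pose below y (f : omega_pow_car) := forall z, olt y z -> sval f z = 0%N.
have zeroP (f : omega_pow_car) : (forall x, sval f x = 0%N) -> Acc omega_pow_lt f.
  by move=> f0; constructor=> g [x []]; rewrite f0 ltn0.
have maxP (f : omega_pow_car) : (exists x, sval f x <> 0%N) ->
    exists2 m, sval f m <> 0%N & below m f.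
  move=> fN0; have [m fm mP] := finite_has_max (proj2_sig f) fN0.
  by exists m => // z mz; apply: contrapT => /mP; exact.
suff main y (f : omega_pow_car) : below y f -> Acc omega_pow_lt f.
  move=> f; have [/maxP[m _ bm]|f0] := pselect (exists x, sval f x <> 0%N).
    exact: main bm.
  by apply: zeroP => x; apply: contrapT => ?; apply: f0; exists x.
elim: (olt_wf y) f => {}y _ IHy f0.
pose drop (f : omega_pow_car) x := if `[< x = y >] then 0%N else sval f x.
have dropP (f : omega_pow_car) : finite_set [set x | drop f x <> 0%N].
  by apply: sub_finite_set (proj2_sig f) => x /=; rewrite /drop; case: asboolP.
pose rest f : omega_pow_car :=
  exist (fun f : a -> nat => finite_set [set x | f x <> 0%N]) _ (dropP f).
have rest_acc g : below y g -> Acc omega_pow_lt (rest g).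
  move=> bg; have [/maxP[m mN bm]|r0] :=
    pselect (exists x, sval (rest g) x <> 0%N); last first.
    by apply: zeroP => x; apply: contrapT => ?; apply: r0; exists x.
  apply: (IHy m) bm; case: (olt_total m y) => [//|[my|ym]]; case: mN.
    by rewrite /= /drop asboolT.
  by rewrite /= /drop; case: asboolP => // _; rewrite bg.
suff key n : forall r, Acc omega_pow_lt r -> forall g, below y g ->
    sval g y = n -> rest g = r -> Acc omega_pow_lt g.
  by move=> bf; exact: (key _ _ (rest_acc f0 bf) f0 bf erefl erefl).
elim/ltn_ind: n => n IHn r; elim=> {}r _ IHr g bg gy gr.
constructor=> h [x [hgx xhg]].
have bh : below y h.
  move=> z yz; case: (olt_total x z) => [xz|[xz|zx]].
  - by rewrite xhg ?bg.
  - by move: hgx; rewrite xz bg.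
  - by move: hgx; rewrite bg //; exact: olt_trans zx.
case: (olt_total x y) => [xy|[xy|yx]].
- apply: (IHr (rest h)) => //; last by rewrite xhg.
  rewrite -gr; exists x; split=> [|z xz] /=; rewrite /drop.
    by rewrite asboolF // => xyE; case: (@olt_irr a y); rewrite -{1}xyE.
  by case: asboolP => // _; exact: xhg.
- apply: (IHn (sval h y)) (rest_acc h bh) _ bh erefl erefl.
  by rewrite -gy -xy.
- by move: hgx; rewrite bg.
Qed.

Definition omega_pow : Ord :=
  MkOrd omega_pow_trans omega_pow_total omega_pow_wf.

End OmegaPower.

(** Fix a well-ordering of the uncountable set [set nat]; [omega1] consists of
    the elements that have countably many predecessors.  The lemmas
    [omega1_uncountable] and [omega1_segment] show that this is indeed the
    uncountable ordinal all of whose proper initial segments are countable. *)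

Section OrdOfType.
Variable T : eqType.

Let R : rel T := sval (well_ordering_principle T).
Let Rwo : well_order R := svalP (well_ordering_principle T).
Let lt (x y : T) : Prop := ~~ R y x.

Let Rchain : wo_chain R predT. Proof. by move=> A _; exact: Rwo. Qed.
Let Rtot x y : R x y || R y x. Proof. exact: (wo_chainW Rchain). Qed.
Let Ranti x y : R x y -> R y x -> x = y.
Proof. by move=> xy yx; apply: (wo_chain_antisymmetric Rchain); rewrite ?xy. Qed.

Let lt_total x y : lt x y \/ x = y \/ lt y x.
Proof.
rewrite /lt; case yx: (R y x); case xy: (R x y); try by [left|right; right].
by right; left; exact: Ranti.
Qed.

Let lt_wf : well_founded lt.
Proof.
move=> x; apply: contrapT => nx.
have [z [[/asboolP nz zP] _]] := Rwo (A := [pred x | `[< ~ Acc lt x >]])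
  (ex_intro _ x (introT (asboolP _) nx)).
apply: nz; constructor=> y yz; apply: contrapT => /asboolP ny.
by move: yz; rewrite /lt zP.
Qed.

Let lt_trans x y z : lt x y -> lt y z -> lt x z.
Proof.
move=> xy yz;
case: (lt_total x z) => // -[xz|zx]; exfalso.
  subst z; move: xy yz; rewrite /lt => /negPf xy /negPf yz.
  by have := Rtot x y; rewrite xy yz.
elim: (lt_wf x) y z xy yz zx => {}x _ IH y z xy yz zx.
exact: (IH z zx x y).
Qed.

Definition ord_of_type : Ord := MkOrd lt_trans lt_total lt_wf.

End OrdOfType.

Section OrdRestrict.
Variables (a : Ord) (P : a -> Prop).

Let lt (x y : {x : a | P x}) := olt (sval x) (sval y).

Let lt_trans x y z : lt x y -> lt y z -> lt x z.
Proof. exact: olt_trans. Qed.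

Let lt_total x y : lt x y \/ x = y \/ lt y x.
Proof.
case: x y => [x px] [y py]; rewrite /lt /=.
case: (olt_total x y) => [|[xy|]]; [by left| |by right; right].
by right; left; subst y; congr exist; exact: Prop_irrelevance.
Qed.

Let lt_wf : well_founded lt.
Proof.
case=> x; elim: (olt_wf x) => {}x _ IH px; constructor=> -[y py] yx.
exact: IH.
Qed.

Definition ord_restrict : Ord := MkOrd lt_trans lt_total lt_wf.

End OrdRestrict.

Definition omega1 : Ord :=
  @ord_restrict (ord_of_type (set nat)) (fun x => countable [set y | olt y x]).

Lemma omega1_segment (x : omega1) : countable [set y | olt y x].
Proof.
case: x => x cx; have /countable_injP[f finj] := cx.
apply/countable_injP; exists (fun y => f (sval y)).
move=> [y py] [z pz] /set_mem yx /set_mem zx /= fE.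
have yz : y = z by apply: finj => //; rewrite inE.
by subst z; congr exist; exact: Prop_irrelevance.
Qed.

Lemma omega1_uncountable : ~ countable [set: omega1].
Proof.
pose W := ord_of_type (set nat); pose P (x : W) := countable [set y | olt y x].
move=> c1; have cP : countable [set x | P x].
  have /countable_injP[f finj] := c1; apply/countable_injP.
  exists (fun x => if pselect (P x) is left px
                   then f (exist _ x px : omega1) else 0%N).
  move=> x y /set_mem /= px /set_mem /= py.
  case: pselect => // px'; case: pselect => // py' /finj.
  by rewrite !inE => /(_ I I)[].
have allP x : P x.
  elim: (olt_wf x) => {}x _ IH; apply: sub_countable cP.
  by apply: subset_card_le => y /IH.
have /countable_injP[f finj] : countable [set: W].
  by apply: sub_countable cP; apply: subset_card_le => x _; exact: allP.
pose D : set nat := [set n | exists2 A : set nat, f A = n & ~ A n].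
have [[A fA nA]|nD] := pselect (D (f D)).
  have AD : A = D by apply: finj; rewrite ?inE.
  by apply: (nA); rewrite AD; exists A.
by apply: (nD); exists D.
Qed.

Definition Tychonoff (X : topologicalType) :=
  accessible_space X /\ completely_regular_space X.

Definition homeomorphic (X Y : topologicalType) :=
  exists (f : X -> Y) (g : Y -> X),
    [/\ cancel f g, cancel g f, continuous f & continuous g].

Definition almost_subset (T : Type) (A B : set T) := finite_set (A `\` B).

(** A convergent sequence is identified with its (infinite) range. *)
Definition seq_to (X : topologicalType) (C : set X) (x : X) :=
  infinite_set C /\ forall U, nbhs x U -> almost_subset C U.

Definition sequential (X : topologicalType) :=
  forall A : set X, ~ closed A ->
    exists (C : set X) (x : X), [/\ C `<=` A, seq_to C x & ~ A x].

HB.mixin Record isTopologicalGroup G of Topological G & Group G := {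
  mulg_continuous : continuous (fun xy : (G * G)%type => (xy.1 * xy.2)%g) ;
  invg_continuous : continuous (fun x : G => (x^-1)%g)
}.

#[short(type="topologicalGroupType")]
HB.structure Definition TopologicalGroup :=
  {G of Topological G & Group G & isTopologicalGroup G}.

Record is_ideal (X : Type) (I : set (set X)) : Prop := {
  ideal_finite : forall A, finite_set A -> I A;
  ideal_sub : forall A B, A `<=` B -> I B -> I A;
  ideal_setU : forall A B, I A -> I B -> I (A `|` B)
}.

Definition omega_hitting (X : Type) (D : set X) (I : set (set X)) :=
  forall YY : set (set X), countable YY ->
    (forall Y, YY Y -> Y `<=` D /\ infinite_set Y) ->
    exists2 A, I A & forall Y, YY Y -> infinite_set (Y `&` A).

(** A function [Y -> nat] is given by a function on [X], of which only the
    values on [Y] matter. *)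
Definition tame (X : Type) (I : set (set X)) :=
  forall (Y : set X) (f : X -> nat) (J : set (set nat)),
    ~ I Y -> is_ideal J -> omega_hitting [set: nat] J ->
    exists2 A, J A & ~ I (Y `&` f @^-1` A).

Definition invariant_ideal (G : groupType) (I : set (set G)) :=
  forall A, I A ->
    [/\ forall g : G, I [set (g * x)%g | x in A],
        forall g : G, I [set (x * g)%g | x in A]
      & I [set (x^-1)%g | x in A]].

Definition weakly_closed (G : topologicalGroupType) (I : set (set G)) :=
  forall A C : set G, seq_to C (1%g : G) ->
    (I A <->
     I (A `|` [set x | almost_subset [set (c * x)%g | c in C] A])).

Definition ideal_at (X : topologicalType) (x : X) : set (set X) :=
  [set A | ~ closure A x].

Definition entangled (X : topologicalType) (Y : set X) :=
  forall x : X, omega_hitting Y [set A | A `<=` Y /\ ideal_at x A].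

Definition groomed (X : topologicalType) :=
  ~ exists Y : set X, dense Y /\ entangled Y.

Definition IIA : Prop :=
  forall G : topologicalGroupType,
    Tychonoff G -> countable [set: G] -> groomed G ->
  forall I : set (set G),
    is_ideal I -> tame I -> weakly_closed I -> invariant_ideal I ->
    (exists S : set (set G), [/\ countable S, S `<=` I &
       forall (C : set G) (x : G), seq_to C x ->
         exists2 A, S A & infinite_set (C `&` A)])
    \/
    (exists H : set (set G), [/\ countable H, H `<=` ~` I &
       forall U : set G, open U -> U !=set0 ->
         exists2 A, H A & I (A `\` U)]).

Section CantorBendixson.
Variables (X : topologicalType) (K : set X).

Definition CB_prime (A : set X) : set X := A `&` limit_point A.

(** [CB_stage x], for [x] in an ordinal [a], is the derivative of [K] of order
    (the order type of) the segment below [x]: the successor and limit clauses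
    are both covered by intersecting [K] with the Cantor-Bendixson derivatives
    of all the previous stages. *)
Inductive CB_stage (a : Ord) : a -> X -> Prop :=
| CB_stage_intro x t : K t ->
    (forall y, olt y x -> CB_prime (CB_stage y) t) -> CB_stage x t.

Definition CB_derivative (a : Ord) : set X :=
  [set t | K t /\ forall x : a, CB_prime (CB_stage x) t].

Definition is_CB_rank (a : Ord) :=
  CB_derivative a = set0 /\
  forall b : Ord, CB_derivative b = set0 -> ord_le a b.

End CantorBendixson.

Section RationalSpaces.
Local Open Scope ring_scope.

(** [rat^o] is [rat] with the topology of its absolute value.  The
    Cantor-Bendixson rank of a compact [K] is computed in this space; it is the
    same as in the subspace [K]. *)
Record admissible_family (KK : set (set rat^o)) (b : Ord) : Prop := {
  adm_countable : countable KK;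
  adm_nonempty : forall K, KK K -> K !=set0;
  adm_compact : forall K, KK K -> compact K;
  adm_translate : forall K (q : rat^o), KK K -> KK [set q + x | x in K];
  adm_opp : forall K, KK K -> KK [set - x | x in K];
  adm_sum : forall K L, KK K -> KK L -> KK [set x + y | x in K & y in L];
  adm_rank : is_ord_sup (fun c => exists2 K, KK K & is_CB_rank K c) b
}.

End RationalSpaces.

(** The rationals with the topology [tau] generated by the family [KK]; see
    [k_rat_openE]. *)
Definition k_rat (KK : set (set rat^o)) : Type := rat^o.

Section KRatTopology.
Variable KK : set (set rat^o).

HB.instance Definition _ := Choice.on (k_rat KK).

Definition k_open (U : set (k_rat KK)) :=
  forall K, KK K -> exists2 V : set rat^o, open V & U `&` K = V `&` K.

Let k_openT : k_open setT.
Proof. by move=> K _; exists setT => //; exact: openT. Qed.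

Let k_openI : setI_closed k_open.
Proof.
move=> U V oU oV K KKK; have [U' oU' UE] := oU _ KKK.
have [V' oV' VE] := oV _ KKK; exists (U' `&` V'); first exact: openI.
by rewrite setIIl UE VE -setIIl.
Qed.

Let k_open_bigU (I : Type) (f : I -> set (k_rat KK)) :
  (forall i, k_open (f i)) -> k_open (\bigcup_i f i).
Proof.
move=> fo K KKK; have /choice[V VP] i : exists V : set rat^o,
    open V /\ f i `&` K = V `&` K by have [V] := fo i _ KKK; exists V.
exists (\bigcup_i V i); first by apply: bigcup_open => i _; have [] := VP i.
by rewrite !setI_bigcupl; apply: eq_bigcupr => i _; have [] := VP i.
Qed.

HB.instance Definition _ :=
  isOpenTopological.Build (k_rat KK) k_openT k_openI k_open_bigU.

Lemma k_rat_openE : (open : set (set (k_rat KK))) = k_open.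
Proof. by []. Qed.

End KRatTopology.

(** [Q_pow KK a] is the space [Q_(omega ^ a)] for [a <= omega1], where [KK b]
    is the family of compact sets chosen for the countable ordinal [b].  An
    uncountable [a <= omega1] is [omega1] itself, with [omega ^ omega1 = omega1],
    and gets the usual topology. *)
Definition Q_pow (KK : Ord -> set (set rat^o)) (a : Ord) : topologicalType :=
  if countable [set: a] then k_rat (KK (omega_pow a)) : topologicalType
  else rat^o : topologicalType.

(* Main.v *)
(** The axiom is applied to three ideals on a nondiscrete group [G].  For the
    nowhere dense sets, case (2) makes [G] first countable, hence homeomorphic
    to the rationals by Sierpinski's theorem, and case (1) yields an invariant
    increasing sequence [F] of closed nowhere dense sets that captures the
    convergent sequences.  For the sets [A] such that no sequence
    [u_i a_i v_i], with [a_i] in [A] and [u], [v] convergent, leaves every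
    [F n], case (2) is impossible.  For the sets [A] in which every sequence has
    a convergent subsequence, case (1) makes [G] a [k_omega] space, and case (2)
    gives sequences [h k] without convergent subsequences such that every
    nonempty open set contains a tail of some [h k]; with the two previous
    ideals this yields a sequentially closed set that is not closed.

    In a [k_omega] group the Cantor-Bendixson ranks of the compact sets are
    closed under ordinal addition, so they form the set of ordinals below some
    [omega ^ a].  The same holds for [k_rat], and two such spaces with the same
    ranks are homeomorphic by a back-and-forth argument that extends a
    homeomorphism between compact sets to larger compact sets. *)

Require Import Defs.
From mathcomp Require Import all_boot all_order all_algebra.
From mathcomp Require Import all_classical all_reals all_analysis.
From mathcomp Require Import Rstruct.

Set Implicit Arguments.
Unset Strict Implicit.
Unset Printing Implicit Defensive.

Local Open Scope classical_set_scope.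

(** * Sequences and subsequences *)

(** The contradictions with case (2) have one source: in a sequential space a set without nontrivial
    convergent sequences is closed. So closed sets are built point by point, provided that few of
    the points fall in each set of a family capturing the convergent sequences. The difficulty in
    the last step is to keep products [t * d] from converging, where the [t] near 1 leave every
    [F n] and the [d] come from divergent sequences. The second ideal is designed for this: if the
    [d] stay in one of its members, convergent products prevent the [t] from leaving every [F n].
    The spaces of the classification need not be first countable, so the back-and-forth argument is
    guided by countably many clopen sets that separate points: on each compact set they decide
    convergence. Closure of the ranks under addition serves twice: it makes their order type a power
    of omega, and it provides, close to each point of a compact set, points outside that set of at
    least any prescribed rank. Uniqueness uses discreteness, first countability and the set of ranks
    as invariants. *)

Definition ev (P : nat -> Prop) := exists N, forall n, (N <= n)%N -> P n.
Definition io (P : nat -> Prop) := forall N, exists2 n, (N <= n)%N & P n.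
Definition incr (phi : nat -> nat) := forall n, (phi n < phi n.+1)%N.

Lemma evT (P : nat -> Prop) : (forall n, P n) -> ev P.
Proof. by move=> allP; exists 0%N. Qed.

Lemma ev_imp (P Q : nat -> Prop) : ev P -> (forall n, P n -> Q n) -> ev Q.
Proof. by move=> [N NP] PQ; exists N => n /NP/PQ. Qed.

Lemma io_imp (P Q : nat -> Prop) : io P -> (forall n, P n -> Q n) -> io Q.
Proof. by move=> ioP PQ N; have [n Nn /PQ] := ioP N; exists n. Qed.

Lemma ev_and (P Q : nat -> Prop) : ev P -> ev Q -> ev (fun n => P n /\ Q n).
Proof.
move=> [N NP] [M MQ]; exists (maxn N M) => n; rewrite geq_max => /andP[Nn Mn].
by split; [exact: NP | exact: MQ].
Qed.

Lemma io_ev (P Q : nat -> Prop) : io P -> ev Q -> io (fun n => P n /\ Q n).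
Proof.
move=> ioP [N NQ] M; have [n] := ioP (maxn N M); rewrite geq_max => /andP[Nn Mn].
by exists n => //; split=> //; exact: NQ.
Qed.

Lemma ev_io (P : nat -> Prop) : ev P -> io P.
Proof.
move=> [N NP] M; exists (maxn N M); first exact: leq_maxr.
by apply: NP; exact: leq_maxl.
Qed.

Lemma io_all (P : nat -> Prop) : (forall n, P n) -> io P.
Proof. by move=> allP N; exists N. Qed.

Lemma not_io (P : nat -> Prop) : ~ io P -> ev (fun n => ~ P n).
Proof.
move=> nio; apply: contrapT => nev; apply: nio => N; apply: contrapT => nex.
by apply: nev; exists N => n Nn Pn; apply: nex; exists n.
Qed.

Lemma not_ev (P : nat -> Prop) : ~ ev P -> io (fun n => ~ P n).
Proof.
move=> nev; apply: contrapT => /not_io [N NP]; apply: nev.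
by exists N => n /NP/contrapT.
Qed.

Lemma io_or (P Q : nat -> Prop) : io (fun n => P n \/ Q n) -> io P \/ io Q.
Proof.
move=> ioPQ; apply: contrapT => /not_orP[/not_io[N NP] /not_io[M MQ]].
have [n] := ioPQ (maxn N M); rewrite geq_max => /andP[Nn Mn] [].
  exact: NP.
exact: MQ.
Qed.

Lemma ev_forall_lt (P : nat -> nat -> Prop) k :
  (forall j, (j < k)%N -> ev (P j)) -> ev (fun n => forall j, (j < k)%N -> P j n).
Proof.
elim: k => [|k IH] evP; first by exists 0%N.
have [|N NP] := IH; first by move=> j jk; apply: evP; exact: ltnW.
have [M MP] := evP k (leqnn _); exists (maxn N M) => n.
rewrite geq_max => /andP[Nn Mn] j; rewrite ltnS leq_eqVlt => /orP[/eqP->|jk].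
  exact: MP.
exact: NP.
Qed.

Lemma io_exists_lt (P : nat -> nat -> Prop) k :
  io (fun n => exists2 j, (j < k)%N & P j n) -> exists2 j, (j < k)%N & io (P j).
Proof.
move=> ioP; apply: contrapT => nex.
have [N NP] : ev (fun n => forall j, (j < k)%N -> ~ P j n).
  apply: ev_forall_lt => j jk; apply: not_io => ioPj; apply: nex.
  by exists j.
by have [n Nn [j jk Pjn]] := ioP N; exact: NP Nn j jk Pjn.
Qed.

Lemma incr_ge phi n : incr phi -> (n <= phi n)%N.
Proof. by move=> ip; elim: n => // n IH; exact: leq_ltn_trans IH (ip n). Qed.

Lemma incr_lt phi m n : incr phi -> (m < n)%N -> (phi m < phi n)%N.
Proof.
move=> ip; elim: n => // n IH; rewrite ltnS leq_eqVlt => /orP[/eqP->//|/IH mn].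
exact: ltn_trans mn (ip n).
Qed.

Lemma incr_inj phi : incr phi -> injective phi.
Proof.
move=> ip m n; case: (ltngtP m n) => // /(incr_lt ip) + E.
  by rewrite E ltnn.
by rewrite E ltnn.
Qed.

Lemma incr_comp phi psi : incr phi -> incr psi -> incr (phi \o psi).
Proof. by move=> ip iq n; exact: (incr_lt ip (iq n)). Qed.

Lemma ev_sub (P : nat -> Prop) phi : incr phi -> ev P -> ev (P \o phi).
Proof.
by move=> ip [N NP]; exists N => n Nn; apply: NP; exact: leq_trans (incr_ge n ip).
Qed.

Lemma io_sub (P : nat -> Prop) phi : incr phi -> io (P \o phi) -> io P.
Proof.
move=> ip ioP N; have [n Nn Pn] := ioP N; exists (phi n) => //.
exact: leq_trans (incr_ge n ip).
Qed.

Lemma subseqs (P : nat -> nat -> Prop) : (forall k, io (P k)) ->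
  exists2 phi, incr phi & forall k, P k (phi k).
Proof.
move=> ioP.
have st (x : nat * nat) : {y : nat * nat | y.1 = x.1.+1 /\ (x.2 < y.2)%N /\ P y.1 y.2}.
  by apply: cid; have [n xn Pn] := ioP x.1.+1 x.2.+1; exists (x.1.+1, n).
have [n0 _ P0] := ioP 0%N 0%N.
have [f [f0 fS]] := dependent_choice st (0%N, n0).
have f1 k : (f k).1 = k by elim: k => [|k IH]; [rewrite f0 | rewrite (fS k).1 IH].
exists (fun k => (f k).2) => k; first exact: (fS k).2.1.
by case: k => [|k]; [rewrite f0 | have := (fS k).2.2; rewrite f1].
Qed.

Lemma subseq1 (P : nat -> Prop) : io P ->
  exists2 phi, incr phi & forall k, P (phi k).
Proof. by move=> ioP; exact: (@subseqs (fun=> P)). Qed.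

(** If no value recurs forever, each index [n] has a later index from which on the values seen up to
    [n] never return; iterating this choice [g] gives the injective subsequence. *)
Lemma sub_const_or_inj (T : Type) (f : nat -> T) :
  (exists v, io (fun n => f n = v)) \/
  (exists2 phi, incr phi & injective (f \o phi)).
Proof.
have [|nconst] := pselect (exists v, io (fun n => f n = v)); first by left.
right; have /choice[g gP] : forall n, exists m, (n < m)%N /\
    forall i j, (i <= n)%N -> (m <= j)%N -> f j <> f i.
  move=> n; have [N NP] : ev (fun j => forall i, (i < n.+1)%N -> f j <> f i).
    apply: ev_forall_lt => i _; apply: not_io => h; apply: nconst.
    by exists (f i).
  exists (maxn N n.+1); split; first exact: leq_maxr.
  by move=> i j ini; rewrite geq_max => /andP[Nj _]; exact: NP.
have ip : incr (fun k => iter k g 0%N) by move=> k /=; exact: (gP _).1.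
exists (fun k => iter k g 0%N) => //.
have key a b : (a < b)%N -> f (iter b g 0%N) <> f (iter a g 0%N).
  move=> ab; apply: (gP (iter a g 0%N)).2 => //.
  by move: ab; rewrite leq_eqVlt => /orP[/eqP<- //|/(incr_lt ip)/ltnW].
by move=> a b /= E; case: (ltngtP a b) => // /key; rewrite E.
Qed.

Lemma inj_ev_neq (T : Type) (u : nat -> T) x : injective u -> ev (fun n => u n <> x).
Proof.
move=> uI; apply: not_io => iox; have [n _ un] := iox 0%N.
by have [m nm um] := iox n.+1; move: nm; rewrite (uI m n) ?ltnn // um un.
Qed.

Lemma inj_ev_finite (T : Type) (u : nat -> T) (A : set T) : injective u ->
  finite_set A -> ev (fun n => ~ A (u n)).
Proof.
move=> uI /(@finite_seqP {classic T})[s ->].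
elim: s => [|x s [N NP]]; first by exists 0%N => n _ /=; rewrite in_nil.
have [M MP] := inj_ev_neq x uI; exists (maxn N M) => n.
rewrite geq_max => /andP[Nn Mn] /=; rewrite inE => /orP[/eqP|]; first exact: MP.
exact: NP.
Qed.

Lemma infinite_seq (T : Type) (A : set T) : infinite_set A ->
  exists2 u : nat -> T, injective u & forall n, A (u n).
Proof.
elim/Ppointed: T => T in A *; first by rewrite emptyE => /infinite_setN0[].
move=> /infiniteP/pcard_leP[f]; exists f.
  by move=> m n /inj; rewrite !inE => ->.
by move=> n; apply: funS.
Qed.

Lemma inj_infinite (T : Type) (u : nat -> T) (A : set T) :
  injective u -> (forall n, A (u n)) -> infinite_set A.
Proof.
move=> uI uA fA; have [N NP] := inj_ev_finite uI fA.
exact: NP (leqnn N) (uA N).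
Qed.

Lemma countable_rank (T : Type) : countable [set: T] -> exists f : T -> nat, injective f.
Proof. by move=> /countable_injP[f fI]; exists f => x y; apply: fI; rewrite inE. Qed.

Lemma countable_union (T : Type) (A B : set T) :
  countable A -> countable B -> countable (A `|` B).
Proof.
move=> cA cB; rewrite (_ : A `|` B = \bigcup_(b in [set: bool]) (if b then A else B)).
  by apply: bigcup_countable => // -[].
by rewrite predeqE => x; split=> [[?|?]|[[] _ ?]]; [exists true|exists false|left|right].
Qed.

Lemma countable_enum (T : Type) (A : set T) (x0 : T) : countable A -> A x0 ->
  exists2 e : nat -> T, (forall n, A (e n)) & forall x, A x -> exists n, e n = x.
Proof.
move=> /countable_injP[f fI] Ax0.
have /choice[e eP] : forall n, exists x, A x /\ ((exists2 y, A y & f y = n) -> f x = n).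
  move=> n; have [[y Ay fy]|nex] := pselect (exists2 y, A y & f y = n).
    by exists y.
  by exists x0; split.
exists e => [n|x Ax]; first exact: (eP n).1.
exists (f x); apply: fI; rewrite ?inE //; first exact: (eP _).1.
by apply: (eP _).2; exists x.
Qed.

(** * Topological preliminaries *)

Section Topology.
Variable X : topologicalType.
Implicit Types (A B U V C : set X) (x y : X) (u : nat -> X).

Lemma closureP A x :
  closure A x <-> forall U, open U -> U x -> exists2 y, A y & U y.
Proof.
split=> [cA U oU Ux|cA B].
  by have [|y [Ay Uy]] := cA U; [exact: open_nbhs_nbhs|exists y].
rewrite nbhsE => -[U [oU Ux] UB]; have [y Ay Uy] := cA U oU Ux.
by exists y; split=> //; exact: UB.
Qed.

Lemma closedP A : closed A <-> forall x, closure A x -> A x.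
Proof. by []. Qed.

(** Convergence is phrased with [ev] rather than with filters, so that it combines with [io] and
    with subsequences. *)
Definition cvs u x := forall U, open U -> U x -> ev (fun n => U (u n)).

Lemma cvs_sub u x phi : incr phi -> cvs u x -> cvs (u \o phi) x.
Proof. by move=> ip ux U oU Ux; exact: (ev_sub ip (ux U oU Ux)). Qed.

Lemma cvs_cst x : cvs (fun=> x) x.
Proof. by move=> U _ Ux; exact: evT. Qed.

Lemma cvs_closure u x A : cvs u x -> io (fun n => A (u n)) -> closure A x.
Proof.
move=> ux ioA; apply/closureP => U oU Ux.
by have [n _ []] := io_ev ioA (ux U oU Ux) 0%N; exists (u n).
Qed.

Lemma cvs_ev u v x : cvs u x -> ev (fun n => v n = u n) -> cvs v x.
Proof.
move=> ux uv U oU Ux; apply: ev_imp (ev_and (ux U oU Ux) uv) _.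
by move=> n [Uu ->].
Qed.

Definition zdim := forall U x, open U -> U x ->
  exists C, [/\ open C, closed C, C x & C `<=` U].

Lemma seq_to_cvs C x : seq_to C x ->
  exists u, [/\ injective u, forall n, C (u n) & cvs u x].
Proof.
move=> [Cinf CU]; have [u uI uC] := infinite_seq Cinf.
exists u; split=> // U oU Ux; have /(inj_ev_finite uI) : finite_set (C `\` U).
  by apply: CU; exact: open_nbhs_nbhs.
move=> E; apply: ev_imp E _ => n nCU; apply: contrapT => nU; apply: nCU.
by split.
Qed.

Lemma cvs_seq_to u x : injective u -> cvs u x -> seq_to (range u) x.
Proof.
move=> uI ux; split; first by apply: (inj_infinite uI) => n; exists n.
move=> V; rewrite nbhsE => -[U [oU Ux] UV]; have [N NP] := ux U oU Ux.
apply: (@sub_finite_set _ _ (u @` `I_N)); last exact: finite_image.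
move=> _ [[n _ <-] nV]; exists n => //=; case: (ltnP n N) => // /NP /UV.
by [].
Qed.

Lemma sequentialP A : sequential X -> ~ closed A ->
  exists u x, [/\ injective u, forall n, A (u n), cvs u x & ~ A x].
Proof.
move=> sX /sX [C [x [CA /seq_to_cvs[u [uI uC ux]] nAx]]].
by exists u, x; split=> // n; exact: CA.
Qed.

(** The transfinitely iterated sequential closure; its induction principle replaces induction on the
    sequential order of a point. *)
Inductive sclos A : X -> Prop :=
| sclos_base x : A x -> sclos A x
| sclos_lim u x : (forall n, sclos A (u n)) -> cvs u x -> sclos A x.

Lemma sequential_closure A x : sequential X -> closure A x -> sclos A x.
Proof.
move=> sX Ax; suff /closedP cl : closed (sclos A).
  by apply: cl; apply/closureP => U oU Ux; move/closureP : Ax => /(_ U oU Ux)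
    [y Ay Uy]; exists y => //; exact: sclos_base.
apply: contrapT => /(sequentialP sX) [u [y [_ uA uy]]]; apply.
exact: sclos_lim uA uy.
Qed.

(** Injectivity of [f] leaves finitely many [i] with [f i <= N], so only finitely many open sets are
    intersected. *)
Lemma finite_bigcap_open (I : Type) (f : I -> nat) (W : I -> set X) N x :
  injective f -> (forall i, open (W i)) ->
  (forall i, (f i <= N)%N -> W i x) ->
  exists U, [/\ open U, U x & forall i y, (f i <= N)%N -> U y -> W i y].
Proof.
move=> fI oW; elim: N => [|N IH] Wx; last first.
  have [|U [oU Ux UW]] := IH; first by move=> i iN; apply: Wx; exact: leqW.
  have [[i fi]|nex] := pselect (exists i, f i = N.+1).
    exists (U `&` W i); split; first exact: openI.
      by split=> //; apply: Wx; rewrite fi.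
    move=> j y; rewrite leq_eqVlt => /orP[/eqP fj|fj] [Uy Wy]; last exact: UW.
    by have -> : j = i by apply: fI; rewrite fj fi.
  exists U; split=> // j y; rewrite leq_eqVlt => /orP[/eqP fj|fj]; last exact: UW.
  by case: nex; exists j.
have [[i fi]|nex] := pselect (exists i, f i = 0%N).
  exists (W i); split=> //; first by apply: Wx; rewrite fi.
  move=> j y; rewrite leqn0 => /eqP fj.
  by have -> : j = i by apply: fI; rewrite fj fi.
exists setT; split=> //; first exact: openT.
by move=> j y; rewrite leqn0 => /eqP fj; case: nex; exists j.
Qed.

Lemma bigcap_lt_open (W : nat -> set X) N x :
  (forall i, open (W i)) -> (forall i, (i < N)%N -> W i x) ->
  exists U, [/\ open U, U x & forall i y, (i < N)%N -> U y -> W i y].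
Proof.
case: N => [|N] oW Wx.
  by exists setT; split=> //; exact: openT.
exact: (@finite_bigcap_open nat id W N x (fun _ _ => id)).
Qed.

End Topology.
Arguments cvs {X} u x.
Arguments zdim X : clear implicits.

Section Separation.
Variable X : topologicalType.
Hypotheses (X_T1 : accessible_space X) (X0 : zdim X).
Implicit Types (A U C : set X) (x y : X) (u : nat -> X).

Lemma T1_open_neq x : open [set y | y <> x].
Proof.
rewrite (_ : mkset _ = ~` [set x]); last by [].
by rewrite openC; exact: accessible_closed_set1.
Qed.

Lemma clopen_sep x y : x <> y -> exists C, [/\ open C, closed C, C x & ~ C y].
Proof.
move=> xy; have [C [oC cC Cx Cy]] := X0 (@T1_open_neq y) xy.
by exists C; split=> // /Cy.
Qed.

Lemma cvs_unique u x y : cvs u x -> cvs u y -> x = y.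
Proof.
move=> ux uy; apply: contrapT => /clopen_sep[C [oC cC Cx nCy]].
have oC' : open (~` C) by rewrite openC.
by have [n _ []] := ev_io (ev_and (ux C oC Cx) (uy _ oC' nCy)) 0%N.
Qed.

Lemma cvs_io_cst u x y : cvs u x -> io (fun n => u n = y) -> x = y.
Proof.
move=> ux /subseq1[phi ip uy]; apply: (cvs_unique (cvs_sub ip ux)).
by apply: (@cvs_ev _ (fun=> y)); [exact: cvs_cst|exact: evT].
Qed.

Lemma closure_infinite A x : closure A x -> ~ A x ->
  forall U, open U -> U x -> infinite_set (A `&` U).
Proof.
move=> cA nAx U oU Ux fA.
have cF : closed (A `&` U) := accessible_finite_set_closed.1 X_T1 _ fA.
have oV : open (U `&` ~` (A `&` U)) by apply: openI => //; rewrite openC.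
have [|y Ay [Uy ny]] := (closureP A x).1 cA _ oV; first by split=> // -[].
by apply: ny.
Qed.

Lemma open_finiteC A : finite_set A -> open (~` A).
Proof. by move=> fA; rewrite openC; exact: accessible_finite_set_closed.1. Qed.

End Separation.

Section CountableZeroDim.
Variable R : realType.
Local Open Scope ring_scope.
Import Order.TTheory GRing.Theory Num.Theory numFieldNormedType.Exports.

(** A countable set is Lebesgue null, whereas the interval has measure 1. *)
Lemma itv01_avoid (A : set R) : countable A -> exists2 r : R, 0 < r < 1 & ~ A r.
Proof.
move=> cA; apply: contrapT => nex.
have /countable_lebesgue_measure0 : countable (`]0, 1[%classic : set R).
  apply: sub_countable cA; apply: subset_card_le => r; rewrite /= in_itv /= => r01.
  by apply: contrapT => nA; apply: nex; exists r.
rewrite lebesgue_measure_itv /= lte_fin ltr01 sube0 => /eqP.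
by rewrite eqe oner_eq0.
Qed.

(** A continuous function separating a point from a closed set has countable range, hence omits some
    [r] strictly between 0 and 1; the set where it is below [r] is then clopen. *)
Lemma countable_zdim_real (X : topologicalType) :
  countable [set: X] -> Tychonoff X -> zdim X.
Proof.
move=> cX [_ crX] U x oU Ux.
have cU : closed (~` U) by rewrite closedC.
have : uniform_separator [set x] (~` U) by apply: crX => // /(_ Ux).
move=> /(@uniform_separatorP _ R)[f [cf f01 fx fU]].
have /itv01_avoid[r /andP[r0 r1] nr] : countable (range f).
  exact: card_le_trans (card_image_le f setT) cX.
have oL : open (f @^-1` [set t | t < r]) by apply: open_comp => [? _|]; [exact: cf|exact: open_lt].
have oR : open (f @^-1` [set t | r < t]) by apply: open_comp => [? _|]; [exact: cf|exact: open_gt].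
have LE : f @^-1` [set t | t < r] = ~` (f @^-1` [set t | r < t]).
  rewrite predeqE => y /=; split=> [fr /(lt_trans fr)|/negP]; first by rewrite ltxx.
  rewrite -leNgt le_eqVlt => /orP[/eqP fr|//].
  by case: nr; exists y.
exists (f @^-1` [set t | t < r]); split=> //.
- by rewrite LE closedC.
- have -> : (f @^-1` [set t | t < r]) x = (f x < r) by [].
  by rewrite (fx (f x)) //; exists x.
- move=> y /= fr; apply: contrapT => nU; move: fr.
  rewrite (fU (f y)); last by exists y.
  by move=> /(lt_trans r1); rewrite ltxx.
Qed.

End CountableZeroDim.

Lemma countable_zdim (X : topologicalType) :
  countable [set: X] -> Tychonoff X -> zdim X.
Proof. exact: (@countable_zdim_real Rdefinitions.RbaseSymbolsImpl.R). Qed.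

(** * Divergent sets in sequential spaces *)

Section Divergent.
Variable X : topologicalType.
Implicit Types (A P Q : set X) (u h : nat -> X).

(** In a sequential space such a set is closed by [divergent_set_closed], and so are its subsets.
    The closed sets that contradict case (2) of the axiom are all obtained in this way. *)
Definition divergent_set P := forall u x, injective u -> (forall n, P (u n)) -> ~ cvs u x.

Definition divergent h := forall phi x, incr phi -> ~ cvs (h \o phi) x.

Lemma divergent_setS P Q : P `<=` Q -> divergent_set Q -> divergent_set P.
Proof. by move=> PQ dQ u x uI uP; apply: dQ => // n; exact/PQ. Qed.

Lemma divergent_set_io P u x : divergent_set P -> injective u -> cvs u x ->
  ~ io (fun n => P (u n)).
Proof.
move=> dP uI ux /subseq1[phi ip uP]; apply: (dP (u \o phi) x) => //.
  by apply: inj_comp => //; exact: incr_inj.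
exact: cvs_sub.
Qed.

Lemma divergent_setU P Q : divergent_set P -> divergent_set Q -> divergent_set (P `|` Q).
Proof.
move=> dP dQ u x uI uPQ ux.
have /io_or[] : io (fun n => P (u n) \/ Q (u n)) by apply: io_all.
  exact: divergent_set_io dP uI ux.
exact: divergent_set_io dQ uI ux.
Qed.

Lemma divergent_set_lt (P : nat -> set X) k : (forall j, divergent_set (P j)) ->
  divergent_set [set x | exists2 j, (j < k)%N & P j x].
Proof.
move=> dP u x uI uP ux.
have /io_exists_lt[j _] : io (fun n => exists2 j, (j < k)%N & P j (u n)).
  by apply: io_all.
exact: divergent_set_io (dP j) uI ux.
Qed.

Lemma divergent_set_finite P : finite_set P -> divergent_set P.
Proof. by move=> fP u x uI uP _; exact: (inj_infinite uI uP). Qed.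

Lemma divergent_set_local P :
  (forall x, exists U, [/\ open U, U x & divergent_set (P `&` U)]) -> divergent_set P.
Proof.
move=> loc u x uI uP ux; have [U [oU Ux dU]] := loc x.
apply: (divergent_set_io dU uI ux); apply: ev_io; apply: ev_imp (ux U oU Ux) _.
by move=> n Un; split.
Qed.

Lemma divergent_set_capture P (B : nat -> set X) :
  (forall u x, injective u -> cvs u x -> exists n, io (fun i => B n (u i))) ->
  (forall n, divergent_set (P `&` B n)) -> divergent_set P.
Proof.
move=> cap dP u x uI uP ux; have [n ion] := cap u x uI ux.
by apply: (divergent_set_io (dP n) uI ux); apply: io_imp ion _ => i Bi; split.
Qed.

Lemma divergent_set_closed P : sequential X -> divergent_set P -> closed P.
Proof.
move=> sX dP; apply: contrapT => /(sequentialP sX)[u [x [uI uP ux _]]].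
exact: dP uI uP ux.
Qed.

Lemma divergent_sub h phi : incr phi -> divergent h -> divergent (h \o phi).
Proof. by move=> ip dh psi x iq; apply: (dh (phi \o psi) x); exact: incr_comp. Qed.

Lemma divergent_neq h x : divergent h -> ev (fun n => h n <> x).
Proof.
move=> dh; apply: not_io => /subseq1[phi ip hx]; apply: (dh phi x ip).
by apply: (@cvs_ev _ (fun=> x)); [exact: cvs_cst|exact: evT].
Qed.

Lemma tends_incr (i : nat -> nat) : (forall m, ev (fun n => (m < i n)%N)) ->
  exists2 psi, incr psi & incr (i \o psi).
Proof.
move=> it; have /choice[g gP] : forall m, exists n, (m < n)%N /\ (i m < i n)%N.
  move=> m; have [N NP] := it (i m); exists (maxn N m.+1).
  by split; [rewrite leq_max ltnSn orbT | apply: NP; exact: leq_maxl].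
exists (fun k => iter k g 0%N) => k /=; first exact: (gP _).1.
exact: (gP _).2.
Qed.

(** An injective sequence in the range of [h] uses indices that tend to infinity, so a subsequence
    of it is a subsequence of [h]. *)
Lemma divergent_range h : divergent h -> divergent_set (range h).
Proof.
move=> dh u x uI uh ux.
have /choice[i iP] : forall n, exists k, h k = u n by move=> n; have [k _ hk] := uh n; exists k.
have iI : injective i by move=> m n E; apply: uI; rewrite -!iP E.
have [|psi ip iip] := @tends_incr i.
  move=> m; apply: ev_imp (inj_ev_finite (A := `I_m.+1) iI (finite_II _)) _ => n /= /negP.
  by rewrite -ltnNge.
apply: (dh _ x iip); apply: (cvs_ev (cvs_sub ip ux)); apply: evT => n /=.
exact: iP.
Qed.

End Divergent.
Arguments divergent_set {X} P.
Arguments divergent {X} h.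

(** * Topological groups *)

Section Group.
Variable G : topologicalGroupType.
Local Open Scope group_scope.
Implicit Types (x y g : G) (u v : nat -> G) (U V W A : set G).

Lemma mul_open W x y : open W -> W (x * y) ->
  exists U V, [/\ open U, U x, open V, V y & forall a b, U a -> V b -> W (a * b)].
Proof.
move=> oW Wxy.
have : nbhs (x * y) W by exact: open_nbhs_nbhs.
move/(@mulg_continuous G (x, y)) => -[[U V] /= [nU nV] UVW].
move: nU nV; rewrite !nbhsE => -[U' [oU' U'x] U'U] [V' [oV' V'y] V'V].
exists U', V'; split=> // a b /U'U Ua /V'V Vb; exact: (UVW (a, b)).
Qed.

Lemma inv_open W : open W -> open [set x | W x^-1].
Proof. by move=> oW; apply: open_comp => // ? _; exact: invg_continuous. Qed.

Lemma open_mull W g : open W -> open [set x | W (g * x)].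
Proof.
move=> oW; rewrite openE => x /= Wgx; have [U [V [_ Ug oV Vx UV]]] := mul_open oW Wgx.
by rewrite /interior nbhsE; exists V => // y Vy; exact: UV.
Qed.

Lemma open_mulr W g : open W -> open [set x | W (x * g)].
Proof.
move=> oW; rewrite openE => x /= Wxg; have [U [V [oU Ux _ Vg UV]]] := mul_open oW Wxg.
by rewrite /interior nbhsE; exists U => // y Uy; exact: UV.
Qed.

Lemma cvsM u v x y : cvs u x -> cvs v y -> cvs (fun n => u n * v n) (x * y).
Proof.
move=> ux vy W oW /(mul_open oW)[U [V [oU Ux oV Vy UV]]].
by apply: ev_imp (ev_and (ux U oU Ux) (vy V oV Vy)) _ => n [/UV]; exact.
Qed.

Lemma cvsV u x : cvs u x -> cvs (fun n => (u n)^-1) x^-1.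
Proof. by move=> ux W oW Wx; exact: (ux _ (inv_open oW) Wx). Qed.

Lemma cvsMl u x g : cvs u x -> cvs (fun n => g * u n) (g * x).
Proof. by move=> ux; apply: cvsM => //; exact: cvs_cst. Qed.

Lemma cvsMr u x g : cvs u x -> cvs (fun n => u n * g) (x * g).
Proof. by move=> ux; apply: cvsM => //; exact: cvs_cst. Qed.

Lemma nbhs1_cube W : open W -> W 1 ->
  exists V, [/\ open V, V 1 & forall a b c, V a -> V b -> V c -> W (a * b * c)].
Proof.
move=> oW W1; have : W (1 * 1) by rewrite mulg1.
move=> /(mul_open oW)[U [V [oU U1 oV V1 UV]]].
have : U (1 * 1) by rewrite mulg1.
move=> /(mul_open oU)[U1' [U2 [oU1 U11 oU2 U21 UU]]].
exists (U1' `&` U2 `&` V); split; first by do 2!apply: openI => //.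
  by [].
by move=> a b c [[Ua _] _] [[_ Ub] _] [_ Vc]; apply: UV => //; exact: UU.
Qed.

Lemma nbhs_mul1 W z : open W -> W z ->
  exists U V, [/\ open U, U 1, open V, V z & forall a b, U a -> V b -> W (a * b)].
Proof. by move=> oW Wz; apply: mul_open; rewrite ?mul1g. Qed.

End Group.

(** * Ideals *)

Lemma infinite_range_io (T : Type) (w : nat -> T) (A : set T) :
  infinite_set (range w `&` A) -> io (fun n => A (w n)).
Proof.
move=> inf; apply: contrapT => /not_io[N NP]; apply: inf.
apply: (@sub_finite_set _ _ (w @` `I_N)); last exact: finite_image.
move=> _ [[n _ <-] Aw]; exists n => //=.
by case: (ltnP n N) => // /NP.
Qed.

Section SequenceIdeal.
Variable G : topologicalGroupType.
Variable Psi : (nat -> G) -> Prop.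
Hypothesis Psi_sub : forall a phi, incr phi -> Psi a -> Psi (a \o phi).
Hypothesis Psi_cst : forall g, ~ Psi (fun=> g).
Implicit Types A : set G.
Local Open Scope group_scope.

Definition seq_ideal : set (set G) :=
  [set A | forall a, (forall n, A (a n)) -> ~ Psi a].

Lemma not_seq_ideal A : ~ seq_ideal A -> exists2 a, forall n, A (a n) & Psi a.
Proof.
move=> nA; apply: contrapT => nex; apply: nA => a aA Pa.
by apply: nex; exists a.
Qed.

Lemma seq_ideal_ev A (U : set G) a : (forall n, A (a n)) -> Psi a ->
  seq_ideal (A `\` U) -> ev (fun n => U (a n)).
Proof.
move=> aA Pa IAU; apply: contrapT => /not_ev/subseq1[phi ip nU].
apply: (IAU (a \o phi)); last exact: Psi_sub.
by move=> n; split; [exact: aA|exact: nU].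
Qed.

(** A sequence in a finite set has a constant subsequence, which [Psi_cst] excludes; a sequence in a
    union has a subsequence in one of the two parts. *)
Lemma seq_ideal_is_ideal : is_ideal seq_ideal.
Proof.
split.
- move=> A fA a aA Pa; have [[v iov]|[phi ip inj]] := sub_const_or_inj a.
    have [phi ip av] := subseq1 iov; apply: (@Psi_cst v).
    rewrite (_ : (fun=> v) = a \o phi); first exact: Psi_sub.
    by apply/funext => n /=; rewrite av.
  exact: (inj_infinite inj (fun n => aA (phi n)) fA).
- by move=> A B AB IB a aA; apply: IB => n; exact: AB.
- move=> A B IA IB a aAB Pa.
  have /io_or[] : io (fun n => A (a n) \/ B (a n)) by apply: io_all.
    by move=> /subseq1[phi ip aA]; exact: IA aA (Psi_sub ip Pa).
  by move=> /subseq1[phi ip aB]; exact: IB aB (Psi_sub ip Pa).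
Qed.

(** A single bad sequence [a] in [Y] is enough: along it [f] either repeats a value forever, or is
    injective on a subsequence, and then a member of [J] meets its infinite range. *)
Lemma seq_ideal_tame : tame seq_ideal.
Proof.
move=> Y f J /not_seq_ideal[a aY Pa] idJ hitJ.
suff [A JA ioA] : exists2 A, J A & io (fun n => A (f (a n))).
  exists A => //; have [phi ip aA] := subseq1 ioA => IYA.
  apply: (IYA (a \o phi)); last exact: Psi_sub.
  by move=> n; split; [exact: aY|exact: aA].
have [[v iov]|[phi ip inj]] := sub_const_or_inj (f \o a).
  exists [set v]; first exact: (ideal_finite idJ).
  exact: iov.
have [|Z [->]|A JA hA] := hitJ [set (range (f \o a \o phi))].
- exact: finite_set_countable.
- split=> //; apply: (inj_infinite inj) => n; by exists n.
exists A => //; apply: (io_sub ip).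
exact: infinite_range_io (hA _ erefl).
Qed.

Hypothesis Psi_mull : forall g a, Psi a -> Psi (fun n => g * a n).
Hypothesis Psi_mulr : forall g a, Psi a -> Psi (fun n => a n * g).
Hypothesis Psi_inv : forall a, Psi a -> Psi (fun n => (a n)^-1).

Lemma seq_ideal_invariant : invariant_ideal seq_ideal.
Proof.
move=> A IA; split.
- move=> g a aA /(Psi_mull g^-1); apply: IA => n.
  by have [x Ax <-] := aA n; rewrite mulKg.
- move=> g a aA /(Psi_mulr g^-1); apply: IA => n.
  by have [x Ax <-] := aA n; rewrite mulgK.
- move=> a aA /Psi_inv; apply: IA => n.
  by have [x Ax <-] := aA n; rewrite invgK.
Qed.

End SequenceIdeal.

Section WeaklyClosed.
Variable G : topologicalGroupType.
Local Open Scope group_scope.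
Implicit Types A : set G.

Lemma seq_to1_translate (C : set G) : seq_to C 1 ->
  exists c : nat -> G, [/\ injective c, cvs c 1 & forall A x,
    almost_subset [set c * x | c in C] A -> ev (fun n => A (c n * x))].
Proof.
move=> /seq_to_cvs[c [cI cC c1]]; exists c; split=> // A x fin.
have inj : injective (fun n => c n * x) by move=> m n /mulIg/cI.
apply: ev_imp (inj_ev_finite inj fin) _ => n nD; apply: contrapT => nA.
by apply: nD; split=> //; exists (c n).
Qed.

(** The backward implication is free, since [A] lies in the larger set; and replacing [C] by an
    injective sequence inside it only enlarges the set of added points. *)
Lemma weakly_closedI (I : set (set G)) : is_ideal I ->
  (forall A (c : nat -> G), injective c -> cvs c 1 -> I A ->
     I (A `|` [set x | ev (fun n => A (c n * x))])) ->
  weakly_closed I.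
Proof.
move=> idI H A C /seq_to1_translate[c [cI c1 cA]]; split=> [IA|].
  apply: (ideal_sub idI) (H A c cI c1 IA) => x [|/cA]; [by left|by right].
by apply: (ideal_sub idI) => x; left.
Qed.

End WeaklyClosed.

(** * The nowhere dense ideal *)

Definition nwd (X : topologicalType) (A : set X) := forall U, open U -> U !=set0 ->
  exists V, [/\ open V, V !=set0, V `<=` U & V `&` A = set0].

Section NowhereDense.
Variable X : topologicalType.
Implicit Types A B U V : set X.

Lemma nwdU A B : nwd A -> nwd B -> nwd (A `|` B).
Proof.
move=> nA nB U oU U0; have [V [oV V0 VU VA]] := nA U oU U0.
have [W [oW W0 WV WB]] := nB V oV V0; exists W; split=> //.
  exact: subset_trans VU.
rewrite setIUr WB setU0 -subset0 => x [Wx Ax].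
by rewrite -VA; split=> //; exact: WV.
Qed.

Lemma nwdS A B : A `<=` B -> nwd B -> nwd A.
Proof.
move=> AB nB U oU U0; have [V [oV V0 VU VB]] := nB U oU U0; exists V; split=> //.
by rewrite -subset0 => x [Vx /AB Bx]; rewrite -VB.
Qed.

Lemma nwd_closure A : nwd A -> nwd (closure A).
Proof.
move=> nA U oU U0; have [V [oV V0 VU VA]] := nA U oU U0; exists V; split=> //.
rewrite -subset0 => x [Vx /closureP/(_ V oV Vx)[y Ay Vy]].
by have : (V `&` A) y by []; rewrite VA.
Qed.

Lemma not_nwd A : ~ nwd A -> exists U, [/\ open U, U !=set0 & U `<=` closure A].
Proof.
move=> nA; apply: contrapT => nex; apply: nA => U oU U0; apply: contrapT => nV.
apply: nex; exists U; split=> // x Ux; apply/closureP => W oW Wx.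
apply: contrapT => nW; apply: nV; exists (U `&` W); split.
- exact: openI.
- by exists x.
- by move=> y [].
- by rewrite -subset0 => y [[_ Wy] Ay]; apply: nW; exists y.
Qed.

Lemma nwd_interior A U : nwd A -> open U -> U `<=` closure A -> U = set0.
Proof.
move=> nA oU UA; apply: contrapT => /eqP/set0P U0.
have [V [oV [x Vx] VU VA]] := nA U oU U0.
have /closureP/(_ V oV Vx)[y Ay Vy] := UA x (VU x Vx).
by have : (V `&` A) y by []; rewrite VA.
Qed.

Lemma nwd_preimage (f g : X -> X) A : cancel f g -> cancel g f ->
  (forall U, open U -> open (f @^-1` U)) -> (forall U, open U -> open (g @^-1` U)) ->
  nwd A -> nwd (f @` A).
Proof.
move=> fK gK fo go nA U oU [x Ux].
have [|V [oV [y Vy] VU VA]] := nA (f @^-1` U) (fo U oU).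
  by exists (g x); rewrite /= gK.
exists (g @^-1` V); split=> //; first exact: go.
- by exists (f y); rewrite /= fK.
- by move=> z /VU /=; rewrite gK.
- rewrite -subset0 => z [/= Vgz [a Aa fa]].
  have : (V `&` A) a by split=> //; rewrite -(fK a) fa.
  by rewrite VA.
Qed.

Hypothesis X_T1 : accessible_space X.
Hypothesis crowded : forall x : X, ~ open [set x].

Lemma nwd_point (x : X) : nwd [set x].
Proof.
move=> U oU [y Uy]; exists (U `&` [set z | z <> x]); split.
- by apply: openI => //; exact: (T1_open_neq X_T1).
- apply: contrapT => nex; have E : U = [set y].
    rewrite predeqE => z; split=> [Uz|->//]; apply: contrapT => zy.
    have [yx|yx] := pselect (y = x).
      by apply: nex; exists z; split=> //= zx; apply: zy; rewrite zx yx.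
    by apply: nex; exists y.
  by apply: (@crowded y); rewrite -E.
- by move=> z [].
- by rewrite -subset0 => z [[_ zx] /zx].
Qed.

Lemma nwd_ideal : is_ideal [set A : set X | nwd A].
Proof.
split; [|by move=> A B /nwdS|by move=> A B; exact: nwdU] => A.
move=> /(@finite_seqP {classic X})[s ->].
elim: s => [|x s IH].
  move=> U oU U0; exists U; split=> //; rewrite -subset0 => x [_].
  by rewrite /= in_nil.
apply: nwdS (nwdU (@nwd_point x) IH) => y /=; rewrite inE => /orP[/eqP->|]; first by left.
by right.
Qed.

Section Tame.
Variable f : X -> nat.

(** A certificate that [x] is a limit of [Y] through every [J] hitting [YY]. Its countability lets
    one member of an omega-hitting ideal serve the certificates of countably many points at once. *)
Definition hit_family (Y : set X) (x : X) (YY : set (set nat)) :=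
  [/\ countable YY, forall Z, YY Z -> infinite_set Z &
   forall J : set nat, (forall Z, YY Z -> infinite_set (Z `&` J)) ->
     closure (Y `&` f @^-1` J) x].

(** Induction on the sequential closure. If infinitely many [u n] are in the closure of a single
    fiber, the values of these fibers either recur or form one infinite set to be hit; otherwise the
    families of all late [u n] are united. *)
Lemma sclos_hit (Y : set X) x : sclos Y x ->
  (exists v, closure (Y `&` f @^-1` [set v]) x) \/ (exists YY, hit_family Y x YY).
Proof.
elim=> {x} [x Yx|u x _ IH ux].
  by left; exists (f x); apply: subset_closure; split.
have cl B : io (fun n => closure B (u n)) -> closure B x.
  by move=> ioB; apply: (@closed_closure _ B); exact: cvs_closure ioB.
pose P n := exists v, closure (Y `&` f @^-1` [set v]) (u n).
have [|/not_io[N NP]] := pselect (io P).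
  move=> /subseq1[phi ip /choice[w wP]].
  have [[v iov]|[psi ips inj]] := sub_const_or_inj w.
    left; exists v; apply: cl; apply: (io_sub ip).
    by apply: io_imp iov _ => n /= wv; rewrite -wv.
  right; exists [set range (w \o psi)]; split.
  - exact: finite_set_countable.
  - by move=> _ ->; apply: (inj_infinite inj) => n; exists n.
  - move=> J /(_ _ erefl)/infinite_range_io ioJ; apply: cl.
    apply: (io_sub (incr_comp ip ips)); apply: io_imp ioJ _ => n /= Jw.
    by apply: closureS (wP (psi n)) => y [Yy /= ->].
right; have /choice[YY YYP] : forall n, exists YY, (N <= n)%N -> hit_family Y (u n) YY.
  move=> n; case: (leqP N n) => [/NP nP|_]; last by exists set0.
  by have [/nP//|[YY]] := IH n; exists YY.
exists (\bigcup_(n in [set n | (N <= n)%N]) YY n); split.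
- by apply: bigcup_countable => // n /= Nn; have [] := YYP n Nn.
- by move=> Z [n /= Nn YZ]; have [_ iYY _] := YYP n Nn; exact: iYY.
- move=> J JP; apply: cl; apply: ev_io; exists N => n Nn.
  by have [_ _] := YYP n Nn; apply=> Z YZ; apply: JP; exists n.
Qed.

End Tame.

(** If all fibers are nowhere dense, every point of an open [U] inside the closure of [Y] receives a
    hit family; one member of [J] hits all these families, and its preimage in [Y] is then dense in
    [U]. *)
Lemma nwd_tame : countable [set: X] -> sequential X -> tame [set A : set X | nwd A].
Proof.
move=> cX sX Y f J nY idJ hitJ; have [U [oU U0 UY]] := not_nwd nY.
have [[v nv]|nfib] := pselect (exists v, ~ nwd (Y `&` f @^-1` [set v])).
  by exists [set v] => //; exact: (ideal_finite idJ).
have fib v : nwd (Y `&` f @^-1` [set v]) by apply: contrapT => nv; apply: nfib; exists v.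
have fibF (V : set nat) : finite_set V -> nwd (Y `&` f @^-1` V).
  move=> /finite_seqP[s ->]; elim: s => [|v s IH].
    by move=> W oW W0; exists W; split=> //; rewrite -subset0 => x [_ []]; rewrite /= in_nil.
  apply: nwdS (nwdU (fib v) IH) => x [Yx] /=; rewrite inE => /orP[/eqP|] h; first by left.
  by right.
have /choice[YY YYP] : forall x, exists YY, U x -> hit_family f Y x YY.
  move=> x; have [Ux|] := pselect (U x); last by exists set0.
  (* If infinitely many fibers accumulate at [x], the set [V] of their values is itself the family.
     Otherwise these finitely many nowhere dense fibers are removed from [Y], which leaves [x] in
     the closure and refutes the first alternative of [sclos_hit]. *)
  pose V := [set v | closure (Y `&` f @^-1` [set v]) x].
  have [fV|iV] := pselect (finite_set V); last first.
    exists [set V] => _; split=> [|_ -> //|K /(_ _ erefl)/infinite_setN0[v [Vv Kv]]].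
      exact: finite_set_countable.
    by apply: closureS Vv => y [Yy /= ->].
  pose Y' := Y `\` f @^-1` V.
  have /(sequential_closure sX)/(sclos_hit f)[[v]|[YY [cYY iYY hYY]]] : closure Y' x.
  - apply/closureP => O oO Ox.
    have [||W [oW [y Wy] WOU WV]] := fibF V fV (O `&` U); first exact: openI.
      by exists x.
    have [z Yz Wz] := (closureP Y y).1 (UY _ (WOU _ Wy).2) W oW Wy.
    exists z; last by have [] := WOU _ Wz.
    by split=> // Vz; have : (W `&` (Y `&` f @^-1` V)) z by []; rewrite WV.
  - move=> cl; exfalso; have Vv : V v by apply: closureS cl => y [[]].
    have [y [[Yy nVy] /= fy] _] := (closureP _ _).1 cl setT openT I.
    by apply: nVy; rewrite /= fy.
  exists YY => _; split=> // K hK; apply: closureS (hYY K hK).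
  by move=> y [[]].
have [||A JA hA] := hitJ (\bigcup_(x in U) YY x).
- apply: bigcup_countable; first by apply: sub_countable cX; exact: subset_card_le.
  by move=> x Ux; have [] := YYP x Ux.
- by move=> Z [x Ux YZ]; split=> //; have [_ iYY _] := YYP x Ux; exact: iYY.
exists A => // nA; have [x Ux] := U0; rewrite (nwd_interior nA oU) in Ux => //.
move=> y Uy; have [_ _] := YYP y Uy; apply=> Z YZ; apply: hA.
by exists y.
Qed.

End NowhereDense.

(** * Consequences of the axiom for a sequential group *)

Definition first_countable_space (X : topologicalType) := forall x : X,
  exists N : nat -> set X, (forall n, open (N n) /\ N n x) /\
    forall U, open U -> U x -> exists n, N n `<=` U.

Section Capturing.
Variable X : topologicalType.
Implicit Types B F : nat -> set X.

Definition capturing B := forall u x, injective u -> cvs u x ->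
  exists n, io (fun i => B n (u i)).

Definition exhausting B :=
  [/\ forall m n, (m <= n)%N -> B m `<=` B n, forall x, exists n, B n x & capturing B].

(** Otherwise some subsequence has its n-th term outside [B n], and by monotonicity no [B m]
    contains infinitely many of its terms. *)
Lemma exhausting_ev B u x : exhausting B -> cvs u x -> exists n, ev (fun i => B n (u i)).
Proof.
move=> [mB cB capB] ux; apply: contrapT => nex.
have [n|phi ip phiP] := @subseqs (fun n i => ~ B n (u i)).
  by apply: not_ev => evB; apply: nex; exists n.
have [[v iov]|[psi ips inj]] := sub_const_or_inj (u \o phi).
  have [m Bv] := cB v; have [k mk /= uv] := iov m.
  by apply: (phiP k); rewrite uv; exact: mB mk _ Bv.
have [m ioB] := capB _ _ inj (cvs_sub (incr_comp ip ips) ux).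
have [k mk Bk] := ioB m; apply: (phiP (psi k)); apply: mB Bk.
exact: leq_trans mk (incr_ge k ips).
Qed.

Definition escaping F (w : nat -> X) := forall n, ev (fun i => ~ F n (w i)).

Lemma escaping_sub F w phi : incr phi -> escaping F w -> escaping F (w \o phi).
Proof. by move=> ip ew n; exact: (ev_sub ip (ew n)). Qed.

Lemma escaping_diag F w : (forall m n, (m <= n)%N -> F m `<=` F n) ->
  (forall n, ~ F n (w n)) -> escaping F w.
Proof. by move=> mF nF n; exists n => k nk Fk; apply: (nF k); exact: mF nk _ Fk. Qed.

End Capturing.

Lemma bounded_choice (P : nat -> nat -> Prop) n : (forall c, exists d, P c d) ->
  exists m, forall c, (c <= n)%N -> exists2 d, (d <= m)%N & P c d.
Proof.
move=> /choice[f fP]; exists (\max_(c < n.+1) f c)%N => c cn; exists (f c) => //.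
by apply: (leq_bigmax (Ordinal (cn : (c < n.+1)%N))).
Qed.

Section SequentialGroup.
Variable G : topologicalGroupType.
Hypothesis G_Tych : Tychonoff G.
Hypothesis G_count : countable [set: G].
Hypothesis G_seq : sequential G.
Hypothesis G_nd : ~ open [set (1 : G)%g].
Local Open Scope group_scope.
Implicit Types (A U V W : set G) (a u v w : nat -> G) (x y g h : G) (I : set (set G)).

Let G_T1 : accessible_space G := G_Tych.1.
Let G_zdim : zdim G := countable_zdim G_count G_Tych.

Lemma group_enum : exists e : nat -> G, forall x, exists n, e n = x.
Proof.
have [e _ eP] := countable_enum G_count (I : [set: G] 1).
by exists e => x; exact: eP.
Qed.

Lemma nontrivial_sequence : exists2 c : nat -> G, injective c & cvs c 1.
Proof.
have [|u [x [uI uA ux nx]]] := sequentialP (A := ~` [set 1]) G_seq.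
  by rewrite closedC.
by exists u => //; have <- : x = 1 by apply: contrapT.
Qed.

Lemma group_crowded x : ~ open [set x].
Proof.
move=> /(open_mull x) ox; apply: G_nd.
rewrite (_ : [set 1] = [set y | [set x] (x * y)]) // predeqE => y /=; split=> [->|].
  by rewrite mulg1.
by rewrite -{2}(mulg1 x) => /mulgI.
Qed.

(** A dense set is either the whole group or not closed; both ways it contains a nontrivial
    convergent sequence, which no set with the limit outside its closure meets infinitely often. *)
Lemma group_groomed : groomed G.
Proof.
move=> [Y [dY eY]].
have [u [x [uI uY ux]]] : exists u x, [/\ injective u, forall n, Y (u n) & cvs u x].
  have [cY|ncY] := pselect (closed Y); last first.
    by have [u [x [uI uY ux _]]] := sequentialP G_seq ncY; exists u, x.
  have [c cI c1] := nontrivial_sequence; exists c, 1; split=> // n.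
  apply: cY; apply/closureP => U oU Uc.
  by have [|y [Uy Yy]] := dY U _ oU; [exists (c n)|exists y].
have [||A [AY nA] hA] := eY x [set range u].
- exact: finite_set_countable.
- by move=> _ ->; split; [move=> _ [n _ <-]|apply: (inj_infinite uI) => n; exists n].
- by apply: nA; apply: cvs_closure ux (infinite_range_io (hA _ erefl)).
Qed.

Definition captured I :=
  exists2 B : nat -> set G, forall n, I (B n) & exhausting B.

Definition surrounded I := exists2 H : nat -> set G, forall k, ~ I (H k) &
  forall U, open U -> U !=set0 -> exists k, I (H k `\` U).

Lemma IIA_cases I : IIA -> is_ideal I -> tame I -> weakly_closed I ->
  invariant_ideal I -> captured I \/ surrounded I.
Proof.
move=> iia idI tI wI vI.
have [[S [cS SI capS]]|[H [cH HI HU]]] := iia G G_Tych G_count group_groomed I idI tI wI vI.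
  left; have [e eP] := group_enum.
  have I0 : I set0 by exact: (ideal_finite idI).
  have [||s sS' sP] := @countable_enum _ (S `|` [set set0]) set0.
  - by apply: countable_union => //; exact: finite_set_countable.
  - by right.
  have sI n : I (s n) by case: (sS' n) => [/SI|->].
  (* The points [e j] are added so that the sets [B n] cover the group; [set0] was added to [S] to
     have something to enumerate. *)
  pose B n := [set x | exists2 j, (j < n)%N & (s j `|` [set e j]) x].
  exists B; last split.
  - elim=> [|n IH]; first by apply: (ideal_sub idI) I0 => x [].
    apply: (ideal_sub idI (B := B n `|` (s n `|` [set e n]))).
      move=> x [j]; rewrite ltnS leq_eqVlt => /orP[/eqP->|jn] jx; first by right.
      by left; exists j.
    apply: (ideal_setU idI) => //; apply: (ideal_setU idI) => //.
    exact: (ideal_finite idI).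
  - by move=> m n mn x [j jm jx]; exists j => //; exact: leq_trans mn.
  - by move=> x; have [n <-] := eP x; exists n.+1, n => //; right.
  - move=> u x uI ux; have [A SA /infinite_range_io ioA] := capS _ _ (cvs_seq_to uI ux).
    have [n sn] := sP A (or_introl SA); exists n.+1; apply: io_imp ioA _ => i Ai.
    by exists n => //; left; rewrite sn.
right; have [A0 HA0 _] := HU setT openT (ex_intro _ 1 Logic.I).
have [s sH sP] := countable_enum cH HA0.
exists s => [k|U oU U0]; first exact/HI.
by have [A /sP[k <-] IA] := HU U oU U0; exists k.
Qed.

Lemma translate_closure A c x : cvs c 1 -> ev (fun n => A (c n * x)) -> closure A x.
Proof.
move=> c1 evA; have := @cvsMr _ c 1 x c1; rewrite mul1g => cx.
exact: (cvs_closure cx (ev_io evA)).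
Qed.

Lemma nwd_group_ideal : is_ideal [set A : set G | nwd A].
Proof. by apply: nwd_ideal => // x; exact: group_crowded. Qed.

Lemma nwd_weakly_closed : weakly_closed [set A : set G | nwd A].
Proof.
apply: weakly_closedI => [|A c cI c1 nA]; first exact: nwd_group_ideal.
apply: nwdS (nwd_closure nA) => x [|evA]; first exact: subset_closure.
exact: translate_closure c1 evA.
Qed.

Lemma nwd_mul A g h : nwd A -> nwd [set x | A (g * x * h)].
Proof.
move=> nA; apply: nwdS (nwd_preimage (f := fun x => g^-1 * x * h^-1)
  (g := fun x => g * x * h) _ _ _ _ nA).
- by move=> x Ax; exists (g * x * h) => //; rewrite mulgA mulgK mulKg.
- by move=> x; rewrite mulgA mulgVK mulVKg.
- by move=> x; rewrite mulgA mulgK mulKg.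
- by move=> U oU; exact: (open_mull g^-1 (open_mulr h^-1 oU)).
- by move=> U oU; exact: (open_mull g (open_mulr h oU)).
Qed.

Lemma nwd_inv A : nwd A -> nwd [set x | A x^-1].
Proof.
move=> nA; apply: nwdS (nwd_preimage (f := fun x => x^-1)
  (g := fun x : G => x^-1) _ _ _ _ nA); try by move=> x; rewrite invgK.
- by move=> x Ax; exists x^-1 => //; rewrite invgK.
- by move=> U oU; exact: inv_open.
- by move=> U oU; exact: inv_open.
Qed.

Lemma nwd_invariant : invariant_ideal [set A : set G | nwd A].
Proof.
move=> A nA; split=> [g|g|].
- apply: nwdS (nwd_mul g^-1 1 nA) => _ [x Ax <-] /=.
  by rewrite mulKg mulg1.
- apply: nwdS (nwd_mul 1 g^-1 nA) => _ [x Ax <-] /=.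
  by rewrite mul1g mulgK.
- by apply: nwdS (nwd_inv nA) => _ [x Ax <-] /=; rewrite invgK.
Qed.

(* The sets [Q k * (Q k)^-1], where [Q k] is open inside the closure of [H k],
   form a neighborhood base at [1]. *)
Lemma surrounded_nwd_first_countable :
  surrounded [set A : set G | nwd A] -> first_countable_space G.
Proof.
move=> [H nH HU].
have /choice[Q QP] : forall k, exists U, [/\ open U, U !=set0 & U `<=` closure (H k)].
  by move=> k; exact/not_nwd/nH.
pose N k := [set x | exists2 b, Q k b & Q k (x * b)].
have oN k : open (N k).
  rewrite (_ : N k = \bigcup_(b in Q k) [set x | Q k (x * b)]).
    by apply: bigcup_open => b _; apply: open_mulr; have [] := QP k.
  by rewrite predeqE => x; split=> [[b Qb Qxb]|[b Qb Qxb]]; exists b.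
have N1 k : N k 1.
  by have [_ [b Qb] _] := QP k; exists b => //; rewrite mul1g.
have NW W : open W -> W 1 -> exists k, N k `<=` W.
  move=> oW W1; have : W (1 * 1) by rewrite mulg1.
  move=> /(mul_open oW)[U [V [oU U1 oV V1 UV]]].
  have [||C [oC cC C1 CUV]] := G_zdim (U := U `&` [set x | V x^-1]) (x := 1).
  - by apply: openI => //; exact: inv_open.
  - by split=> //=; rewrite invg1.
  have [k nk] := HU C oC (ex_intro _ 1 C1); exists k => x [b Qb Qxb].
  have [oO _ QH] := QP k.
  (* Since [C] is clopen, the part of [Q k] outside [C] is open and lies in the closure of the
     nowhere dense part of [H k] outside [C]. *)
  have QC : Q k `<=` C.
    have E : Q k `&` ~` C = set0.
      apply: (nwd_interior nk); first by apply: openI => //; rewrite openC.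
      move=> y [Qy nCy]; apply/closureP => Z oZ Zy.
      have [||z Hz [Zz nCz]] := (closureP _ _).1 (QH y Qy) (Z `&` ~` C).
      + by apply: openI => //; rewrite openC.
      + by split.
      + by exists z.
    by move=> y Qy; apply: contrapT => nCy; have : (Q k `&` ~` C) y by []; rewrite E.
  rewrite -(mulgK b x); apply: UV.
    by have [] := CUV _ (QC _ Qxb).
  by have [] := CUV _ (QC _ Qb).
move=> x; exists (fun k => [set y | N k (x^-1 * y)]); split=> [n|U oU Ux].
  by split; [exact: open_mull|rewrite /= mulVg].
have [||k Nk] := NW [set y | U (x * y)]; first exact: open_mull.
  by rewrite /= mulg1.
by exists k => y /= /Nk /=; rewrite mulVKg.
Qed.

Definition invariant_family (F : nat -> set G) :=
  (forall n g h, exists m, forall x, F n x -> F m (g * x * h)) /\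
  (forall n, exists m, forall x, F n x -> F m x^-1).

(** The two-sided translates of the closures of the [B k] and of their inverses are countably many.
    [F n] unites those of code at most [n], and a translation or inversion maps these finitely many
    pieces into pieces of some [F m]. *)
Lemma captured_nwd_family : captured [set A : set G | nwd A] ->
  exists F : nat -> set G, [/\ exhausting F, forall n, closed (F n),
    forall n, nwd (F n), invariant_family F & F 0%N 1].
Proof.
move=> [B nB [mB cB capB]]; have [e eP] := group_enum.
pose E (t : nat * nat * nat * bool) := [set x |
  let y := e t.1.1.1 * x * e t.1.1.2 in closure (B t.1.2) (if t.2 then y^-1 else y)].
have oE (t : nat * nat * nat * bool) : closed (E t).
  rewrite -openC; case: t => [[[i j] k] []].
    exact: (open_mull (e i) (open_mulr (e j) (inv_open (closed_openC (@closed_closure _ (B k)))))).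
  exact: (open_mull (e i) (open_mulr (e j) (closed_openC (@closed_closure _ (B k))))).
have nE t : nwd (E t).
  have nC k : nwd (closure (B k)) by exact/nwd_closure/nB.
  case: t => [[[i j] k] []].
    exact: (nwd_mul (e i) (e j) (nwd_inv (nC k))).
  exact: (nwd_mul (e i) (e j) (nC k)).
have [c1 ec1] := eP 1.
pose D c : set G := if unpickle c is Some t then E t else set0.
pose F n := [set x | exists2 c, (c <= n)%N & D c x].
have D_closed c : closed (D c) by rewrite /D; case: unpickle => //; exact: closed0.
have D_nwd c : nwd (D c).
  rewrite /D; case: unpickle => // U oU U0.
  by exists U; split=> //; rewrite setI0.
have FS n : F n.+1 = F n `|` D n.+1.
  rewrite predeqE => x; split=> [[c]|[[c cn Dc]|Dn]].
  - by rewrite leq_eqVlt => /orP[/eqP->|cn] Dc; [right|left; exists c].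
  - by exists c => //; exact: leqW.
  - by exists n.+1.
have F0 : F 0%N = D 0%N.
  by rewrite predeqE => x; split=> [[c]|]; [rewrite leqn0 => /eqP->|exists 0%N].
have mF m n : (m <= n)%N -> F m `<=` F n.
  by move=> mn x [c cm Dc]; exists c => //; exact: leq_trans mn.
have DF t x : E t x -> F (pickle t) x by move=> Et; exists (pickle t) => //; rewrite /D pickleK.
have F_cl n : closed (F n) by elim: n => [|n IH]; rewrite ?F0 // FS; exact: closedU.
have F_nwd n : nwd (F n) by elim: n => [|n IH]; rewrite ?F0 // FS; exact: nwdU.
have transfer (f : G -> G) : (forall t, exists t', forall x, E t x -> E t' (f x)) ->
    forall n, exists m, forall x, F n x -> F m (f x).
  move=> Ef n; have [c|m mP] := @bounded_choice (fun c d => forall x, D c x -> D d (f x)) n.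
    rewrite {1}/D; case: unpickle => [t|]; last by exists 0%N.
    by have [t' t'P] := Ef t; exists (pickle t') => x /t'P; rewrite /D pickleK.
  by exists m => x [c /mP[d dm dP] /dP]; exists d.
have F_inv : invariant_family F.
  split=> [n g h|].
    apply: (transfer (fun x => g * x * h)) => -[[[i j] k] b].
    have [i' i'P] := eP (e i * g^-1); have [j' j'P] := eP (h^-1 * e j).
    exists (i', j', k, b) => x; rewrite /E /= i'P j'P.
    by rewrite -!mulgA mulKg mulVKg.
  apply: (transfer (fun x => x^-1)) => -[[[i j] k] b].
  have [i' i'P] := eP (e j)^-1; have [j' j'P] := eP (e i)^-1.
  exists (i', j', k, ~~ b) => x; rewrite /E /= i'P j'P -!invgM mulgA.
  by case: b => //=; rewrite invgK.
have F_cover x : exists n, F n x.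
  have [k Bk] := cB x; exists (pickle (c1, c1, k, false)); apply: DF.
  by rewrite /E /= ec1 mul1g mulg1; exact: subset_closure.
have [n0 Fn0] := F_cover 1.
(* The shift by [n0] puts 1 into the first set. *)
exists (fun n => F (n + n0)%N); split=> //.
- split=> [m n mn|x|u x uI ux].
  + by apply: mF; rewrite leq_add2r.
  + by have [n Fn] := F_cover x; exists n; apply: mF Fn; exact: leq_addr.
  + have [k ioB] := capB u x uI ux; exists (pickle (c1, c1, k, false)).
    apply: io_imp ioB _ => i Bi; apply: (mF _ _ (leq_addr _ _)); apply: DF.
    by rewrite /E /= ec1 mul1g mulg1; exact: subset_closure.
- split=> [n g h|n].
    have [m mP] := F_inv.1 (n + n0)%N g h; exists m => x /mP.
    by apply: mF; exact: leq_addr.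
  have [m mP] := F_inv.2 (n + n0)%N; exists m => x /mP.
  by apply: mF; exact: leq_addr.
Qed.

End SequentialGroup.

(** * The ideal of sets without two-sided escaping sequences *)

Section TwoSided.
Variable G : topologicalGroupType.
Hypothesis G_Tych : Tychonoff G.
Hypothesis G_count : countable [set: G].
Hypothesis G_seq : sequential G.
Hypothesis G_nd : ~ open [set (1 : G)%g].
Variable F : nat -> set G.
Hypothesis F_exh : exhausting F.
Hypothesis F_closed : forall n, closed (F n).
Hypothesis F_inv : invariant_family F.
Hypothesis F1 : F 0%N 1%g.
Local Open Scope group_scope.
Implicit Types (A U V W : set G) (a u v w : nat -> G) (x y g h : G).

Let F_mono m n : (m <= n)%N -> F m `<=` F n. Proof. by case: F_exh => + _ _; exact. Qed.

(** Inversion exchanges left and right factors, so both are allowed to make the ideal invariant; the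
    arbitrary limits [x] and [y] absorb translations of [a]. *)
Definition two_sided a := exists u v x y,
  [/\ cvs u x, cvs v y & escaping F (fun i => u i * a i * v i)].

Lemma escaping_mul w g h : escaping F w -> escaping F (fun i => g * w i * h).
Proof.
move=> ew n; have [m mP] := F_inv.1 n g^-1 h^-1.
by apply: ev_imp (ew m) _ => i nF /mP; rewrite mulgA mulgK mulKg.
Qed.

Lemma two_sided_sub a phi : incr phi -> two_sided a -> two_sided (a \o phi).
Proof.
move=> ip [u [v [x [y [ux vy e]]]]]; exists (u \o phi), (v \o phi), x, y.
by split; [exact: cvs_sub|exact: cvs_sub|exact: (escaping_sub ip e)].
Qed.

Lemma two_sided_cst g : ~ two_sided (fun=> g).
Proof.
move=> [u [v [x [y [ux vy e]]]]].
have [n nF] := exhausting_ev F_exh (cvsM (@cvsMr _ u x g ux) vy).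
by have [i _ []] := ev_io (ev_and nF (e n)) 0%N.
Qed.

Lemma two_sided_mull g a : two_sided a -> two_sided (fun n => g * a n).
Proof.
move=> [u [v [x [y [ux vy e]]]]]; exists (fun n => u n * g^-1), v, (x * g^-1), y.
split=> //; first exact: (@cvsMr _ u x g^-1 ux).
rewrite (_ : (fun _ => _) = fun i => u i * a i * v i) //.
by apply/funext => i; rewrite mulgA mulgVK.
Qed.

Lemma two_sided_mulr g a : two_sided a -> two_sided (fun n => a n * g).
Proof.
move=> [u [v [x [y [ux vy e]]]]]; exists u, (fun n => g^-1 * v n), x, (g^-1 * y).
split=> //; first exact: (@cvsMl _ v y g^-1 vy).
rewrite (_ : (fun _ => _) = fun i => u i * a i * v i) //.
by apply/funext => i; rewrite !mulgA mulgK.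
Qed.

Lemma two_sided_inv a : two_sided a -> two_sided (fun n => (a n)^-1).
Proof.
move=> [u [v [x [y [ux vy e]]]]].
exists (fun n => (v n)^-1), (fun n => (u n)^-1), y^-1, x^-1.
split; [exact: (cvsV vy)|exact: (cvsV ux)|move=> n].
have [m mP] := F_inv.2 n; apply: ev_imp (e m) _ => i nF /mP.
by rewrite !invgM !invgK mulgA.
Qed.

Let I := seq_ideal two_sided.

Lemma two_sided_is_ideal : is_ideal I.
Proof. exact: seq_ideal_is_ideal two_sided_sub two_sided_cst. Qed.

(** An added point [a n] can be replaced by some [c j * a n] in [A]: the complement of [F n] is
    open, so for large [j] the product with [u] and [v] still avoids [F n]. A bad sequence of added
    points thus yields one in [A]. *)
Lemma two_sided_weakly_closed : weakly_closed I.
Proof.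
apply: weakly_closedI => [|A c cI c1 IA a aA]; first exact: two_sided_is_ideal.
have /io_or[] : io (fun n => A (a n) \/ ev (fun k => A (c k * a n))).
- by apply: io_all => n; case: (aA n); [left|right].
- by move=> /subseq1[phi ip pA] /(two_sided_sub ip); exact: IA pA.
move=> /subseq1[phi ip pA] /(two_sided_sub ip)[u [v [x [y [ux vy e]]]]].
have [k|psi ips psiP] := @subseqs (fun k i => ~ F k (u i * (a \o phi) i * v i)).
  exact: ev_io (e k).
have /choice[j jP] : forall k, exists j, A (c j * a (phi (psi k))) /\
    ~ F k (u (psi k) * (c j * a (phi (psi k))) * v (psi k)).
  move=> k; have oF : open (~` F k) by rewrite openC.
  have := @cvsMr _ c 1 (a (phi (psi k))) c1; rewrite mul1g => ca.
  have [i _ [Ai Fi]] := ev_io (ev_and (pA (psi k))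
    (ca _ (open_mull (u (psi k)) (open_mulr (v (psi k)) oF)) (psiP k))) 0%N.
  by exists i.
apply: (IA (fun k => c (j k) * a (phi (psi k)))); first by move=> k; exact: (jP k).1.
exists (u \o psi), (v \o psi), x, y; split; try exact: cvs_sub.
apply: escaping_diag => [m n|n]; first exact: F_mono.
exact: (jP n).2.
Qed.

(** Escaping products [w k i] with middle factor in [H k] form a closed set without 1, so the
    threefold product of some neighborhood [V] of 1 misses it. But if [H k] is contained in [V] up
    to the ideal, all three factors of [w k i] are in [V] for late [i]. *)
Lemma two_sided_not_surrounded : ~ surrounded I.
Proof.
move=> [H nH HU].
have /choice[auv auvP] : forall k, exists auv : (nat -> G) * (nat -> G) * (nat -> G),
    let: (a, u, v) := auv in [/\ forall i, H k (a i), two_sided a, cvs u 1, cvs v 1 &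
      forall i, ~ F (k + i)%N (u i * a i * v i)].
  move=> k; have [a aH ta] := not_seq_ideal (nH k).
  have [u [v [x [y [ux vy /(escaping_mul x^-1 y^-1) e]]]]] := ta.
  (* The outer factors are normalized to tend to 1. The index [k + i] leaves only finitely many of
     the points [w k i], over all [k] and [i], in each [F n]. *)
  have [i|phi ip phiP] := @subseqs (fun i j => ~ F (k + i)%N (x^-1 * (u j * a j * v j) * y^-1)).
    exact: ev_io (e _).
  exists (a \o phi, (fun i => x^-1 * u (phi i)), (fun i => v (phi i) * y^-1)); split.
  - by move=> i; exact: aH.
  - exact: two_sided_sub.
  - by have := @cvsMl _ _ _ x^-1 (cvs_sub ip ux); rewrite mulVg.
  - by have := @cvsMr _ _ _ y^-1 (cvs_sub ip vy); rewrite mulgV.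
  - by move=> i /=; have := phiP i; rewrite !mulgA.
pose w k i := (auv k).1.2 i * (auv k).1.1 i * (auv k).2 i.
have wF k i : ~ F (k + i)%N (w k i) by have := auvP k; rewrite /w; case: (auv k) => -[a u] v [].
pose A := [set x | exists k i, w k i = x].
have dA : divergent_set A.
  apply: (divergent_set_capture (B := F)); first by case: F_exh.
  move=> n; apply: divergent_set_finite.
  apply: (@sub_finite_set _ _ ((fun ki => w ki.1 ki.2) @` (`I_n `*` `I_n))).
    move=> _ [[k [i <-]] Fn]; exists (k, i) => //=.
    have kin : (k + i < n)%N.
      by rewrite ltnNge; apply/negP => nki; exact: (wF k i (F_mono nki Fn)).
    by split=> /=; apply: leq_ltn_trans kin; rewrite ?leq_addr ?leq_addl.
  by apply: finite_image; apply: finite_setX; exact: finite_II.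
have oA : open (~` A) by rewrite openC; exact: divergent_set_closed.
have [|V [oV V1 VA]] := nbhs1_cube oA.
  by move=> [k [i E]]; apply: (wF k i); rewrite E; exact: F_mono F1.
have [k IHV] := HU V oV (ex_intro _ 1 V1).
have := auvP k; have := wF k; have : forall i, A (w k i) by move=> i; exists k, i.
rewrite /w; case: (auv k) => -[a u] v /= wA _ [aH ta u1 v1 _].
have Va := seq_ideal_ev two_sided_sub aH ta IHV.
have [i _ [Ui [Ai Vi]]] := ev_io (ev_and (u1 V oV V1) (ev_and Va (v1 V oV V1))) 0%N.
exact: (VA _ _ _ Ui Ai Vi (wA i)).
Qed.

Lemma two_sided_captured : IIA -> captured I.
Proof.
move=> iia; have [//|/two_sided_not_surrounded//] : captured I \/ surrounded I.
apply: IIA_cases => //.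
- exact: two_sided_is_ideal.
- exact: seq_ideal_tame two_sided_sub.
- exact: two_sided_weakly_closed.
- exact: seq_ideal_invariant two_sided_mull two_sided_mulr two_sided_inv.
Qed.

End TwoSided.

(** * The ideal of sets in which every sequence has a convergent subsequence *)

Section DivergentIdeal.
Variable G : topologicalGroupType.
Hypothesis G_Tych : Tychonoff G.
Hypothesis G_count : countable [set: G].
Hypothesis G_seq : sequential G.
Hypothesis G_nd : ~ open [set (1 : G)%g].
Local Open Scope group_scope.
Implicit Types (A U V W : set G) (a u v w : nat -> G) (x y g h : G).

Lemma divergent_cst g : ~ divergent (fun=> g).
Proof. by move=> /(_ id g (fun n => ltnSn n)); apply; exact: cvs_cst. Qed.

Lemma divergent_mull g a : divergent a -> divergent (fun n => g * a n).
Proof.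
move=> da phi x ip gax; apply: (da phi (g^-1 * x) ip).
apply: (cvs_ev (@cvsMl _ _ _ g^-1 gax)); apply: evT => n /=.
by rewrite mulKg.
Qed.

Lemma divergent_mulr g a : divergent a -> divergent (fun n => a n * g).
Proof.
move=> da phi x ip gax; apply: (da phi (x * g^-1) ip).
apply: (cvs_ev (@cvsMr _ _ _ g^-1 gax)); apply: evT => n /=.
by rewrite mulgK.
Qed.

Lemma divergent_inv a : divergent a -> divergent (fun n => (a n)^-1).
Proof.
move=> da phi x ip gax; apply: (da phi x^-1 ip).
by apply: (cvs_ev (cvsV gax)); apply: evT => n /=; rewrite invgK.
Qed.

Let I := seq_ideal (@divergent G).

Lemma divergent_is_ideal : is_ideal I.
Proof. exact: seq_ideal_is_ideal (@divergent_sub G) divergent_cst. Qed.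

(** Multiplying [a (phi k)] by [c (j k)] with [j k >= k] changes it by factors tending to 1, so both
    sequences converge along the same subsequences. *)
Lemma divergent_weakly_closed : weakly_closed I.
Proof.
apply: weakly_closedI => [|A c cI c1 IA a aA]; first exact: divergent_is_ideal.
have /io_or[] : io (fun n => A (a n) \/ ev (fun k => A (c k * a n))).
- by apply: io_all => n; case: (aA n); [left|right].
- by move=> /subseq1[phi ip pA] /(divergent_sub ip); exact: IA pA.
move=> /subseq1[phi ip pA] /(divergent_sub ip) da.
have /choice[j jP] : forall k, exists j, (k <= j)%N /\ A (c j * a (phi k)).
  by move=> k; have [j kj Aj] := ev_io (pA k) k; exists j.
apply: (IA (fun k => c (j k) * a (phi k))) => [k|]; first exact: (jP k).2.
move=> psi x ips wx; apply: (da psi x ips).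
have cj : cvs (fun k => c (j (psi k))) 1.
  move=> U oU U1; have [N NP] := c1 U oU U1; exists N => k Nk; apply: NP.
  exact: leq_trans (leq_trans Nk (incr_ge k ips)) (jP _).1.
have := cvsM (cvsV cj) wx; rewrite invg1 mul1g => /cvs_ev; apply.
by apply: evT => n /=; rewrite mulKg.
Qed.

Lemma divergent_cases : IIA -> captured I \/ exists2 h : nat -> nat -> G,
  forall k, divergent (h k) &
  forall U, open U -> U !=set0 -> exists k, ev (fun i => U (h k i)).
Proof.
move=> iia; have [|||||[H nH HU]] := IIA_cases G_Tych G_count G_seq G_nd (I := I) iia.
- exact: divergent_is_ideal.
- exact: seq_ideal_tame (@divergent_sub G).
- exact: divergent_weakly_closed.
- exact: seq_ideal_invariant divergent_mull divergent_mulr divergent_inv.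
- by left.
right; have /choice[h hP] : forall k, exists a, (forall i, H k (a i)) /\ divergent a.
  by move=> k; have [a aH da] := not_seq_ideal (nH k); exists a.
exists h => [k|U oU U0]; first exact: (hP k).2.
have [k IHU] := HU U oU U0; exists k; have [hH dh] := hP k.
exact: (seq_ideal_ev (@divergent_sub G) hH dh IHU).
Qed.

Section Concentrate.
Variable h : nat -> nat -> G.
Hypothesis h_div : forall k, divergent (h k).
Hypothesis h_hit : forall U, open U -> U !=set0 -> exists k, ev (fun i => U (h k i)).
Variable B : nat -> set G.
Hypothesis B_exh : exhausting B.

Let meets k D := io (fun i => D (h k i)).

(** A localized form of [h_hit]: tails inside the single set [B n], and only at the point [z]. The
    second clause keeps infinitely many terms of each sequence, so that restricting to [D] yields
    subsequences. *)
Let concentrated n z D := [/\ D `<=` B n, forall k, meets k (B n) -> meets k D &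
  forall U, open U -> U z -> exists2 k, meets k (B n) & ev (fun i => D (h k i) -> U (h k i))].

(** Without concentration at [e j], a neighborhood of [e j] can be removed while each sequence keeps
    infinitely many terms. The j-th term taken from [h k] survives the first [k + j] removals, so
    the neighborhood removed around a point contains finitely many selected terms. *)
Let thin_selection n : (forall z D, ~ concentrated n z D) -> exists P : set G,
  divergent_set P /\ forall k, meets k (B n) -> meets k P.
Proof.
move=> nc; have [e eP] := group_enum G_count.
have step (j : nat) (D : {D : set G | D `<=` B n /\ forall k, meets k (B n) -> meets k D}) :
    {D' : {D : set G | D `<=` B n /\ forall k, meets k (B n) -> meets k D} |
      exists2 U, open U /\ U (e j) & sval D' = sval D `\` U}.
  apply: cid; case: D => D [DB Dm].
  have [U [oU Ue UD]] : exists U, [/\ open U, U (e j) &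
      forall k, meets k (B n) -> meets k (D `\` U)].
    apply: contrapT => nU; apply: (nc (e j) D); split=> // U oU Ue.
    apply: contrapT => nk; apply: nU; exists U; split=> // k kB.
    apply: contrapT => /not_io evn; apply: nk; exists k => //.
    apply: ev_imp evn _ => i nDU Di; apply: contrapT => nU; apply: nDU.
    by split.
  have D'P : D `\` U `<=` B n /\ forall k, meets k (B n) -> meets k (D `\` U).
    by split=> // x [/DB].
  by exists (exist _ (D `\` U) D'P); exists U.
have B0 : B n `<=` B n /\ forall k, meets k (B n) -> meets k (B n) by split=> // x.
pose DD := fix DD j := if j is j'.+1 then sval (step j' (DD j')) else exist _ (B n) B0.
pose D j := sval (DD j).
have Dm j k : meets k (B n) -> meets k (D j) by move=> kB; apply: (proj2_sig (DD j)).2.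
have DU j : exists2 U, open U /\ U (e j) & D j.+1 = D j `\` U.
  exact: (svalP (step j (DD j))).
have D_anti i j : (i <= j)%N -> D j `<=` D i.
  elim: j => [|j IH]; first by rewrite leqn0 => /eqP->.
  rewrite leq_eqVlt => /orP[/eqP->//|/IH ij]; have [U _ ->] := DU j.
  by move=> x [/ij].
have /choice[phi phiP] : forall k, exists phi : nat -> nat, meets k (B n) ->
    incr phi /\ forall j, D (k + j)%N (h k (phi j)).
  move=> k; have [kB|nkB] := pselect (meets k (B n)); last by exists id.
  have [j|phi ip phiP] := @subseqs (fun j i => D (k + j)%N (h k i)); first exact: Dm.
  by exists phi.
exists [set x | exists k j, meets k (B n) /\ h k (phi k j) = x]; split; last first.
  move=> k kB; have [ip _] := phiP k kB; apply: (io_sub ip).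
  by apply: io_all => j /=; exists k, j.
apply: divergent_set_local => x; have [l <-] := eP x; have [U [oU Ue] DE] := DU l.
exists U; split=> //; apply: divergent_set_finite.
apply: (@sub_finite_set _ _ ((fun kj => h kj.1 (phi kj.1 kj.2)) @` (`I_l.+1 `*` `I_l.+1))).
  move=> _ [[k [j [kB <-]]] Uh]; exists (k, j) => //=.
  have kjl : (k + j < l.+1)%N.
    rewrite ltnNge; apply/negP => lkj; have [_ /(_ j)] := phiP k kB.
    by move/(D_anti _ _ lkj); rewrite DE => -[].
  by split=> /=; apply: leq_ltn_trans kjl; rewrite ?leq_addr ?leq_addl.
by apply: finite_image; apply: finite_setX; exact: finite_II.
Qed.

(* Otherwise neighborhoods of all points can be removed one by one from each
   [B n], leaving divergent sets [P n] that meet infinitely often every [h k]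
   meeting [B n] infinitely often; gluing them gives a closed set without [1]
   that meets every [h k] infinitely often. *)
Lemma concentrate : exists n z (Q : set nat) (d : nat -> nat -> G),
  [/\ forall k, Q k -> divergent (d k), forall k, Q k -> forall i, B n (d k i) &
    forall U, open U -> U z -> exists2 k, Q k & ev (fun i => U (d k i))].
Proof.
have [mB cB capB] := B_exh.
have [[n [z [D [DB Dm DU]]]]|nc] := pselect (exists n z D, concentrated n z D).
  have /choice[phi phiP] : forall k, exists phi : nat -> nat, meets k (B n) ->
      incr phi /\ forall i, D (h k (phi i)).
    move=> k; have [/Dm/subseq1[phi ip phiP]|nkB] := pselect (meets k (B n)).
      by exists phi.
    by exists id.
  exists n, z, (meets^~ (B n)), (fun k i => h k (phi k i)); split.
  - by move=> k /phiP[ip _]; exact: (divergent_sub ip (@h_div k)).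
  - by move=> k /phiP[_ kD] i; exact: DB.
  - move=> U oU /(DU U oU)[k kB evU]; exists k => //; have [ip kD] := phiP k kB.
    by apply: ev_imp (ev_sub ip evU) _ => i /=; apply.
exfalso.
have /choice[P PP] : forall n, exists P : set G,
    divergent_set P /\ forall k, meets k (B n) -> meets k P.
  by move=> n; apply: thin_selection => z D c; apply: nc; exists n, z, D.
(* By this shift the part of [A] in [B m] involves only [P n] with [n <= m] and [h k] with [k < m].
   A sequence [h k] that returns to some [B n] forever meets [P n] outside [B' n] for the least such
   [n]; any other [h k] eventually leaves [B k]. *)
pose B' n := if n is m.+1 then B m else set0.
pose A := [set x | x <> 1 /\ ((exists2 n, P n x & ~ B' n x) \/
  exists k, range (h k) x /\ ~ B k x)].
have dA : divergent_set A.
  apply: (divergent_set_capture capB) => m.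
  apply: (divergent_setS (Q := [set x | exists2 n, (n < m.+1)%N & P n x] `|`
    [set x | exists2 k, (k < m)%N & range (h k) x])).
  - move=> x [[_ [[n Pn nB]|[k [hk nB]]]] Bm].
      left; exists n => //; rewrite ltnNge; apply/negP; case: n nB {Pn} => // n nB mn.
      by apply: nB; exact: mB Bm.
    right; exists k => //; rewrite ltnNge; apply/negP => mk; apply: nB.
    exact: mB Bm.
  - apply: divergent_setU; apply: divergent_set_lt => k; first exact: (PP k).1.
    exact: divergent_range (@h_div k).
have oA : open (~` A) by rewrite openC; exact: divergent_set_closed.
have [|k evA] := h_hit oA; first by exists 1 => -[].
have nA : ~ io (fun i => A (h k i)).
  by move=> ioA; have [i _ [Ai]] := io_ev ioA evA 0%N; exact.
have ne1 := divergent_neq 1 (@h_div k).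
have [[n kn]|nn] := pselect (exists n, meets k (B n)); last first.
  have /not_io nB : ~ meets k (B k) by move=> kk; apply: nn; exists k.
  apply: nA; apply: ev_io; apply: ev_imp (ev_and nB ne1) _ => i [nBi n1].
  by split=> //; right; exists k; split=> //; exists i.
elim/ltn_ind: n kn => n IH kn; case: n IH kn => [|n] IH kn.
  apply: nA; apply: io_imp (io_ev ((PP _).2 _ kn) ne1) _ => i [Pi n1].
  by split=> //; left; exists 0%N.
have [/(IH n (ltnSn n))//|/not_io nB] := pselect (meets k (B n)).
apply: nA; apply: io_imp (io_ev ((PP _).2 _ kn) (ev_and ne1 nB)) _ => i [Pi [n1 nBi]].
by split=> //; left; exists n.+1.
Qed.

End Concentrate.

End DivergentIdeal.

Lemma finite_inj_lt (T : Type) (f : T -> nat) n : injective f ->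
  finite_set [set t | (f t < n)%N].
Proof.
move=> fI; apply: contrapT => /infinite_seq[u uI un].
have [N NP] := inj_ev_finite (u := f \o u) (inj_comp fI uI) (finite_II n).
exact: NP (leqnn N) (un N).
Qed.

(** * Selecting closed sets of products; exclusion of concentration *)

Section Selection.
Variable G : topologicalGroupType.
Hypothesis G_Tych : Tychonoff G.
Hypothesis G_count : countable [set: G].
Hypothesis G_seq : sequential G.
Local Open Scope group_scope.
Implicit Types (E T A U V W : set G) (a u v w d : nat -> G) (x y z g h : G).

Let G_T1 : accessible_space G := G_Tych.1.

Lemma divergent_avoid d g : divergent d ->
  exists W, [/\ open W, W g & ev (fun m => ~ W (d m))].
Proof.
move=> dd; have [N NP] := divergent_neq g dd.
pose P := range d `\` [set g].
have oP : open (~` P).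
  rewrite openC; apply: (divergent_set_closed G_seq).
  by apply: divergent_setS (divergent_range dd) => x [].
exists (~` P); split=> //; first by case=> _; exact.
by exists N => n /NP gn; apply; split=> //; exists n.
Qed.

(** This allows one term of each translate [t * d] to be chosen so that the chosen points form a
    divergent set. *)
Definition scattering d T := forall g, exists W,
  [/\ open W, W g & finite_set [set t | T t /\ io (fun m => W (t * d m))]].

(** Induction on the sequential closure. All [t] near [x] make [t * d] eventually avoid one
    neighborhood of [g]. In the limit step, points of [T j] are kept only if they lie in these
    neighborhoods of [x] for each [g] with [rank g <= j], as far as [u j] does; for a given [g] this
    settles all but finitely many [T j], to which the induction hypothesis applies. *)
Lemma scattering_select d E x : divergent d -> sclos E x ->
  exists T, [/\ T `<=` E, closure T x & scattering d T].
Proof.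
move=> dd; have [rank rankI] := countable_rank G_count.
elim=> {x} [x Ex|u x _ /choice[T TP] ux].
  exists [set x]; split=> [y ->//||g]; first exact: subset_closure.
  exists setT; split=> //; first exact: openT.
  by apply: sub_finite_set (finite_set1 x) => y [].
have /choice[OW OWP] : forall g, exists OW : set G * set G,
    [/\ open OW.1, OW.1 x, open OW.2, OW.2 g &
      forall t, OW.1 t -> ~ io (fun m => OW.2 (t * d m))].
  move=> g; have [W [oW Wg evW]] := divergent_avoid g (@divergent_mull _ x _ dd).
  (* [x * d m] is the product of [x * t^-1], close to 1, and [t * d m]; this carries the avoidance
     from [x] to nearby [t]. *)
  have [|U [V [oU Ux oV Vg UV]]] := mul_open (x := x * x^-1) (y := g) oW.
    by rewrite mulgV mul1g.
  exists ([set t | U (x * t^-1)], V); split=> //=.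
    exact: (inv_open (open_mull x oU)).
  move=> t Ut ioV; have [m _ [Vm nW]] := io_ev ioV evW 0%N.
  by apply: nW; have := UV _ _ Ut Vm; rewrite mulgA mulgVK.
pose S := [set t | exists j, T j t /\
  forall g, (rank g <= j)%N -> (OW g).1 (u j) -> (OW g).1 t].
exists S; split=> [t [j [Tt _]]||g].
- by have [TE _ _] := TP j; exact: TE.
- apply: (@closed_closure _ S); apply: (cvs_closure ux); apply: io_all => j.
  apply/closureP => U oU Uu; have [_ /closureP Tu _] := TP j.
  have [g|g gj|Q [oQ Qu QO]] := @finite_bigcap_open _ _
      rank (fun g => [set t | (OW g).1 (u j) -> (OW g).1 t]) j (u j) rankI.
  + have [Ou|nOu] := pselect ((OW g).1 (u j)).
      rewrite (_ : mkset _ = (OW g).1); first by have [] := OWP g.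
      by rewrite predeqE => t; split=> [h|Ot _]; [exact: h Ou|exact: Ot].
    rewrite (_ : mkset _ = setT); first exact: openT.
    by rewrite predeqE => t; split=> // _ /nOu.
  + by [].
  + have [|t Tt [Ot Ut]] := Tu (Q `&` U) (openI oQ oU); first by split.
    by exists t => //; exists j; split=> // h hj; exact: QO.
- have [q1 q1x q2 q2g oP] := OWP g; have [N NP] := ux _ q1 q1x.
  pose M := maxn N (rank g).
  have /choice[W WP] : forall j, exists W, [/\ open W, W g &
      finite_set [set t | T j t /\ io (fun m => W (t * d m))]].
    by move=> j; have [_ _] := TP j; apply.
  have [||V [oV Vg VW]] := @bigcap_lt_open _ W M g.
  + by move=> j; have [] := WP j.
  + by move=> j _; have [] := WP j.
  exists ((OW g).2 `&` V); split; [exact: openI|by []|].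
  apply: (@sub_finite_set _ _ (\bigcup_(j < M)
    [set t | T j t /\ io (fun m => W j (t * d m))])); last first.
    by apply: bigcup_finite => [|j _]; [exact: finite_II|have [] := WP j].
  move=> t [[j [Tt tO]] ioW].
  have [jM|Mj] := ltnP j M.
    by exists j => //; split=> //; apply: io_imp ioW _ => m [_ /VW]; apply.
  exfalso; apply: (oP t); last by apply: io_imp ioW _ => m [].
  move: Mj; rewrite geq_max => /andP[Nj gj]; apply: tO => //.
  exact: NP.
Qed.

Variable F : nat -> set G.
Hypothesis F_exh : exhausting F.
Hypothesis F_nwd : forall n, nwd (F n).
Hypothesis F_inv : invariant_family F.
Hypothesis F1 : F 0%N 1.

Let F_mono m n : (m <= n)%N -> F m `<=` F n. Proof. by case: F_exh => + _ _; exact. Qed.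

(* [AA] collects points [t * d k m] with [t] near [1] outside [F k], so that [z]
   is in its closure; it is divergent because a convergent sequence [w] of such
   points with [k] unbounded would make [w * (d k m)^-1 = t] leave every [F n]. *)
Lemma not_concentrated (B : set G) z (Q : set nat) (d : nat -> nat -> G) :
  seq_ideal (two_sided F) B ->
  (forall k, Q k -> divergent (d k)) -> (forall k, Q k -> forall i, B (d k i)) ->
  ~ (forall U, open U -> U z -> exists2 k, Q k & ev (fun i => U (d k i))).
Proof.
move=> IB dd dB hit; have [rank rankI] := countable_rank G_count.
have /choice[T TP] : forall k, exists T, Q k ->
    [/\ T `<=` ~` F k, closure T 1 & scattering (d k) T].
  move=> k; have [/dd dk|nQ] := pselect (Q k); last by exists set0.
  have /(sequential_closure G_seq)/(scattering_select dk)[T TP] : closure (~` F k) 1.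
    apply/closureP => U oU U1; have [|V [oV [y Vy] VU VF]] := F_nwd k oU; first by exists 1.
    by exists y; [move=> Fy; have : (V `&` F k) y by []; rewrite VF|exact: VU].
  by exists T.
have /choice[W WP] : forall kg : nat * G, exists W, Q kg.1 ->
    [/\ open W, W kg.2 & finite_set [set t | T kg.1 t /\ io (fun m => W (t * d kg.1 m))]].
  move=> [k g] /=; have [Qk|nQ] := pselect (Q k); last by exists set0.
  by have [_ _ /(_ g)[V VP]] := TP k Qk; exists V.
(* The chosen term avoids each [W (k, g)] with [rank g <= rank t] that [t * d k] eventually avoids,
   so [W (k, g)] contains it only for finitely many [t]: those of smaller rank and those whose
   translate returns forever. The bound [rank t <= m] makes the chosen indices tend to infinity. *)
have /choice[m mP] : forall kt : nat * G, exists m, Q kt.1 ->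
    [/\ (rank kt.2 <= m)%N, kt.2 * d kt.1 m <> z &
      forall g, (rank g <= rank kt.2)%N -> ~ io (fun i => W (kt.1, g) (kt.2 * d kt.1 i)) ->
        ~ W (kt.1, g) (kt.2 * d kt.1 m)].
  move=> [k t] /=; have [Qk|nQ] := pselect (Q k); last by exists 0%N.
  have [e eP] := group_enum G_count.
  have : ev (fun i => forall j, (j < (rank t).+1)%N -> forall g, rank g = j ->
      ~ io (fun i => W (k, g) (t * d k i)) -> ~ W (k, g) (t * d k i)).
    apply: ev_forall_lt => j _.
    have [[g [gj /not_io evg]]|ng] := pselect (exists g, rank g = j /\
        ~ io (fun i => W (k, g) (t * d k i))).
      by apply: ev_imp evg _ => i nW g'; rewrite -gj => /rankI->.
    by apply: evT => i g gj nio; case: ng; exists g.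
  move/(ev_and (divergent_neq z (@divergent_mull _ t _ (dd k Qk)))) => [N NP].
  exists (maxn N (rank t)) => _; have [nz tW] := NP _ (leq_maxl N (rank t)).
  by split=> //; [exact: leq_maxr|move=> g gt; exact: (tW (rank g))].
pose A k := [set x | exists t, T k t /\ t * d k (m (k, t)) = x].
have dA k : Q k -> divergent_set (A k).
  move=> Qk; apply: divergent_set_local => g; have [oW Wg fW] := WP (k, g) Qk.
  exists (W (k, g)); split=> //; apply: divergent_set_finite.
  have fr : finite_set [set t | (rank t < rank g)%N].
    exact: finite_inj_lt.
  apply: (@sub_finite_set _ _ ((fun t => t * d k (m (k, t))) @`
    ([set t | T k t /\ io (fun i => W (k, g) (t * d k i))] `|`
     [set t | (rank t < rank g)%N]))); last by apply: finite_image; rewrite finite_setU.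
  move=> _ [[t [Tt <-]] Wt]; exists t => //.
  have [ioW|nio] := pselect (io (fun i => W (k, g) (t * d k i))); first by left.
  right => /=; rewrite ltnNge; apply/negP => gt.
  by have [_ _ /(_ g gt nio)] := mP (k, t) Qk.
pose AA := [set x | exists2 k, Q k & A k x].
have cA : closed AA.
  apply: (divergent_set_closed G_seq) => w y wI wA wy.
  have /choice[kt ktP] : forall i, exists kt : nat * G,
      [/\ Q kt.1, T kt.1 kt.2 & kt.2 * d kt.1 (m kt) = w i].
    by move=> i; have [k Qk [t [Tt E]]] := wA i; exists (k, t).
  have [[k iok]|[phi ip inj]] := sub_const_or_inj (fun i => (kt i).1).
    have Qk : Q k by have [i _ <-] := iok 0%N; have [] := ktP i.
    apply: (divergent_set_io (dA k Qk) wI wy); apply: io_imp iok _ => i <-.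
    by have [_ Ti E] := ktP i; exists (kt i).2; split=> //; rewrite -E; case: (kt i).
  pose a i := d (kt (phi i)).1 (m (kt (phi i))).
  apply: (IB a) => [i|]; first by apply: dB; have [] := ktP (phi i).
  suff : two_sided F (fun i => (a i)^-1).
    move/(two_sided_inv F_inv); rewrite (_ : (fun _ => _) = a) //.
    by apply/funext => i; rewrite invgK.
  exists (w \o phi), (fun=> 1), y, 1; split; [exact: cvs_sub|exact: cvs_cst|].
  move=> n; have : ev (fun i => ~ `I_n (kt (phi i)).1) by apply: (inj_ev_finite inj); exact: finite_II.
  move=> evn; apply: ev_imp evn _ => i /= /negP; rewrite -leqNgt => nk.
  have [Qk Tt E] := ktP (phi i); rewrite mulg1 -E /a mulgK => Fn.
  by have [TF _ _] := TP _ Qk; apply: (TF _ Tt); exact: F_mono Fn.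
have nAz : ~ AA z.
  by move=> [k Qk [t [Tt E]]]; have [_ + _] := mP (k, t) Qk; exact.
apply: nAz; apply: cA; apply/closureP => U oU Uz.
have [V [V' [oV V1 oV' V'z VV]]] := nbhs_mul1 oU Uz.
have [k Qk [N NP]] := hit V' oV' V'z; have [TF T1 _] := TP k Qk.
have nT1 : ~ T k 1 by move=> /TF; apply; exact: F_mono F1.
(* As 1 is in the closure of [T k] but not in [T k], infinitely many [t] lie in [V], and one of them
   has rank at least [N]; then [m (k, t) >= N]. *)
have [|t [[Tt Vt] /negP]] := @infinite_setN0 _ ((T k `&` V) `\` [set t | (rank t < N)%N]).
  apply: infinite_setD; first exact: (closure_infinite G_T1 T1 nT1 oV V1).
  exact: finite_inj_lt.
rewrite -leqNgt => Nt; exists (t * d k (m (k, t))); first by exists k => //; exists t.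
apply: VV => //; apply: NP; have [+ _ _] := mP (k, t) Qk.
exact: leq_trans.
Qed.

End Selection.

Section Dichotomy.
Variable G : topologicalGroupType.
Hypothesis G_Tych : Tychonoff G.
Hypothesis G_count : countable [set: G].
Hypothesis G_seq : sequential G.
Hypothesis G_nd : ~ open [set (1 : G)%g].

Lemma first_countable_or_captured : IIA ->
  first_countable_space G \/ captured (seq_ideal (@divergent G)).
Proof.
move=> iia.
have [||||[B0 nB0 exB0]|/surrounded_nwd_first_countable] :=
  IIA_cases G_Tych G_count G_seq G_nd (I := [set A : set G | nwd A]) iia.
- exact: nwd_group_ideal.
- by apply: nwd_tame => //; exact: G_Tych.1.
- exact: nwd_weakly_closed.
- exact: nwd_invariant.
- have capN : captured [set A : set G | nwd A] by exists B0.
  have [F [exF cF nF iF F1]] := captured_nwd_family G_count capN.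
  have [B IB exB] := two_sided_captured G_Tych G_count G_seq G_nd exF cF iF F1 iia.
  have [|[h dh hit]] := divergent_cases G_Tych G_count G_seq G_nd iia; first by right.
  have [n [z [Q [d [dd dB dU]]]]] := concentrate G_count G_seq dh hit exB.
  by case: (not_concentrated G_Tych G_count G_seq exF nF iF F1 (IB n) dd dB dU).
- by left; auto.
Qed.

End Dichotomy.

(** * Cantor-Bendixson stages *)

Section LimitPoints.
Variable X : topologicalType.
Implicit Types (A : set X) (t : X).

Lemma limit_pointS A A' t : A `<=` A' -> limit_point A t -> limit_point A' t.
Proof. by move=> AA' lA U /lA[y [yt /AA' Ay Uy]]; exists y. Qed.

Lemma limit_pointP A t : limit_point A t <->
  forall U, open U -> U t -> exists y, [/\ y <> t, A y & U y].
Proof.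
split=> [lA U oU Ut|H V].
  by have [|y [/eqP yt Ay Uy]] := lA U; [exact: open_nbhs_nbhs|exists y].
rewrite nbhsE => -[U [oU Ut] UV]; have [y [/eqP yt Ay Uy]] := H U oU Ut.
by exists y; split=> //; exact: UV.
Qed.

Lemma limit_point_open A U t : open U -> U t -> limit_point A t -> limit_point (A `&` U) t.
Proof.
move=> oU Ut /limit_pointP lA; apply/limit_pointP => V oV Vt.
by have [||y [yt Ay [Uy Vy]]] := lA (U `&` V); [exact: openI|split|exists y].
Qed.

Lemma limit_pointU A B t : limit_point (A `|` B) t -> limit_point A t \/ limit_point B t.
Proof.
move=> /limit_pointP lAB; apply: contrapT => /not_orP[nA nB].
have far D : ~ limit_point D t -> exists U, [/\ open U, U t & forall s, s <> t -> D s -> ~ U s].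
  move=> nD; apply: contrapT => nU; apply: nD; apply/limit_pointP => U oU Ut.
  apply: contrapT => ns; apply: nU; exists U; split=> // s st Ds Us; apply: ns.
  by exists s.
have [U [oU Ut UA]] := far A nA; have [V [oV Vt VB]] := far B nB.
have [||s [st [As|Bs] [Us Vs]]] := lAB (U `&` V); [exact: openI|by split| |].
  exact: UA As Us.
exact: VB Bs Vs.
Qed.

Lemma limit_point_closure A t : limit_point A t -> closure A t.
Proof. by move=> lA U /lA[y [_ Ay Uy]]; exists y. Qed.

End LimitPoints.

(* Locked, because [done] would unfold [CB_stage] forever, through its unique
   constructor. *)
Definition stage (X : topologicalType) (K : set X) (a : Ord) (x : a) : set X :=
  locked (CB_stage K x).

Section Stages.
Variables (a : Ord).
Implicit Types (x y z : a).

Lemma ord_min (P : a -> Prop) x : P x ->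
  exists2 m, P m & forall y, olt y m -> ~ P y.
Proof.
elim: (olt_wf x) => {}x _ IH Px.
have [[y [yx Py]]|nP] := pselect (exists y, olt y x /\ P y); first exact: IH yx Py.
by exists x => // y yx Py; apply: nP; exists y.
Qed.

Lemma olt_nle x y : ~ olt x y -> x = y \/ olt y x.
Proof. by case: (olt_total x y) => [//|[->|]]; [left|right]. Qed.

Lemma ole_lt_trans x y z : ~ olt y x -> olt y z -> olt x z.
Proof. by move=> /olt_nle[->//|xy]; exact: olt_trans. Qed.

Section OneSpace.
Variable X : topologicalType.
Implicit Types (K A : set X) (t : X).

Lemma stageE K x t : stage K x t <-> CB_stage K x t.
Proof. by rewrite /stage -lock. Qed.

Lemma stageP K x t : stage K x t <->
  K t /\ forall y, olt y x -> limit_point (stage K y) t.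
Proof.
split=> [/stageE[{}x {}t Kt H]|].
  split=> // y /H[_]; apply: limit_pointS => s sy; exact/stageE.
elim: (olt_wf x) => {}x _ IH [Kt H]; apply/stageE; constructor; first exact: Kt.
move=> y yx; split.
  apply/stageE; apply: (IH y yx); split=> // z zy; apply: H.
  exact: olt_trans yx.
apply: limit_pointS (H y yx) => s sy; exact/stageE.
Qed.

Lemma stage_sub K x : stage K x `<=` K.
Proof. by move=> t /stageP[]. Qed.

Lemma stage_lt K x y : olt y x -> stage K x `<=` stage K y.
Proof.
move=> yx t /stageP[Kt H]; apply/stageP; split=> // z zy.
by apply: H; exact: olt_trans yx.
Qed.

Lemma stage_le K x y : ~ olt x y -> stage K x `<=` stage K y.
Proof. by move=> /olt_nle[->//|/stage_lt]; exact. Qed.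

Lemma stage_lim K x y t : olt y x -> stage K x t -> limit_point (stage K y) t.
Proof. by move=> yx /stageP[_]; apply. Qed.

Lemma stage_closed K x : closed K -> closed (stage K x).
Proof.
move=> cK t ct; apply/stageP; split=> [|y yx].
  by apply: cK; apply: closureS ct; exact: stage_sub.
apply/limit_pointP => U oU Ut; have [s xs Us] := (closureP _ _).1 ct U oU Ut.
have [st|st] := pselect (s = t); last by exists s; split=> //; exact: stage_lt xs.
subst s; have [z [zt xz Uz]] := (limit_pointP _ _).1 (stage_lim yx xs) U oU Ut.
by exists z; split.
Qed.

(** Take the least stage of which [t] is not a limit point: this is the rank of the point [t] in
    [K]. *)
Lemma stage_isolated K x t : K t -> ~ stage K x t ->
  exists y, [/\ olt y x, stage K y t & ~ limit_point (stage K y) t].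
Proof.
move=> Kt nxt; have [y0 [y0x ny0]] : exists y, olt y x /\ ~ limit_point (stage K y) t.
  apply: contrapT => nex; apply: nxt; apply/stageP; split=> // y yx.
  by apply: contrapT => ly; apply: nex; exists y.
have [y [yx ny] yP] := ord_min (P := fun y => olt y x /\ ~ limit_point (stage K y) t)
  (conj y0x ny0).
exists y; split=> //; apply/stageP; split=> // z zy; apply: contrapT => nz.
by apply: (yP z zy); split=> //; exact: olt_trans yx.
Qed.

(** If [t] is in neither stage, there are [y] and [z] below [x] such that [t] is not a limit point
    of the stages of [K] from [y] on, nor of those of [L] from [z] on; the larger of the two is
    impossible for the union. *)
Lemma stageU K L x t : closed K -> closed L ->
  stage (K `|` L) x t -> stage K x t \/ stage L x t.
Proof.
move=> cK cL; elim: (olt_wf x) t => {}x _ IH t xt.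
have lim y : olt y x -> limit_point (stage K y) t \/ limit_point (stage L y) t.
  by move=> yx; apply: limit_pointU; apply: limit_pointS (stage_lim yx xt) => s; exact: IH.
have bound (M : set X) : closed M -> ~ stage M x t -> M t \/ (exists y, olt y x) ->
    exists2 y, olt y x & forall z, ~ olt z y -> ~ limit_point (stage M z) t.
  move=> cM nM; have [Mt _|nMt [//|[y yx]]] := pselect (M t); last first.
    exists y => // z _ /limit_point_closure cl; apply: nMt; apply: cM.
    by apply: closureS cl; exact: stage_sub.
  have [y [yx _ ly]] := stage_isolated Mt nM; exists y => // z zy lz.
  by apply: ly; apply: limit_pointS lz; exact: stage_le.
apply: contrapT => /not_orP[nK nL].
have [y [z [yx zx hK hL]]] : exists y z, [/\ olt y x, olt z x,
    forall v, ~ olt v y -> ~ limit_point (stage K v) t &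
    forall v, ~ olt v z -> ~ limit_point (stage L v) t].
  case: (stage_sub xt) => h.
    have [y yx hK] := bound K cK nK (or_introl h).
    have [z zx hL] := bound L cL nL (or_intror (ex_intro _ y yx)); by exists y, z.
  have [z zx hL] := bound L cL nL (or_introl h).
  have [y yx hK] := bound K cK nK (or_intror (ex_intro _ z zx)); by exists y, z.
have [yz|yz] := pselect (olt y z).
  case: (lim z zx); last exact: hL (@olt_irr _ z).
  by apply: hK => zy; exact: olt_irr (olt_trans zy yz).
by case: (lim y yx); [exact: hK (@olt_irr _ y)|exact: hL yz].
Qed.

End OneSpace.

Lemma stage_map (X Y : topologicalType) (f : X -> Y) (K : set X) (L : set Y) :
  (forall t, K t -> L (f t)) ->
  (forall A t, A `<=` K -> K t -> limit_point A t -> limit_point (f @` A) (f t)) ->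
  forall x t, stage K x t -> stage L x (f t).
Proof.
move=> fKL flim x; elim: (olt_wf x) => {}x _ IH t xt.
have Kt := stage_sub xt; apply/stageP; split=> [|y yx]; first exact: fKL.
apply: limit_pointS (flim _ _ (@stage_sub _ K y) Kt (stage_lim yx xt)).
by move=> _ [s ys <-]; exact: (IH y yx).
Qed.

Lemma stageS (X : topologicalType) (K L : set X) x :
  K `<=` L -> stage K x `<=` stage L x.
Proof.
move=> KL t; apply: (stage_map (f := id)) => // A s _ _.
by apply: limit_pointS => y Ay; exists y.
Qed.

End Stages.

Lemma omega1_bounded (S : set omega1) : countable S ->
  exists w, forall s, S s -> olt s w.
Proof.
move=> cS; apply: contrapT => nw; apply: omega1_uncountable.
suff -> : [set: omega1] = \bigcup_(s in S) ([set s] `|` [set y | olt y s]).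
  apply: bigcup_countable => // s _.
  by apply: countable_union; [exact: finite_set_countable|exact: omega1_segment].
rewrite predeqE => w; split=> // _; apply: contrapT => nS; apply: nw; exists w => s Ss.
apply: contrapT => /olt_nle sw; apply: nS; exists s => //.
by case: sw => [->|sw]; [left|right].
Qed.

Section Agree.
Variables (X : topologicalType) (C : nat -> set X).
(** Agreement on the first [N] sets acts as closeness in an ultrametric, which need not induce the
    topology. *)
Definition agree N x y := forall i, (i < N)%N -> (C i x <-> C i y).

Lemma agree_refl N x : agree N x x. Proof. by []. Qed.

Lemma agree_sym N x y : agree N x y -> agree N y x.
Proof. by move=> h i /h; exact: iff_sym. Qed.

Lemma agree_trans N x y z : agree N x y -> agree N y z -> agree N x z.
Proof. by move=> xy yz i iN; exact: iff_trans (xy i iN) (yz i iN). Qed.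

Lemma agree_le M N x y : (M <= N)%N -> agree N x y -> agree M x y.
Proof. by move=> MN h i iM; apply: h; exact: leq_trans MN. Qed.

Hypothesis oC : forall i, open (C i).
Hypothesis cC : forall i, closed (C i).

Lemma clopen_agree_open N x : open [set y | agree N x y].
Proof.
elim: N => [|N IH]; first by rewrite (_ : mkset _ = setT) ?predeqE //; exact: openT.
have oN : open [set y | C N x <-> C N y].
  have [Cx|nCx] := pselect (C N x).
    rewrite (_ : mkset _ = C N); first exact: oC N.
    by rewrite predeqE => y; split=> [[+ _]|Cy]; [exact|split].
  rewrite (_ : mkset _ = ~` C N); first by rewrite openC; exact: cC N.
  rewrite predeqE => y; split=> [[_ yx] /yx //|nCy].
  by split=> // Cy; case: nCy.
rewrite (_ : mkset _ = [set y | agree N x y] `&` [set y | C N x <-> C N y]).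
  exact: openI.
rewrite predeqE => y; split=> [xy|[xy Nxy] i]; first by split; [exact: agree_le xy|exact: xy].
by rewrite ltnS leq_eqVlt => /orP[/eqP->//|]; exact: xy.
Qed.

End Agree.

Definition seq_compact (X : topologicalType) (K : set X) := forall u, (forall i, K (u i)) ->
  exists phi x, [/\ incr phi, K x & cvs (u \o phi) x].

(** [C] separates the points, hence determines the convergence of sequences on
    each of the compact sets [Xs n]. *)
Record komega (X : topologicalType) (Xs C : nat -> set X) : Prop := Komega {
  ko_mono : forall m n, (m <= n)%N -> Xs m `<=` Xs n;
  ko_cpt : forall n, seq_compact (Xs n);
  ko_ev : forall u x, cvs u x -> exists n, ev (fun i => Xs n (u i));
  ko_open : forall i, open (C i);
  ko_closed : forall i, closed (C i);
  ko_sep : forall x y, x <> y -> exists i, C i x /\ ~ C i y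
}.

Arguments ko_cpt {X Xs C} _ n _ _.
Arguments ko_mono {X Xs C} _ {m n} _ _ _.

Section Komega.
Variables (X : topologicalType) (Xs C : nat -> set X).
Hypothesis ko : komega Xs C.
Implicit Types (x y t : X) (u : nat -> X) (K A : set X).

Lemma ko_cover x : exists n, Xs n x.
Proof.
have [n evn] := ko_ev ko (@cvs_cst _ x); exists n.
by have [i _] := ev_io evn 0%N.
Qed.

Lemma agree_open N x : open [set y | agree C N x y].
Proof. exact: clopen_agree_open (ko_open ko) (ko_closed ko) _ _. Qed.

Lemma cvs_agree u x N : cvs u x -> ev (fun i => agree C N x (u i)).
Proof. by move=> ux; exact: ux (@agree_open N x) (@agree_refl _ C N x). Qed.

Lemma agree_eq x y : (forall N, agree C N x y) -> x = y.
Proof.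
move=> xy; apply: contrapT => /(ko_sep ko)[i [Cx nCy]].
by apply: nCy; exact/(xy i.+1 i (ltnSn i)).
Qed.

Lemma agree_neq x y : x <> y -> exists N, ~ agree C N x y.
Proof.
by move=> /(ko_sep ko)[i [Cx nCy]]; exists i.+1 => xy; apply: nCy; exact/(xy i (ltnSn i)).
Qed.

Lemma ko_unique u x y : cvs u x -> cvs u y -> x = y.
Proof.
move=> ux uy; apply: agree_eq => N.
have [i _ [xu yu]] := ev_io (ev_and (cvs_agree N ux) (cvs_agree N uy)) 0%N.
exact: agree_trans xu (agree_sym yu).
Qed.

(** A subsequence avoiding [U] would, by compactness, have a further subsequence with a limit that
    the sets [C] cannot distinguish from [x]. *)
Lemma agree_cvs K u x : seq_compact K -> (forall i, K (u i)) ->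
  (forall N, ev (fun i => agree C N x (u i))) -> cvs u x.
Proof.
move=> cK uK ag U oU Ux; apply: contrapT => /not_ev/subseq1[phi ip nU].
have [|psi [y [iq _ uy]]] := cK (u \o phi); first by move=> i; exact: uK.
have xy : x = y.
  apply: agree_eq => N.
  have := ev_and (ev_sub (incr_comp ip iq) (ag N)) (cvs_agree N uy).
  move=> /ev_io/(_ 0%N)[i _ [xu yu]].
  exact: agree_trans xu (agree_sym yu).
subst y; have [i _] := ev_io (uy U oU Ux) 0%N.
exact: nU.
Qed.

Lemma agree_diag N u x : (forall i, agree C i x (u i)) -> ev (fun i => agree C N x (u i)).
Proof. by move=> h; exists N => i Ni; exact: agree_le Ni (h i). Qed.

Lemma seq_compact_closed K : seq_compact K -> closed K.
Proof.
move=> cK t /closureP ct; have /choice[u uP] : forall N, exists s, K s /\ agree C N t s.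
  move=> N; have [s Ks ts] := ct _ (@agree_open N t) (@agree_refl _ C N t).
  by exists s.
have [|phi [y [ip Ky uy]]] := cK u; first by move=> i; exact: (uP i).1.
have ut : cvs u t.
  by apply: (agree_cvs cK) => [i|N]; [exact: (uP i).1|apply: agree_diag => i; exact: (uP i).2].
by rewrite (ko_unique (cvs_sub ip ut) uy).
Qed.

Lemma seq_compact_sub K : seq_compact K -> exists n, K `<=` Xs n.
Proof.
move=> cK; apply: contrapT => nK.
have /choice[u uP] : forall n, exists x, K x /\ ~ Xs n x.
  move=> n; apply: contrapT => nx; apply: nK; exists n => x Kx.
  by apply: contrapT => nX; apply: nx; exists x.
have [|phi [y [ip Ky uy]]] := cK u; first by move=> i; exact: (uP i).1.
have [n [N NP]] := ko_ev ko uy.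
apply: (uP (phi (maxn N n))).2; apply: (ko_mono ko) (NP (maxn N n) (leq_maxl _ _)).
apply: leq_trans (leq_maxr N n) _; exact: incr_ge.
Qed.

Lemma cvs_sub_inj u x : cvs u x -> (forall i, u i <> x) ->
  exists2 phi, incr phi & injective (u \o phi).
Proof.
move=> ux un; have [[v iov]|//] := sub_const_or_inj u.
have [phi ip uv] := subseq1 iov; exfalso; apply: (un (phi 0%N)); rewrite uv.
apply: (ko_unique _ (cvs_sub ip ux)); apply: (cvs_ev (@cvs_cst _ v)).
by apply: evT => i /=.
Qed.

Lemma limit_point_seq K A t : seq_compact K -> A `<=` K -> limit_point A t ->
  exists u, [/\ injective u, forall i, A (u i), forall i, u i <> t & cvs u t].
Proof.
move=> cK AK /limit_pointP lA.
have /choice[u uP] : forall N, exists s, [/\ s <> t, A s & agree C N t s].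
  move=> N; have [s [st As ts]] := lA _ (@agree_open N t) (@agree_refl _ C N t).
  by exists s.
have ut : cvs u t.
  apply: (agree_cvs cK) => [i|N]; first by apply: AK; have [] := uP i.
  by apply: agree_diag => i; have [] := uP i.
have [|phi ip inj] := cvs_sub_inj ut; first by move=> i; have [] := uP i.
exists (u \o phi); split=> //; last exact: cvs_sub.
- by move=> i; have [] := uP (phi i).
- by move=> i; have [] := uP (phi i).
Qed.

Lemma seq_compact_closed_sub K A : seq_compact K -> closed A -> A `<=` K -> seq_compact A.
Proof.
move=> cK cA AK u uA; have [|phi [y [ip Ky uy]]] := cK u; first by move=> i; exact/AK.
exists phi, y; split=> //; apply: cA; apply: (cvs_closure uy).
by apply: io_all => i; exact: uA.
Qed.

Lemma seq_limit_point u A t : injective u -> (forall i, A (u i)) -> cvs u t -> limit_point A t.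
Proof.
move=> uI uA ut; apply/limit_pointP => U oU Ut.
have [i _ [Ui ui]] := ev_io (ev_and (ut U oU Ut) (inj_ev_neq t uI)) 0%N.
by exists (u i).
Qed.

Hypothesis X_count : countable [set: X].

(** Baire category: step [k] moves to a point that finitely many of the sets [C] distinguish from
    [e k], and later steps keep this distinction, so a limit would differ from every point of the
    countable space. *)
Lemma crowded_not_seq_compact K : seq_compact K -> K !=set0 ->
  ~ (forall t, K t -> limit_point K t).
Proof.
move=> cK [t0 Kt0] perf; have [e _ eP] := countable_enum X_count (I : [set: X] t0).
have step (k : nat) (tN : {tN : X * nat | K tN.1}) : {sM : {sM : X * nat | K sM.1} |
    [/\ agree C (sval tN).2 (sval tN).1 (sval sM).1, ((sval tN).2 <= (sval sM).2)%N &
      ~ agree C (sval sM).2 (sval sM).1 (e k)]}.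
  apply: cid; case: tN => -[t N] /= Kt.
  have [s [Ks ts sk]] : exists s, [/\ K s, agree C N t s & s <> e k].
    have [tk|tk] := pselect (t = e k); last by exists t; split=> //; exact: agree_refl.
    have /limit_pointP lK := perf t Kt.
    have [s [st Ks ts]] := lK _ (@agree_open N t) (@agree_refl _ C N t).
    by exists s; split=> //; rewrite -tk.
  have [M nM] := agree_neq sk.
  exists (exist (fun tN : X * nat => K tN.1) (s, maxn N M) Ks) => /=; split=> //.
    exact: leq_maxl.
  by move=> sM; apply: nM; exact: (agree_le (leq_maxr N M) sM).
pose S := fix S k := if k is j.+1 then sval (step j (S j))
  else exist (fun tN : X * nat => K tN.1) (t0, 0%N) Kt0.
pose t k := (sval (S k)).1; pose N k := (sval (S k)).2.
have SP k : [/\ agree C (N k) (t k) (t k.+1), (N k <= N k.+1)%N &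
    ~ agree C (N k.+1) (t k.+1) (e k)] := svalP (step k (S k)).
have tag j k : agree C (N k) (t k) (t (k + j)%N).
  elim: j => [|j IH]; first by rewrite addn0; exact: agree_refl.
  rewrite addnS; apply: agree_trans IH _; have [+ _ _] := SP (k + j)%N.
  apply: agree_le; elim: j => [|j IH]; first by rewrite addn0.
  by rewrite addnS; apply: leq_trans IH _; have [] := SP (k + j)%N.
have [|phi [y [ip Ky ty]]] := cK t; first by move=> i; exact: (svalP (S i)).
have [k ek] := eP y I; have [_ _ nk] := SP k; apply: nk.
rewrite ek; have [M MP] := cvs_agree (N k.+1) ty.
have yt := MP (maxn M k.+1) (leq_maxl _ _); apply: agree_trans (agree_sym yt) => /=.
have kM : (k.+1 <= phi (maxn M k.+1))%N by apply: leq_trans (incr_ge _ ip); exact: leq_maxr.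
by rewrite -(subnKC kM).
Qed.

(** Those of the countably many points that ever leave the stages do so before a common [w]. The
    stage [w] is then contained in every other one, so it has no isolated points and must be
    empty. *)
Lemma empty_stage n : exists w : omega1, stage (Xs n) w = set0.
Proof.
have /choice[f fP] : forall x, exists w : omega1, forall v : omega1,
    ~ stage (Xs n) v x -> ~ stage (Xs n) w x.
  move=> x; have [[w nw]|nex] := pselect (exists w : omega1, ~ stage (Xs n) w x).
    by exists w.
  have [w _] := omega1_bounded (S := set0) (finite_set_countable (finite_set0 _)).
  by exists w => v nv; case: nex; exists v.
have [|w wP] := @omega1_bounded (range f).
  by apply: sub_countable X_count; exact: card_image_le.
have [w' ww'] := omega1_bounded (S := [set w]) (finite_set_countable (finite_set1 w)).
have sw (v : omega1) : stage (Xs n) w `<=` stage (Xs n) v.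
  move=> t wt; apply: contrapT => nv; apply: (fP t v nv).
  by apply: stage_lt wt; apply: wP; exists t.
exists w; apply: contrapT => /eqP/set0P nw.
have cX := seq_compact_closed (ko_cpt ko n).
apply: (crowded_not_seq_compact (seq_compact_closed_sub (ko_cpt ko n)
  (stage_closed cX) (@stage_sub _ _ _ w)) nw) => t /(sw w').
by apply: stage_lim; exact: ww'.
Qed.

End Komega.

(** * Ranks of the compact sets of a homogeneous k_omega space *)

Section Addition.

Let bound (g : omega1) (d : omega1) (rec : forall y, olt y d -> omega1) :
  {w : omega1 | [/\ ~ olt w g, forall y (yd : olt y d), olt (rec y yd) w &
     forall v, olt v w -> olt v g \/ exists y (yd : olt y d), ~ olt (rec y yd) v]}.
Proof.
apply: cid; pose f y := if pselect (olt y d) is left yd then rec y yd else g.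
have [|w0 w0P] := @omega1_bounded (f @` [set y | olt y d] `|` [set g]).
  apply: countable_union; last exact: finite_set_countable.
  by apply: sub_countable (@omega1_segment d); exact: card_image_le.
have recf y (yd : olt y d) : rec y yd = f y.
  rewrite /f; case: pselect => [yd'|//].
  by rewrite (Prop_irrelevance yd yd').
pose P w := ~ olt w g /\ forall y (yd : olt y d), olt (rec y yd) w.
have Pw0 : P w0.
  split; first by move=> w0g; apply: (olt_irr (olt_trans w0g (w0P g (or_intror erefl)))).
  by move=> y yd; apply: w0P; left; exists y => //; rewrite recf.
have [w [wg wP] wmin] := ord_min Pw0; exists w; split=> // v vw.
apply: contrapT => /not_orP[vg nv]; apply: (wmin v vw); split=> // y yd.
by apply: contrapT => nr; apply: nv; exists y, yd.
Qed.

(** The ordinal sum of [g] and [d], by well-founded recursion on [d]. *)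
Definition oadd (g : omega1) : omega1 -> omega1 :=
  Fix (@olt_wf omega1) (fun=> omega1) (fun d rec => sval (bound g rec)).

Lemma oaddE g d : oadd g d = sval (bound g (fun y (_ : olt y d) => oadd g y)).
Proof.
rewrite /oadd Fix_eq // => x f f' ff'; congr (sval (@bound g x _)).
by apply: functional_extensionality_dep => y; apply: functional_extensionality_dep => yx.
Qed.

Lemma oadd_ge g d : ~ olt (oadd g d) g.
Proof. by rewrite oaddE; case: bound => w []. Qed.

Lemma oadd_lt g d d' : olt d' d -> olt (oadd g d') (oadd g d).
Proof. by move=> dd; rewrite [oadd g d]oaddE; case: bound => w /= [_ wP _]; exact: wP. Qed.

Lemma oadd_inv g d v : olt v (oadd g d) ->
  olt v g \/ exists2 d', olt d' d & ~ olt (oadd g d') v.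
Proof.
rewrite oaddE; case: bound => w /= [_ _ vP] /vP[|[y [yd yv]]]; first by left.
by right; exists y.
Qed.

End Addition.

(** [w] belongs to it when some [Xs n] has rank greater than [w], so the order type of this initial
    segment of [omega1] is the supremum of the ranks. *)
Definition ranks (X : topologicalType) (Xs : nat -> set X) : set omega1 :=
  [set w | exists n, stage (Xs n) w !=set0].

(** Holds when [Xs] comes from a group: [x p^-1 K] is a copy of [K], and the sets
    [Xs n * p^-1 * Xs k] are contained in some [Xs m]. *)
Definition homogeneous (X : topologicalType) (Xs : nat -> set X) :=
  forall k (w : omega1) n, stage (Xs k) w !=set0 -> exists m, Xs n `<=` stage (Xs m) w.

(** The input of the back-and-forth argument: extending a map to [Xs n] needs, near each point
    already used in the other space, fresh points surviving to a stage [w] at which [Xs n] has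
    vanished. Hence [w] has to be in the common set [B]. *)
Definition rank_rich (X : topologicalType) (Xs : nat -> set X) (B : set omega1) :=
  (forall n, exists2 w, B w & stage (Xs n) w = set0) /\
  (forall n w, B w -> exists2 m, (n <= m)%N & forall x, Xs n x ->
    limit_point (stage (Xs m) w `\` Xs n) x).

Section Ranks.
Variables (X : topologicalType) (Xs C : nat -> set X).
Hypothesis ko : komega Xs C.
Hypothesis X_count : countable [set: X].

Lemma ranks_countable : countable (ranks Xs).
Proof.
have /choice[w wP] := empty_stage ko X_count.
apply: (@sub_countable _ _ _ (\bigcup_n [set v | olt v (w n)])).
  apply: subset_card_le => v [n [t vt]]; exists n => //=; apply: contrapT => vw.
  have : stage (Xs n) (w n) t by exact: stage_le vt.
  by rewrite wP.
by apply: bigcup_countable => // n _; exact: omega1_segment.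
Qed.

Lemma ranks_lt v w : olt v w -> ranks Xs w -> ranks Xs v.
Proof. by move=> vw [n [t wt]]; exists n, t; exact: stage_lt wt. Qed.

Hypothesis X_hom : homogeneous Xs.

(** All of [K] survives to the stage [g] of [M], so taking [d] derivatives of [K] costs [d] further
    derivatives of [M]. *)
Lemma stage_oadd (K M : set X) (g d : omega1) :
  K `<=` stage M g -> stage K d `<=` stage M (oadd g d).
Proof.
move=> KM; elim: (olt_wf d) => {}d _ IH t dt; have gt := KM _ (stage_sub dt).
apply/stageP; split=> [|v /oadd_inv[vg|[d' d'd nv]]]; first exact: stage_sub gt.
  exact: stage_lim vg gt.
apply: limit_pointS (stage_lim d'd dt) => s /(IH d' d'd).
exact: stage_le nv _.
Qed.

Lemma ranks_oadd p q : ranks Xs p -> ranks Xs q -> ranks Xs (oadd p q).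
Proof.
move=> [k pk] [j [t qt]]; have [m mP] := X_hom j pk.
by exists m, t; exact: stage_oadd mP _ qt.
Qed.

Variables (u : nat -> X) (t : X).
Hypothesis u_inj : injective u.
Hypothesis u_t : cvs u t.

(** The two elements are 0 and 1: the limit of the given sequence survives one derivative. *)
Lemma ranks_two : exists v w, [/\ ranks Xs v, ranks Xs w & olt v w].
Proof.
have [n evn] := ko_ev ko u_t; have [phi ip un] := subseq1 (ev_io evn).
have [w _] := omega1_bounded (S := set0) (finite_set_countable (finite_set0 _)).
have [v _ vmin] := @ord_min omega1 (fun=> True) w Logic.I.
have [|v' v'P] := @omega1_bounded [set v]; first exact: finite_set_countable.
have [v1 vv1 v1min] := ord_min (P := fun v1 => olt v v1) (v'P v erefl).
exists v, v1; suff B1 : ranks Xs v1 by split=> //; exact: ranks_lt B1.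
have Xt : Xs n t.
  apply: (seq_compact_closed ko (ko_cpt ko n)); apply: (cvs_closure u_t).
  exact: ev_io.
exists n, t; apply/stageP; split=> // y yv1.
apply: (@seq_limit_point _ (u \o phi)) => [|i|]; last exact: cvs_sub.
  by apply: inj_comp => //; exact: incr_inj.
apply/stageP; split=> [|z zy]; [exact: un|exfalso]; apply: (v1min y yv1).
by have [vz|/olt_nle[->//|/vmin]] := pselect (olt v z); first exact: olt_trans vz zy.
Qed.

(** Let [w] be the first empty stage. If [w] has a predecessor [g], then [g] is in the set, and so
    is a sum exceeding it. If [w] is a nonzero limit, compactness gives a point in all stages below
    [w], hence in the stage [w]. *)
Lemma ranks_bounded n : exists2 w, ranks Xs w & stage (Xs n) w = set0.
Proof.
have [w0 w0P] := empty_stage ko X_count n.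
have [w wE wmin] := ord_min (P := fun w : omega1 => stage (Xs n) w = set0) w0P.
have [b0 [b1 [B0 B1 b01]]] := ranks_two.
have [[g [gw gmax]]|nmax] := pselect (exists g, olt g w /\ forall z, olt g z -> ~ olt z w).
  have Bg : ranks Xs g.
    by exists n; apply/set0P/eqP => gE; exact: wmin gw gE.
  exists (oadd g b1); first exact: ranks_oadd.
  rewrite -subset0 -wE; apply: stage_le; apply: gmax.
  by apply: ole_lt_trans (oadd_lt g b01); exact: oadd_ge.
have wlim y : olt y w -> exists z, olt y z /\ olt z w.
  move=> yw; apply: contrapT => nz; apply: nmax; exists y; split=> // z yz zw.
  by apply: nz; exists z.
have [[y0 y0w]|ny] := pselect (exists y, olt y w); last first.
  exists b0 => //; rewrite -subset0 -wE => x /stage_sub Xx.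
  by apply/stageP; split=> // y yw; case: ny; exists y.
exfalso; have [y yw yP] := countable_enum (omega1_segment w) y0w.
have /choice[s sP] : forall i, exists x, forall j, (j <= i)%N -> stage (Xs n) (y j) x.
  move=> i; suff [z zw zP] : exists2 z, olt z w & forall j, (j <= i)%N -> ~ olt z (y j).
    have /eqP/set0P[x zx] := wmin z zw; exists x => j /zP jz.
    exact: stage_le zx.
  elim: i => [|i [z zw zP]].
    exists (y 0%N); first exact: yw.
    by move=> j; rewrite leqn0 => /eqP->; exact: olt_irr.
  have [zy|zy] := pselect (olt z (y i.+1)).
    exists (y i.+1); first exact: yw.
    move=> j; rewrite leq_eqVlt => /orP[/eqP->|/zP zj]; first exact: olt_irr.
    by move=> /(olt_trans zy).
  by exists z => // j; rewrite leq_eqVlt => /orP[/eqP->|/zP].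
have [i|phi [x [ip Xx sx]]] := ko_cpt ko n s.
  by apply: stage_sub (sP i i (leqnn i)).
suff : stage (Xs n) w x by rewrite wE.
have xy z : olt z w -> stage (Xs n) z x.
  move=> /yP[j <-]; apply: (stage_closed (seq_compact_closed ko (ko_cpt ko n))).
  apply: (cvs_closure sx); apply: ev_io; exists j => i ji; apply: sP.
  exact: leq_trans ji (incr_ge i ip).
apply/stageP; split=> // z zw; have [z' [zz' z'w]] := wlim z zw.
exact: stage_lim zz' (xy _ z'w).
Qed.

(** In a larger [Xs m] the points of [Xs n] survive to the stage [oadd g d], where the stage [d] of
    [Xs n] is empty. If near [x] the stage [g] of [Xs m] added nothing outside [Xs n], its [d]
    further derivatives would be bounded by those of [Xs n] and vanish at [x]. *)
Lemma ranks_rich : rank_rich Xs (ranks Xs).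
Proof.
split; first exact: ranks_bounded.
move=> n g Bg; have [d Bd dE] := ranks_bounded n.
have [b0 [b1 [B0 B1 b01]]] := ranks_two.
pose p := oadd g d; have Bp : ranks Xs p by exact: ranks_oadd.
have [k qk] := ranks_oadd Bp B1; have [m0 m0P] := X_hom n qk.
pose m := maxn n m0; have mP : Xs n `<=` stage (Xs m) (oadd p b1).
  by move=> x /m0P; apply: stageS; exact: (ko_mono ko (leq_maxr n m0)).
exists m => [|x Xx]; first exact: leq_maxl.
have px : stage (Xs m) p x.
  apply: stage_le (stage_lt (oadd_lt p b01) (mP x Xx)); exact: oadd_ge.
apply/limit_pointP => U oU Ux; apply: contrapT => nex.
have sub s : stage (Xs m) g s -> U s -> Xs n s.
  move=> gs Us; have [->//|sx] := pselect (s = x).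
  by apply: contrapT => nXs; apply: nex; exists s.
have key e : stage (Xs m) (oadd g e) `&` U `<=` stage (Xs n) e.
  elim: (olt_wf e) => {}e _ IH s [es Us]; apply/stageP; split=> [|e' e'e].
    by apply: sub Us; apply: stage_le es; exact: oadd_ge.
  have := limit_point_open oU Us (stage_lim (oadd_lt g e'e) es).
  by apply: limit_pointS; exact: IH.
by have : stage (Xs n) d x; [exact: key|rewrite dE].
Qed.

End Ranks.

(** * The extension lemma *)

(** Course-of-values dependent choice: the history is kept as a list, read with the default [t0]
    beyond its end. *)
Lemma strong_dep_choice (T : Type) (P : (nat -> T) -> nat -> T -> Prop) (t0 : T) :
  (forall f n, exists y, P f n y) ->
  (forall f g n y, (forall i, (i < n)%N -> f i = g i) -> P f n y -> P g n y) ->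
  exists f, forall n, P f n (f n).
Proof.
move=> ex ext; have /choice[h hP] : forall fn : (nat -> T) * nat, exists y, P fn.1 fn.2 y.
  by move=> [f n]; exact: ex.
pose s := fix s n := if n is m.+1 then rcons (s m) (h (nth t0 (s m), m)) else [::].
have sz n : size (s n) = n by elim: n => //= n IH; rewrite size_rcons IH.
have stab n j i : (i < n)%N -> nth t0 (s (n + j)%N) i = nth t0 (s n) i.
  move=> ik; elim: j => [|j IH]; first by rewrite addn0.
  by rewrite addnS /= nth_rcons sz ltn_addr.
exists (fun n => nth t0 (s n.+1) n) => n.
rewrite /= nth_rcons sz ltnn eqxx; apply: ext (hP (nth t0 (s n), n)) => i /= ik.
by rewrite -(subnKC ik) stab.
Qed.

Definition continuous_on (X Y : topologicalType) (K : set X) (f : X -> Y) :=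
  forall u x, (forall i, K (u i)) -> cvs u x -> cvs (f \o u) (f x).

Section Extension.
Variables (X Y : topologicalType) (Xs C : nat -> set X) (Ys D : nat -> set Y).
Hypothesis koX : komega Xs C.
Hypothesis koY : komega Ys D.
Hypothesis X_count : countable [set: X].
Variables (K : set X) (phi0 : X -> Y) (x0 : X) (n k m : nat) (g : omega1).
Hypothesis K_cpt : seq_compact K.
Hypothesis Kx0 : K x0.
Hypothesis K_sub : K `<=` Xs n.
Hypothesis phi0_inj : forall x y, K x -> K y -> phi0 x = phi0 y -> x = y.
Hypothesis phi0_cont : continuous_on K phi0.
Hypothesis phi0_sub : forall x, K x -> Ys k (phi0 x).
Hypothesis g_empty : stage (Xs n) g = set0.
Hypothesis km : (k <= m)%N.
Hypothesis rich : forall y, Ys k y -> limit_point (stage (Ys m) g `\` Ys k) y.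

Let L := Xs n.
Let L_cpt : seq_compact L := ko_cpt koX n.
Let L_closed : closed L := seq_compact_closed koX L_cpt.
Let K_closed : closed K := seq_compact_closed koX K_cpt.

Let rank : {r : X -> nat | injective r} := cid (countable_rank X_count).
Let r := sval rank.
Let r_inj : injective r := svalP rank.

(** [rho x] is the rank of the point [x] in [L], the last stage that contains it; it is below [g]
    because that stage is empty. *)
Let rho_ex : {rho : X -> omega1 | forall x, L x ->
  [/\ olt (rho x) g, stage L (rho x) x & ~ limit_point (stage L (rho x)) x]}.
Proof.
apply: cid; have /choice[rho rhoP] : forall x, exists w : omega1, L x ->
    [/\ olt w g, stage L w x & ~ limit_point (stage L w) x].
  move=> x; have [Lx|nL] := pselect (L x); last by exists g.
  have [|w wP] := @stage_isolated _ _ L g x Lx; first by rewrite g_empty.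
  by exists w.
by exists rho.
Qed.
Let rho := sval rho_ex.
Let rhoP := svalP rho_ex.

Let isolated x : L x -> exists N, forall y, L y -> agree C N x y -> y <> x -> olt (rho y) (rho x).
Proof.
move=> Lx; apply: contrapT => nN; have [_ _] := rhoP Lx; apply.
have /choice[u uP] : forall N, exists y, [/\ L y, agree C N x y, y <> x & ~ olt (rho y) (rho x)].
  move=> N; apply: contrapT => ny; apply: nN; exists N => y Ly xy yx.
  by apply: contrapT => nr; apply: ny; exists y.
have ux : cvs u x.
  apply: (agree_cvs koX L_cpt) => [i|N]; first by have [] := uP i.
  by apply: agree_diag => i; have [] := uP i.
apply/limit_pointP => U oU Ux; have [i _ Ui] := ev_io (ux U oU Ux) 0%N.
have [Li _ nx nr] := uP i; exists (u i); split=> //.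
by have [_ + _] := rhoP Li; exact: stage_le.
Qed.

Let far_K x : ~ K x -> exists N, forall c, K c -> ~ agree C N x c.
Proof.
move=> nK; apply: contrapT => nN; apply: nK; apply: K_closed.
have /choice[u uP] : forall N, exists y, K y /\ agree C N x y.
  move=> N; apply: contrapT => ny; apply: nN; exists N => y Ky xy.
  by apply: ny; exists y.
apply: (@cvs_closure _ u) => [|i]; last by exists i => //; exact: (uP i).1.
by apply: (agree_cvs koX K_cpt) => [i|N]; [exact: (uP i).1|
  apply: agree_diag => i; exact: (uP i).2].
Qed.

Let far_earlier x : exists N, forall c, (r c < r x)%N -> ~ agree C N x c.
Proof.
have [j|N NP] := @bounded_choice (fun j d => forall c, r c = j -> c <> x -> ~ agree C d x c) (r x).
  have [[c [cj cx]]|nc] := pselect (exists c, r c = j /\ c <> x).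
    have [d nd] := agree_neq koX (nesym cx); exists d => c'; rewrite -cj => /r_inj-> _.
    exact: nd.
  by exists 0%N => c cj cx; case: nc; exists c.
exists N => c cx xc; have [d dN dP] := NP (r c) (ltnW cx).
apply: (dP c erefl); last exact: agree_le dN xc.
by move=> cxE; move: cx; rewrite cxE ltnn.
Qed.

(* The image of [x] is chosen near the image of the closest point among [K] and
   the points treated before [x] that have a larger rank than [x]. *)
Let cand x p := K p \/ [/\ L p, ~ K p, (r p < r x)%N & olt (rho x) (rho p)].
Let near x p N := [/\ cand x p, agree C N x p & forall c M, cand x c -> agree C M x c -> (M <= N)%N].

(** A largest agreement exists because the sets [C] distinguish [x], at some bounded level, from all
    of the compact [K] and from the finitely many earlier points. *)
Let near_ex x : L x -> ~ K x -> exists p N, near x p N.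
Proof.
move=> Lx nK; pose P M := `[< exists2 c, cand x c & agree C M x c >].
have [N1 N1P] := far_K nK; have [N2 N2P] := far_earlier x.
have exP : exists M, P M by exists 0%N; apply/asboolP; exists x0 => //; left.
have ubP M : P M -> (M <= maxn N1 N2)%N.
  move=> /asboolP[c cc xc]; rewrite leqNgt gtn_max; apply/negP => /andP[M1 M2].
  case: cc => [/N1P|[_ _ /N2P cx _]]; first by apply; exact: agree_le (ltnW M1) xc.
  by apply: cx; exact: agree_le (ltnW M2) xc.
case: (ex_maxnP exP ubP) => N /asboolP[p cp xp] NP; exists p, N; split=> // c M cc xc.
by apply: NP; apply/asboolP; exists c.
Qed.

Let val (f : nat -> Y) p := if pselect (K p) then phi0 p else f (r p).

Let valK f p : K p -> val f p = phi0 p. Proof. by rewrite /val; case: pselect. Qed.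
Let valN f p : ~ K p -> val f p = f (r p). Proof. by rewrite /val; case: pselect. Qed.

(** Avoiding [Ys k] keeps new images apart from those of [K]; surviving to the stage [w] leaves room
    nearby for later points of smaller rank. *)
Let good (w : omega1) y := stage (Ys m) w y /\ ~ Ys k y.

(** The premise on earlier values makes a choice possible after an arbitrary history [f]; it is
    discharged by induction once the whole sequence exists. *)
Let spec (f : nat -> Y) j y := forall x, r x = j -> L x -> ~ K x ->
  (forall z, L z -> ~ K z -> (r z < j)%N -> good (rho z) (f (r z))) ->
  [/\ good (rho x) y, exists p N, near x p N /\ agree D N (val f p) y &
     forall i, (i < j)%N -> f i <> y].

Let spec_ex f j : exists y, spec f j y.
Proof.
have [[x [xj Lx nKx inv]]|nx] := pselect (exists x, [/\ r x = j, L x, ~ K x &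
    forall z, L z -> ~ K z -> (r z < j)%N -> good (rho z) (f (r z))]); last first.
  by exists (phi0 x0) => x xj Lx nKx inv; case: nx; exists x.
have [p [N nearp]] := near_ex Lx nKx; have [cp xp _] := nearp.
have [rg _ _] := rhoP Lx.
(* Near [phi0 p] fresh points come from [rich]; near the image of an earlier point of larger rank
   they come from the definition of the stages. *)
have /(limit_point_seq koY (ko_cpt koY m))[|u [uI uG _ up]] :
    limit_point (stage (Ys m) (rho x) `\` Ys k) (val f p); last first.
- have fin : finite_set (f @` `I_j) by apply: finite_image; exact: finite_II.
  have [i _ [pu nu]] := ev_io (ev_and (cvs_agree koY N up) (inj_ev_finite uI fin)) 0%N.
  exists (u i) => x'; rewrite -xj => /r_inj-> _ _ _; split.
  + exact: uG.
  + by exists p, N.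
  + by move=> i' ij fu; apply: nu; exists i' => //=; rewrite -xj.
- by move=> y [/stage_sub].
- have [Kp|nKp] := pselect (K p).
    rewrite valK //; apply: limit_pointS (rich (phi0_sub Kp)) => y [gy nYy].
    by split=> //; exact: stage_lt gy.
  rewrite valN //; case: cp => [//|[Lp _ rp xp']].
  have [|sp np] := inv p Lp nKp; first by rewrite -xj.
  rewrite setDE; apply: limit_point_open => //; last exact: stage_lim xp' sp.
  by rewrite openC; exact: (seq_compact_closed koY (ko_cpt koY k)).
Qed.

Lemma extension : exists phi : X -> Y, [/\ forall x, K x -> phi x = phi0 x,
  forall x y, L x -> L y -> phi x = phi y -> x = y, continuous_on L phi &
  forall x, L x -> Ys m (phi x)].
Proof.
have [f fP] : exists f, forall j, spec f j (f j).
  apply: (strong_dep_choice (phi0 x0)); first exact: spec_ex.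
  move=> f h j y fh sf x xj Lx nKx inv.
  have [z Lz nKz zj|gy [p [N [np py]]] fy] := sf x xj Lx nKx.
    by rewrite fh //; exact: inv.
  split=> //; last by move=> i ij; rewrite -fh //; exact: fy.
  exists p, N; split=> //; have [Kp|nKp] := pselect (K p); first by rewrite valK // -(valK f).
  rewrite valN // -fh -?valN //; case: np => -[//|[_ _ + _]] _ _.
  by rewrite xj.
have inv x : L x -> ~ K x -> good (rho x) (f (r x)).
  elim/ltn_ind: {x}(r x) {-2}x (erefl (r x)) => j IH x xj Lx nKx.
  have [|gd _ _] := fP j x xj Lx nKx; last by rewrite xj.
  by move=> z Lz nKz zj; exact: (IH (r z)).
have full x : L x -> ~ K x -> (exists p N, near x p N /\ agree D N (val f p) (f (r x))) /\
    forall i, (i < r x)%N -> f i <> f (r x).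
  move=> Lx nKx; have [|_ h1 h2] := fP (r x) x erefl Lx nKx; last by split.
  by move=> z Lz nKz _; exact: inv.
have val_m x : L x -> Ys m (val f x).
  move=> Lx; have [Kx|nKx] := pselect (K x).
    by rewrite valK //; apply: (ko_mono koY km); exact: phi0_sub.
  by rewrite valN //; have [/stage_sub] := inv x Lx nKx.
(* Every new [z] close to [x] has [x] as a candidate, so its closest candidate is at least as close.
   Following closest candidates decreases [r] and ends at [x] or in [K], where continuity of [phi0]
   takes over. *)
have key x : L x -> exists N0, forall N z, (N0 <= N)%N -> L z -> agree C N x z ->
    exists q, [/\ L q, K q \/ q = x, agree C N x q & agree D N (val f q) (val f z)].
  move=> Lx; have [N0 N0P] : exists N0, forall z, L z -> agree C N0 x z -> ~ K z ->
      z <> x -> cand z x.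
    have [Kx|nKx] := pselect (K x); first by exists 0%N => z _ _ _ _; left.
    have [N1 N1P] := isolated Lx; have [N2 N2P] := far_earlier x.
    exists (maxn N1 N2) => z Lz xz nKz zx; right; split=> //.
      have := N2P z; case: (ltngtP (r z) (r x)) => [_ /(_ isT)[]|//|/r_inj//].
      exact: agree_le (leq_maxr _ _) xz.
    by apply: N1P => //; exact: agree_le (leq_maxl _ _) xz.
  exists N0 => N z N0N; elim/ltn_ind: {z}(r z) {-2}z (erefl (r z)) => j IH z zj Lz xz.
  have [Kz|nKz] := pselect (K z).
    by exists z; split=> //; left.
  have [->|zx] := pselect (z = x).
    by exists x; split=> //; right.
  have [[p [M [[cp zp Mmax] fp]]] _] := full z Lz nKz.
  have NM : (N <= M)%N.
    apply: (Mmax x); last exact: agree_sym.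
    by apply: N0P => //; exact: agree_le N0N xz.
  have xp : agree C N x p by apply: agree_trans xz (agree_le NM zp).
  have fz : agree D N (val f p) (val f z) by rewrite (valN f nKz); exact: agree_le NM fp.
  case: cp => [Kp|[Lp nKp rp _]].
    by exists p; split=> //; [exact: K_sub|left].
  have [q [Lq qx xq fq]] : exists q, [/\ L q, K q \/ q = x, agree C N x q &
      agree D N (val f q) (val f p)] by apply: (IH (r p)) => //; rewrite -zj.
  by exists q; split=> //; exact: agree_trans fq fz.
exists (val f); split.
- by move=> x Kx; rewrite valK.
- have lt_neq x y : L x -> L y -> ~ K x -> ~ K y -> (r x < r y)%N -> val f x <> val f y.
    by move=> Lx Ly nKx nKy xy; rewrite !valN //; have [_] := full y Ly nKy; apply.
  have neq x y : L y -> K x -> ~ K y -> val f x <> val f y.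
    move=> Ly Kx nKy; rewrite valK // valN // => E; have [_] := inv y Ly nKy; apply.
    by rewrite -E; exact: phi0_sub.
  move=> x y Lx Ly; have [Kx|nKx] := pselect (K x); have [Ky|nKy] := pselect (K y).
  + by rewrite !valK //; exact: phi0_inj.
  + by move=> /neq; case.
  + by move=> /esym/neq; case.
  + case: (ltngtP (r x) (r y)) => [xy /(lt_neq _ _ Lx Ly nKx nKy xy)//|yx|/r_inj//].
    by move=> /esym/(lt_neq _ _ Ly Lx nKy nKx yx).
- move=> u x uL ux.
  have Lx : L x by apply: L_closed; apply: (cvs_closure ux); exact: io_all.
  apply: (agree_cvs koY (ko_cpt koY m)) => [i|N]; first exact: val_m.
  apply: contrapT => /not_ev/subseq1[phi ip bad]; have [N0 N0P] := key x Lx.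
  have [i|psi iq xu] := @subseqs (fun i j => agree C (N0 + i)%N x (u (phi j))).
    exact: ev_io (ev_sub ip (cvs_agree koX _ ux)).
  have /choice[q qP] : forall i, exists q, [/\ L q, K q \/ q = x, agree C (N0 + i)%N x q &
      agree D (N0 + i)%N (val f q) (val f (u (phi (psi i))))].
    by move=> i; apply: N0P => //; exact: leq_addr.
  have qx : cvs q x.
    apply: (agree_cvs koX L_cpt) => [i|M]; first by have [] := qP i.
    apply: agree_diag => i; have [_ _ + _] := qP i.
    by apply: agree_le; exact: leq_addl.
  have ag i : (N <= i)%N -> ~ agree D N (val f x) (val f (q i)).
    move=> Ni xq; apply: (bad (psi i)); apply: agree_trans xq _.
    by have [_ _ _] := qP i; apply: agree_le; apply: leq_trans Ni _; exact: leq_addl.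
  have nqx i : (N <= i)%N -> q i <> x.
    by move=> /ag + E; rewrite E; apply; exact: agree_refl.
  have Kq i : K (q (i + N)%N).
    have [_ [//|E] _ _] := qP (i + N)%N; case: (nqx _ _ E).
    exact: leq_addl.
  have qNx : cvs (fun i => q (i + N)%N) x.
    move=> U oU Ux; have [M MP] := qx U oU Ux; exists M => i Mi; apply: MP.
    exact: leq_trans Mi (leq_addr _ _).
  have Kx : K x.
    by apply: K_closed; apply: (cvs_closure qNx); exact: io_all.
  have [i _ agi] := ev_io (cvs_agree koY N (phi0_cont Kq qNx)) 0%N.
  apply: (ag (i + N)%N (leq_addl _ _)).
  by rewrite (valK f Kx) (valK f (Kq i)).
- exact: val_m.
Qed.

End Extension.

(** * Classification of k_omega spaces by their ranks *)

Lemma cvs_shift (X : topologicalType) (u : nat -> X) x N :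
  cvs u x <-> cvs (fun i => u (i + N)%N) x.
Proof.
split=> ux U oU Ux; have [M MP] := ux U oU Ux.
  by exists M => i Mi; apply: MP; exact: leq_trans Mi (leq_addr _ _).
exists (M + N)%N => i MNi; rewrite -(subnK (leq_trans (leq_addl M N) MNi)).
by apply: MP; rewrite leq_subRL ?(leq_trans (leq_addl M N)) // addnC.
Qed.

Lemma sequential_continuous (X Y : topologicalType) (f : X -> Y) : sequential X ->
  (forall u x, cvs u x -> cvs (f \o u) (f x)) -> continuous f.
Proof.
move=> sX fc; apply/continuousP => U oU; rewrite -(setCK (f @^-1` U)) openC.
apply: contrapT => /(sequentialP sX)[u [x [_ uU ux /contrapT Ux]]].
have [i _] := ev_io (fc u x ux U oU Ux) 0%N; exact: uU.
Qed.

Lemma glue_continuous (X Y : topologicalType) (Xs C K : nat -> set X) (f : nat -> X -> Y) F :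
  komega Xs C -> sequential X -> (forall n, Xs n `<=` K n) -> (forall n, seq_compact (K n)) ->
  (forall n, continuous_on (K n) (f n)) -> (forall n x, K n x -> f n x = F x) -> continuous F.
Proof.
move=> ko sX XK cK fc fF; apply: sequential_continuous => // u x ux.
have [n [N NP]] := ko_ev ko ux; apply: (cvs_shift _ _ N).2.
have uK i : K n (u (i + N)%N) by apply: XK; apply: NP; exact: leq_addl.
have ux' := (cvs_shift _ _ N).1 ux.
have Kx : K n x.
  apply: (seq_compact_closed ko (cK n)); apply: (cvs_closure ux').
  by apply: io_all.
rewrite -(fF n) //; apply: (cvs_ev (fc n _ _ uK ux')).
by apply: evT => i; exact: esym (fF n _ (uK i)).
Qed.

Section PartialIso.
Variables (X Y : topologicalType).

Record piso (K : set X) (f : X -> Y) (L : set Y) (g : Y -> X) : Prop := Piso {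
  piso_l : seq_compact K;
  piso_r : seq_compact L;
  piso_lr : forall x, K x -> L (f x) /\ g (f x) = x;
  piso_rl : forall y, L y -> K (g y) /\ f (g y) = y;
  piso_lc : continuous_on K f;
  piso_rc : continuous_on L g
}.

End PartialIso.

Lemma piso_sym (X Y : topologicalType) (K : set X) (f : X -> Y) L g :
  piso K f L g -> piso L g K f.
Proof. by case. Qed.

Section ImagePiso.
Variables (X Y : topologicalType) (Xs C : nat -> set X) (Ys D : nat -> set Y).
Hypothesis koX : komega Xs C.
Hypothesis koY : komega Ys D.

(** Continuity of the inverse: preimages of a convergent sequence have convergent subsequences in
    [K], and injectivity of [f] makes all their limits equal. *)
Lemma piso_image (K : set X) (f : X -> Y) : seq_compact K ->
  (forall x y, K x -> K y -> f x = f y -> x = y) -> continuous_on K f ->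
  forall g, (forall x, K x -> g (f x) = x) -> piso K f (f @` K) g.
Proof.
move=> cK fI fc g gf; split=> //.
- move=> u uK; have /choice[v vP] : forall i, exists x, K x /\ f x = u i.
    by move=> i; have [x Kx fx] := uK i; exists x.
  have [|phi [x [ip Kx vx]]] := cK v; first by move=> i; exact: (vP i).1.
  exists phi, (f x); split=> //.
  have fvx : cvs (f \o (v \o phi)) (f x) by apply: fc => // i; exact: (vP _).1.
  by apply: (cvs_ev fvx); apply: evT => i /=; rewrite (vP _).2.
- by move=> x Kx; split; [exists x|exact: gf].
- by move=> _ [x Kx <-]; rewrite gf.
- move=> u y uK uy.
  have /choice[v vP] : forall i, exists x, K x /\ f x = u i.
    by move=> i; have [x Kx fx] := uK i; exists x.
  have vE : g \o u = v by apply/funext => i /=; rewrite -(vP i).2 gf //; exact: (vP i).1.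
  rewrite vE; have vK i : K (v i) := (vP i).1.
  have [phi0 [x [ip0 Kx vx0]]] := cK v vK.
  have fv psi z : incr psi -> K z -> cvs (v \o psi) z -> f z = y.
    move=> iq Kz vz; have fvz : cvs (f \o (v \o psi)) (f z) by apply: fc => // i; exact: vK.
    apply: (ko_unique koY fvz); apply: (cvs_ev (cvs_sub iq uy)).
    by apply: evT => i /=; rewrite (vP _).2.
  have xy : f x = y by exact: fv ip0 Kx vx0.
  rewrite -xy gf //; apply: (agree_cvs koX cK) => // N; apply: contrapT.
  move=> /not_ev/subseq1[phi ip bad].
  have [|psi [z [iq Kz vz]]] := cK (v \o phi); first by move=> i; exact: vK.
  have zx : z = x by apply: fI => //; rewrite xy; exact: fv (incr_comp ip iq) Kz vz.
  subst z; have [i _] := ev_io (cvs_agree koX N vz) 0%N.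
  exact: bad.
Qed.

(** The forth half; the back half is this lemma with the spaces exchanged by [piso_sym]. *)
Lemma piso_extend (B : set omega1) (K : set X) (f : X -> Y) (L : set Y) (g : Y -> X) x0 n :
  countable [set: X] ->
  (forall n, exists2 w, B w & stage (Xs n) w = set0) -> rank_rich Ys B ->
  piso K f L g -> K x0 -> exists (K' : set X) (f' : X -> Y) (L' : set Y) (g' : Y -> X),
    [/\ piso K' f' L' g', Xs n `<=` K', K `<=` K' /\ L `<=` L',
    forall x, K x -> f' x = f x & forall y, L y -> g' y = g y].
Proof.
move=> X_count bdX [_ rich] [cK cL fg gf fc gc] Kx0.
have [n1 Kn1] := seq_compact_sub koX cK; have [k Lk] := seq_compact_sub koY cL.
pose n' := maxn n n1; have [w Bw wE] := bdX n'; have [m km mP] := rich k w Bw.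
have KX : K `<=` Xs n' by apply: subset_trans Kn1 _; apply: (ko_mono koX); exact: leq_maxr.
have f_inj x y : K x -> K y -> f x = f y -> x = y.
  by move=> Kx Ky E; rewrite -(fg x Kx).2 E (fg y Ky).2.
have fk x : K x -> Ys k (f x) by move=> Kx; apply: Lk; exact: (fg x Kx).1.
have [f' [f'K f'I f'c f'm]] := @extension X Y Xs C Ys D koX koY X_count K f x0 n' k m w
  cK Kx0 KX f_inj fc fk wE km mP.
have /choice[g' g'P] : forall y, exists x, (exists2 x', Xs n' x' & f' x' = y) -> Xs n' x /\ f' x = y.
  move=> y; have [[x Xx fx]|nx] := pselect (exists2 x', Xs n' x' & f' x' = y); first by exists x.
  by exists x0.
have g'f x : Xs n' x -> g' (f' x) = x.
  move=> Xx; have [|Xg E] := g'P (f' x); first by exists x.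
  exact: f'I.
exists (Xs n'), f', (f' @` Xs n'), g'; split=> //.
- exact: piso_image (ko_cpt koX n') f'I f'c _ g'f.
- by apply: (ko_mono koX); exact: leq_maxl.
- split=> // y Ly; exists (g y); first by apply: KX; exact: (gf y Ly).1.
  by rewrite f'K; [exact: (gf y Ly).2|exact: (gf y Ly).1].
- move=> y Ly; have [Kg E] := gf y Ly; rewrite -{1}E -f'K // g'f //.
  exact: KX.
Qed.

End ImagePiso.

Section Classification.
Variables (X Y : topologicalType) (Xs C : nat -> set X) (Ys D : nat -> set Y).
Hypothesis koX : komega Xs C.
Hypothesis koY : komega Ys D.
Hypothesis X_count : countable [set: X].
Hypothesis Y_count : countable [set: Y].
Hypothesis X_seq : sequential X.
Hypothesis Y_seq : sequential Y.
Variable B : set omega1.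
Hypothesis richX : rank_rich Xs B.
Hypothesis richY : rank_rich Ys B.
Variables (x0 : X) (y0 : Y).

(** The base point keeps every domain nonempty, as [extension] requires of [K]. *)
Let state := {s : set X * (X -> Y) * set Y * (Y -> X) |
  piso s.1.1.1 s.1.1.2 s.1.2 s.2 /\ s.1.1.1 x0}.
Let dom (s : state) := (sval s).1.1.1.
Let fwd (s : state) := (sval s).1.1.2.
Let cod (s : state) := (sval s).1.2.
Let bwd (s : state) := (sval s).2.

Let step (n : nat) (s : state) : {s' : state | [/\ Xs n `<=` dom s', Ys n `<=` cod s',
  dom s `<=` dom s' /\ cod s `<=` cod s', forall x, dom s x -> fwd s' x = fwd s x &
  forall y, cod s y -> bwd s' y = bwd s y]}.
Proof.
apply: cid; case: s => -[[[K f] L] g] [/= p Kx0]; rewrite /dom /cod /fwd /bwd /=.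
have [K1 [f1 [L1 [g1 [p1 X1 [KK1 LL1] f1f g1g]]]]] :=
  @piso_extend X Y Xs C Ys D koX koY B K f L g x0 n X_count richX.1 richY p Kx0.
have [L2 [g2 [K2 [f2 [p2 Y2 [LL2 KK2] g2g f2f]]]]] :=
  @piso_extend Y X Ys D Xs C koY koX B L1 g1 K1 f1 (f1 x0) n Y_count richY.1 richX
    (piso_sym p1) (piso_lr p1 (KK1 _ Kx0)).1.
have K2x0 : K2 x0 by exact/KK2/KK1.
exists (exist (fun s => piso s.1.1.1 s.1.1.2 s.1.2 s.2 /\ s.1.1.1 x0) (K2, f2, L2, g2)
  (conj (piso_sym p2) K2x0)) => /=; split=> //.
- exact: subset_trans KK2.
- by split; [exact: subset_trans KK2|exact: subset_trans LL2].
- by move=> x Kx; rewrite f2f ?f1f //; exact: KK1.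
- by move=> y Ly; rewrite g2g ?g1g //; exact: LL1.
Qed.

Lemma komega_homeomorphic : homeomorphic X Y.
Proof.
have start : exists s : state, True.
  have c1 (Z : topologicalType) (z : Z) : seq_compact [set z].
    move=> u uz; exists id, z; split=> //; apply: (cvs_ev (@cvs_cst _ z)).
    by apply: evT => i; exact: uz.
  have p : piso [set x0] (fun=> y0) [set y0] (fun=> x0).
    by split=> //; try exact: c1; try (by move=> _ ->); move=> u z _ _; exact: cvs_cst.
  by exists (exist (fun s => piso s.1.1.1 s.1.1.2 s.1.2 s.2 /\ s.1.1.1 x0)
    ([set x0], fun=> y0, [set y0], fun=> x0) (conj p erefl)).
have [s0 _] := start.
pose S := fix S n := if n is j.+1 then sval (step j (S j)) else s0.
have SP n := svalP (step n (S n)).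
have grow n j : [/\ dom (S n) `<=` dom (S (n + j)%N) /\ cod (S n) `<=` cod (S (n + j)%N),
    forall x, dom (S n) x -> fwd (S (n + j)%N) x = fwd (S n) x &
    forall y, cod (S n) y -> bwd (S (n + j)%N) y = bwd (S n) y].
  elim: j => [|j [[IH1 IH2] IH3 IH4]]; first by rewrite addn0; split=> //; split.
  rewrite addnS; have [_ _ [H1 H2] H3 H4] := SP (n + j)%N; split.
  - by split; [exact: subset_trans H1|exact: subset_trans H2].
  - by move=> x Sx; rewrite -IH3 //; exact: H3 (IH1 _ Sx).
  - by move=> y Sy; rewrite -IH4 //; exact: H4 (IH2 _ Sy).
have XS n : Xs n `<=` dom (S n.+1) by have [] := SP n.
have YS n : Ys n `<=` cod (S n.+1) by have [_ +] := SP n.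
have pS n : piso (dom (S n)) (fwd (S n)) (cod (S n)) (bwd (S n)) := (svalP (S n)).1.
have /choice[a aP] : forall x, exists n, dom (S n) x.
  by move=> x; have [n Xx] := ko_cover koX x; exists n.+1; exact: XS.
have /choice[b bP] : forall y, exists n, cod (S n) y.
  by move=> y; have [n Yy] := ko_cover koY y; exists n.+1; exact: YS.
pose F x := fwd (S (a x)) x; pose H y := bwd (S (b y)) y.
have FE n x : dom (S n) x -> fwd (S n) x = F x.
  move=> Sx; rewrite /F; have [_ + _] := grow n (a x); move=> /(_ x Sx) <-.
  by rewrite addnC; have [_ + _] := grow (a x) n; move=> /(_ x (aP x)).
have HE n y : cod (S n) y -> bwd (S n) y = H y.
  move=> Sy; rewrite /H; have [_ _] := grow n (b y); move=> /(_ y Sy) <-.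
  by rewrite addnC; have [_ _] := grow (b y) n; move=> /(_ y (bP y)).
exists F, H; split.
- by move=> x; have [cx E] := piso_lr (pS (a x)) (aP x); rewrite /F -(HE (a x)).
- by move=> y; have [cy E] := piso_rl (pS (b y)) (bP y); rewrite /H -(FE (b y)).
- exact: (glue_continuous koX X_seq XS (fun n => piso_l (pS n.+1))
    (fun n => @piso_lc _ _ _ _ _ _ (pS n.+1)) (fun n => FE n.+1)).
- exact: (glue_continuous koY Y_seq YS (fun n => piso_r (pS n.+1))
    (fun n => @piso_rc _ _ _ _ _ _ (pS n.+1)) (fun n => HE n.+1)).
Qed.

End Classification.

Lemma clopen_pairs (X : topologicalType) (P : nat -> nat -> set X -> Prop) :
  (forall i j, exists A, [/\ open A, closed A & P i j A]) ->
  exists C : nat -> set X, [/\ forall i, open (C i), forall i, closed (C i) &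
    forall i j, exists c, P i j (C c)].
Proof.
move=> exA; have /choice[f fP] : forall ij : nat * nat, exists A,
    [/\ open A, closed A & P ij.1 ij.2 A] by move=> [i j]; exact: exA.
exists (fun c => if unpickle c is Some ij then f ij else set0); split=> [c|c|i j].
- by case: unpickle => [ij|]; [have [] := fP ij|exact: open0].
- by case: unpickle => [ij|]; [have [] := fP ij|exact: closed0].
- by exists (pickle (i, j)); rewrite pickleK; have [] := fP (i, j).
Qed.

Lemma clopen_family (X : topologicalType) (x0 : X) : countable [set: X] ->
  accessible_space X -> zdim X ->
  exists C : nat -> set X, [/\ forall i, open (C i), forall i, closed (C i) &
    forall x y, x <> y -> exists i, C i x /\ ~ C i y].
Proof.
move=> X_count X_T1 X0; have [e _ eP] := countable_enum X_count (Logic.I : [set: X] x0).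
have [|C [oC cC CP]] := @clopen_pairs X (fun i j A => e i <> e j -> A (e i) /\ ~ A (e j)).
  move=> i j; have [E|eij] := pselect (e i = e j).
    by exists set0; split; [exact: open0|exact: closed0|].
  by have [A [oA cA Ai nAj]] := clopen_sep X_T1 X0 eij; exists A.
exists C; split=> // x y.
by have [i <-] := eP x Logic.I; have [j <-] := eP y Logic.I => eij; have [c /(_ eij)] := CP i j; exists c.
Qed.

(** * The k_omega structure of a group with captured sequences *)

Section GroupKomega.
Variable G : topologicalGroupType.
Hypothesis G_Tych : Tychonoff G.
Hypothesis G_count : countable [set: G].
Hypothesis G_seq : sequential G.
Local Open Scope group_scope.
Implicit Types (x y p : G) (u : nat -> G).

Let G_T1 : accessible_space G := G_Tych.1.
Let G_zdim : zdim G := countable_zdim G_count G_Tych.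

(** Suppose [a] has no convergent subsequence. Each [g] has a clopen neighborhood [W g] that [a]
    eventually avoids, and [b i] in [B] can be chosen near [a i] so as to copy its avoidance of
    [W g] for all [g] of rank at most [i]. Then [b] is divergent as well. *)
Lemma closure_seq_compact (B : set G) :
  seq_ideal (@divergent G) B -> seq_compact (closure B).
Proof.
move=> IB a aB; have [rank rankI] := countable_rank G_count.
suff [phi [x [ip ax]]] : exists phi x, incr phi /\ cvs (a \o phi) x.
  exists phi, x; split=> //; apply: (@closed_closure _ B); apply: (cvs_closure ax).
  by apply: io_all => i; exact: aB.
apply: contrapT => nax.
have da : divergent a by move=> phi x ip ax; apply: nax; exists phi, x.
have /choice[W WP] : forall g, exists W, [/\ open W, closed W, W g & ev (fun m => ~ W (a m))].
  move=> g; have [U [oU Ug aU]] := divergent_avoid G_seq g da.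
  have [W [oW cW Wg WU]] := G_zdim oU Ug; exists W; split=> //.
  by apply: ev_imp aU _ => m nU /WU.
have /choice[b bP] : forall i, exists b, B b /\
    forall g, (rank g <= i)%N -> ~ W g (a i) -> ~ W g b.
  move=> i; have [g|g gi|U [oU Ua UW]] := @finite_bigcap_open _ _ rank
      (fun g => if `[< W g (a i) >] then setT else ~` W g) i (a i) rankI.
  - by case: asboolP => _; [exact: openT|rewrite openC; have [] := WP g].
  - by case: asboolP.
  - have [b Bb Ub] := (closureP _ _).1 (aB i) U oU Ua; exists b; split=> // g gi.
    by have := UW g b gi Ub; case: asboolP.
apply: (IB b) => [i|phi x ip bx]; first exact: (bP i).1.
have [oW _ Wx aW] := WP x; have [N NP] := ev_and (bx _ oW Wx) (ev_sub ip aW).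
have [Wb nWa] := NP (maxn N (rank x)) (leq_maxl _ _).
apply: ((bP (phi (maxn N (rank x)))).2 x) => //.
exact: leq_trans (leq_maxr N _) (incr_ge _ ip).
Qed.

Lemma captured_komega : captured (seq_ideal (@divergent G)) ->
  exists Xs C : nat -> set G, komega Xs C.
Proof.
move=> [B IB exB]; have [C [oC cC sepC]] := clopen_family 1 G_count G_T1 G_zdim.
exists (fun n => closure (B n)), C; split=> //.
- by move=> m n mn; apply: closureS; case: exB => + _ _; exact.
- by move=> n; apply: closure_seq_compact.
- move=> u x ux; have [n evn] := exhausting_ev exB ux; exists n.
  by apply: ev_imp evn _ => i; exact: subset_closure.
Qed.

Lemma group_homogeneous (Xs C : nat -> set G) : komega Xs C -> homogeneous Xs.
Proof.
move=> ko k w n [p wp].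
pose P := [set z | exists x y, [/\ Xs n x, Xs k y & z = x * p^-1 * y]].
have cP : seq_compact P.
  move=> u /choice[x /choice[y uxy]].
  have [|phi [x' [ip Xx xx]]] := ko_cpt ko n x; first by move=> i; have [] := uxy i.
  have [|psi [y' [iq Xy yy]]] := ko_cpt ko k (y \o phi).
    by move=> i; have [] := uxy (phi i).
  exists (phi \o psi), (x' * p^-1 * y'); split; [exact: incr_comp|by exists x', y'|].
  apply: (cvs_ev (cvsM (@cvsMr _ _ _ p^-1 (cvs_sub iq xx)) yy)).
  by apply: evT => i /=; have [] := uxy (phi (psi i)).
have [m Pm] := seq_compact_sub ko cP; exists m => x Xx.
have -> : x = x * p^-1 * p by rewrite mulgVK.
apply: (stage_map (f := fun y => x * p^-1 * y)) wp => [y Xy|A t AX Xt /limit_pointP lA].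
  by apply: Pm; exists x, y.
apply/limit_pointP => U oU Ut; have [s [st As Us]] := lA _ (open_mull _ oU) Ut.
by exists (x * p^-1 * s); split=> //; [move/mulgI|exists s].
Qed.

End GroupKomega.

(** * The rationals and their k-topologies *)

Section Rationals.
Import Order.TTheory GRing.Theory Num.Theory.
Import numFieldNormedType.Exports.
Local Open Scope ring_scope.
Implicit Types (x y : rat^o) (K : set rat^o) (u : nat -> rat^o).

Lemma rat_Tychonoff : Tychonoff rat^o.
Proof.
split; first exact: (hausdorff_accessible (@norm_hausdorff _ rat^o)).
exact: (@uniform_completely_regular Rdefinitions.RbaseSymbolsImpl.R (rat^o : uniformType)).
Qed.

Lemma rat_count : countable [set: rat^o]. Proof. exact: (countableP [set: rat]). Qed.

Lemma rat_zdim : zdim rat^o.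
Proof. exact: countable_zdim rat_count rat_Tychonoff. Qed.

Definition rat_nbhd x (n : nat) : set rat^o := [set y | `|y - x| < n.+1%:R^-1].

Lemma rat_nbhd_open x n : open (rat_nbhd x n).
Proof.
rewrite (_ : rat_nbhd x n = ball x (n.+1%:R^-1 : rat)); first exact: ball_open.
by rewrite predeqE => y; rewrite /rat_nbhd /ball /= distrC.
Qed.

Lemma rat_nbhd_center x n : rat_nbhd x n x.
Proof. by rewrite /rat_nbhd /= subrr normr0 invr_gt0 ltr0Sn. Qed.

Lemma rat_nbhd_base U x : open U -> U x -> exists n, rat_nbhd x n `<=` U.
Proof.
move=> oU Ux; have /nbhs_ballP[e /= e0 eU] : nbhs x U by exact: open_nbhs_nbhs.
pose n := Num.bound e^-1; exists n => y xy; apply: eU; rewrite /ball /= distrC.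
apply: lt_le_trans xy _; rewrite invf_ple ?posrE ?ltr0Sn //.
apply: ltW; apply: lt_trans (archi_boundP _) _; first by rewrite invr_ge0 ltW.
by rewrite ltr_nat.
Qed.

Lemma rat_first_countable : first_countable_space rat^o.
Proof.
move=> x; exists (rat_nbhd x); split=> [n|U]; last exact: rat_nbhd_base.
by split; [exact: rat_nbhd_open|exact: rat_nbhd_center].
Qed.

Lemma rat_crowded x : ~ open [set x].
Proof.
move=> /(rat_nbhd_base (x := x))[//|n xn].
pose y : rat := x + n.+2%:R^-1; have : [set x] y.
  apply: xn; rewrite /rat_nbhd /= /y addrAC subrr add0r ger0_norm ?invr_ge0 ?ler0n //.
  by rewrite ltf_pV2 ?posrE ?ltr0Sn // ltr_nat.
move=> /eqP; rewrite /y -subr_eq0 addrAC subrr add0r invr_eq0.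
by rewrite pnatr_eq0.
Qed.

Lemma rat_nbhd_le x m n : (m <= n)%N -> rat_nbhd x n `<=` rat_nbhd x m.
Proof.
move=> mn y xy; apply: lt_le_trans xy _.
by rewrite lef_pV2 ?posrE ?ltr0Sn // ler_nat.
Qed.

Lemma rat_diag u x : (forall n, rat_nbhd x n (u n)) -> cvs u x.
Proof.
move=> ux U oU Ux; have [N NU] := rat_nbhd_base oU Ux; exists N => n Nn.
by apply: NU; exact: rat_nbhd_le Nn _ (ux n).
Qed.

Lemma rat_closure K x : closure K x -> exists2 u, forall i, K (u i) & cvs u x.
Proof.
move=> /closureP cK; have /choice[u uP] : forall n, exists y, K y /\ rat_nbhd x n y.
  move=> n; have [y Ky xy] := cK _ (@rat_nbhd_open x n) (@rat_nbhd_center x n).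
  by exists y.
by exists u => [i|]; [exact: (uP i).1|apply: rat_diag => n; exact: (uP n).2].
Qed.

Lemma rat_compact K : compact K -> seq_compact K.
Proof.
move=> cK u uK; have [|x [Kx clx]] := cK (u @ \oo)%classic _.
  by exists 0%N => // n _; exact: uK.
have ioN n : io (fun i => rat_nbhd x n (u i)).
  move=> N; have [||y [[i /= Ni <-] xy]] := clx [set u i | i in [set i | (N <= i)%N]] (rat_nbhd x n).
  - by exists N => // i /= Ni; exists i.
  - exact: open_nbhs_nbhs (conj (@rat_nbhd_open x n) (@rat_nbhd_center x n)).
  - by exists i.
have [phi ip phiP] := subseqs ioN.
by exists phi, x; split=> //; exact: rat_diag.
Qed.

Lemma rat_compact_closed K : compact K -> closed K.
Proof. by move=> cK; apply: (compact_closed _ cK); exact: norm_hausdorff. Qed.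

Lemma rat_cvsD u v x y : cvs u x -> cvs v y -> cvs (fun i => u i + v i : rat^o) (x + y : rat^o).
Proof.
move=> ux vy U oU Uxy; have : nbhs (x + y : rat^o) U by exact: open_nbhs_nbhs.
move=> /(@add_continuous rat^o (x, y))[[A B] /= [nA nB] AB].
move: nA nB; rewrite !nbhsE => -[A' [oA A'x] AA'] [B' [oB B'y] BB'].
apply: ev_imp (ev_and (ux _ oA A'x) (vy _ oB B'y)) _ => i [Ai Bi].
by apply: (AB (u i, v i)); split; [exact: AA'|exact: BB'].
Qed.

End Rationals.

Section KRat.
Import Order.TTheory GRing.Theory Num.Theory.
Import numFieldNormedType.Exports.
Local Open Scope ring_scope.
Variable KK : set (set rat^o).
Hypothesis KK_count : countable KK.
Hypothesis KK0 : KK !=set0.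
Hypothesis KK_nonempty : forall K, KK K -> K !=set0.
Hypothesis KK_compact : forall K, KK K -> compact K.
Hypothesis KK_translate : forall K (q : rat^o), KK K -> KK [set q + x | x in K].
Hypothesis KK_sum : forall K L, KK K -> KK L -> KK [set x + y | x in K & y in L].

Let kQ : topologicalType := k_rat KK.
Let kcvs (u : nat -> rat^o) (x : rat^o) := @cvs kQ u x.
Let rcvs (u : nat -> rat^o) (x : rat^o) := @cvs rat^o u x.

Lemma k_rat_open (U : set rat^o) : open U -> open (U : set (k_rat KK)).
Proof. by move=> oU; rewrite k_rat_openE => K _; exists U. Qed.

Lemma k_rat_closed (A : set rat^o) : closed A -> closed (A : set (k_rat KK)).
Proof.
move=> cA; rewrite -(@openC kQ); apply: k_rat_open.
by rewrite openC.
Qed.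

Lemma k_rat_cvs (u : nat -> rat^o) x : @cvs (k_rat KK) u x -> @cvs rat^o u x.
Proof. by move=> ux U oU; exact: ux (k_rat_open oU). Qed.

Lemma k_rat_count : countable [set: k_rat KK].
Proof. exact: rat_count. Qed.

Lemma k_rat_family : exists2 E : nat -> set rat^o, forall i, KK (E i) &
  forall K, KK K -> exists i, E i = K.
Proof. by have [K KKK] := KK0; exact: countable_enum KK_count KKK. Qed.

Lemma k_rat_cover x : exists2 K, KK K & K x.
Proof.
have [K KKK] := KK0; have [y Ky] := KK_nonempty KKK.
exists [set (x - y) + z | z in K]; first exact: KK_translate.
by exists y => //; rewrite addrNK.
Qed.

(** [KK] need not be directed under inclusion, so finite unions provide the increasing
    exhaustion. *)
Definition finite_unions (E : nat -> set rat^o) (n : nat) : set rat^o :=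
  [set x | exists2 i, (i < n)%N & E i x].

Variable E : nat -> set rat^o.
Hypothesis EKK : forall i, KK (E i).
Hypothesis KKE : forall K, KK K -> exists i, E i = K.
Let Ks := finite_unions E.

Let E_closed i : closed (E i). Proof. by apply: rat_compact_closed; exact: KK_compact. Qed.

Lemma finite_unions_mono m n : (m <= n)%N -> Ks m `<=` Ks n.
Proof. by move=> mn x [i im Ei]; exists i => //; exact: leq_trans mn. Qed.

Lemma finite_unionsS n : Ks n.+1 = Ks n `|` E n.
Proof.
rewrite predeqE => x; split=> [[i]|[[i ik Ei]|En]].
- by rewrite ltnS leq_eqVlt => /orP[/eqP->|ik] Ei; [right|left; exists i].
- by exists i => //; exact: ltnW.
- by exists n.
Qed.

Lemma finite_unions_closed n : closed (Ks n : set rat^o).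
Proof.
elim: n => [|n IH]; last by rewrite finite_unionsS; exact: closedU.
by rewrite (_ : Ks 0%N = set0); [exact: closed0|rewrite predeqE => x; split=> // -[]].
Qed.

(** A subsequence outside [U] would return forever to one [E j], on which [U] is the trace of a
    usual open set. *)
Lemma rat_k_cvs n (u : nat -> rat^o) x : (forall i, Ks n (u i)) -> rcvs u x -> kcvs u x.
Proof.
move=> uK ux U; rewrite k_rat_openE => kU Ux; apply: contrapT => /not_ev/subseq1[phi ip nU].
have /io_exists_lt[j jn] : io (fun i => exists2 j, (j < n)%N & E j (u (phi i))).
  by apply: io_all => i; exact: uK.
move=> ioE; have [V oV UV] := kU _ (EKK j).
have Ej : E j x by apply: (@E_closed j); exact: cvs_closure (cvs_sub ip ux) ioE.
have Vx : V x by have : (U `&` E j) x by []; rewrite UV => -[].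
have [i _ [Eu Vu]] := io_ev ioE (cvs_sub ip ux oV Vx) 0%N.
apply: (nU i); have : (V `&` E j) (u (phi i)) by [].
by rewrite -UV => -[].
Qed.

(** Otherwise a subsequence leaves every finite union; its range meets each member of [KK] in a
    finite set, so it is closed in the k-topology and misses [x]. *)
Lemma k_cvs_finite_unions (u : nat -> rat^o) x : kcvs u x -> exists n, ev (fun i => Ks n (u i)).
Proof.
move=> ux; apply: contrapT => nex.
have [n0 Kx] : exists n, Ks n x.
  by have [K /KKE[i <-] Ex] := k_rat_cover x; exists i.+1, i.
have [k|phi ip phiP] := @subseqs (fun k i => ~ Ks (k + n0)%N (u i)).
  by apply: not_ev => evk; apply: nex; exists (k + n0)%N.
pose A : set rat^o := range (u \o phi).
have nAx : ~ A x.
  move=> [k _ kx]; apply: (phiP k); rewrite -/((u \o phi) k) kx.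
  exact: finite_unions_mono (leq_addl _ _) _ Kx.
have oA : @open kQ (~` A).
  rewrite k_rat_openE => K /KKE[i <-]; exists (~` (A `&` E i)).
    apply: (open_finiteC rat_Tychonoff.1).
    apply: (@sub_finite_set _ _ ((u \o phi) @` `I_i.+1)); last exact/finite_image/finite_II.
    move=> _ [[k _ <-] Ei]; exists k => //=; rewrite ltnNge; apply/negP => ik.
    by apply: (phiP k); exists i => //; exact: leq_trans ik (leq_addr _ _).
  rewrite predeqE => y; split=> [[nA Ey]|[nAE Ey]]; split=> //; first by case.
  by move=> Ay; exact: nAE.
have [i _] := ev_io (cvs_sub ip ux oA nAx) 0%N.
by apply; exists i.
Qed.

Lemma k_rat_sequential : sequential (k_rat KK).
Proof.
move=> A ncA; have : ~ @open kQ (~` A) by rewrite openC.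
rewrite k_rat_openE => nkA.
have [K KKK nV] : exists2 K, KK K & forall V : set rat^o, open V -> ~ ~` A `&` K = V `&` K.
  apply: contrapT => nK; apply: nkA => K KKK; apply: contrapT => nV; apply: nK.
  by exists K => // V oV EV; apply: nV; exists V.
have [x [Kx nAx clx]] : exists x, [/\ K x, ~ A x & closure (A `&` K : set rat^o) x].
  apply: contrapT => nx; apply: (nV (~` closure (A `&` K : set rat^o))).
    by rewrite openC; exact: closed_closure.
  rewrite predeqE => y; split=> [[nAy Ky]|[ncy Ky]]; split=> //.
    by move=> cy; apply: nx; exists y.
  by move=> Ay; apply: ncy; exact: subset_closure.
have [u uAK ux] := rat_closure clx; have [i iK] := KKE KKK.
have kux : kcvs u x.
  apply: (@rat_k_cvs i.+1) ux => j; exists i => //; rewrite iK.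
  by have [] := uAK j.
have [[v iov]|[phi ip uI]] := sub_const_or_inj u.
  have xv : x = v := cvs_io_cst rat_Tychonoff.1 rat_zdim ux iov.
  by have [j _ uj] := iov 0%N; case: nAx; rewrite xv -uj; have [] := uAK j.
exists (range (u \o phi)), x; split=> //.
  by move=> _ [j _ <-]; have [] := uAK (phi j).
exact: (@cvs_seq_to kQ _ _ uI (@cvs_sub kQ _ _ _ ip kux)).
Qed.

Lemma finite_unions_compact n : @seq_compact kQ (Ks n).
Proof.
move=> u uK; have /io_exists_lt[j jn ioE] : io (fun i => exists2 j, (j < n)%N & E j (u i)).
  by apply: io_all => i; exact: uK.
have [phi ip phiE] := subseq1 ioE.
have [psi [x [iq Ex ux]]] := rat_compact (KK_compact (EKK j)) phiE.
exists (phi \o psi), x; split; [exact: incr_comp|by exists j|].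
by apply: (@rat_k_cvs n) => [i|]; [exact: uK|exact: ux].
Qed.

Lemma k_rat_komega : exists C, komega (Ks : nat -> set (k_rat KK)) C.
Proof.
have [C [oC cC sC]] := clopen_family (0 : rat^o) rat_count rat_Tychonoff.1 rat_zdim.
exists C; split=> //.
- exact: finite_unions_mono.
- exact: finite_unions_compact.
- exact: k_cvs_finite_unions.
- by move=> i; apply: k_rat_open; exact: oC.
- by move=> i; apply: k_rat_closed; exact: cC.
Qed.

(** Sums and translates in [KK] play the part of products in a group; finitely many pairs of members
    lead to a common bound [m]. *)
Lemma k_rat_homogeneous : homogeneous (Ks : nat -> set (k_rat KK)).
Proof.
have [C ko] := k_rat_komega; move=> k w n [p wp].
have [m mP] : exists m, forall i j, (i < n)%N -> (j < k)%N -> exists2 l, (l < m)%N &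
    forall x y, E i x -> E j y -> E l (x - p + y).
  have sum i j : exists l, forall x y, E i x -> E j y -> E l (x - p + y).
    have [l lE] := KKE (KK_sum (EKK i) (KK_translate (- p) (EKK j))); exists l => x y Ex Ey.
    by rewrite lE -addrA; exists x => //; exists (- p + y) => //; exists y.
  have /choice[l' lP] : forall i, exists f : nat -> nat,
      forall j x y, E i x -> E j y -> E (f j) (x - p + y).
    by move=> i; have [f fP] := choice (sum i); exists f.
  exists (\max_(i < n) \max_(j < k) (l' i j)).+1 => i j ik jk; exists (l' i j); last exact: lP.
  rewrite ltnS; apply: leq_trans (leq_bigmax (Ordinal ik)) => /=.
  exact: (leq_bigmax (Ordinal jk)).
have KP x y : Ks n x -> Ks k y -> Ks m (x - p + y).
  by move=> [i ik Ex] [j jk Ey]; have [l lm lE] := mP i j ik jk; exists l => //; exact: lE.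
exists m => x Xx; have -> : x = x - p + p by rewrite addrNK.
apply: (@stage_map _ kQ kQ (fun y => x - p + y) (Ks k)) wp => [y|A t AK Kt lA]; first exact: KP.
have [u [uI uA _ ut]] := limit_point_seq ko (ko_cpt ko k) AK lA.
apply: (@seq_limit_point kQ (fun i => x - p + u i)).
- by move=> i j /addrI/uI.
- by move=> i; exists (u i).
- apply: (@rat_k_cvs m) => [i|]; first by apply: KP => //; exact: AK.
  apply: (@rat_cvsD (fun=> x - p)); first exact: cvs_cst.
  exact: k_rat_cvs ut.
Qed.

Lemma rat_k_stage (a : Ord) (w : a) K t : KK K ->
  stage (K : set rat^o) w t <-> stage (K : set (k_rat KK)) w t.
Proof.
move=> KKK; split.
  apply: (@stage_map _ rat^o kQ id) => // A s AK Ks' /limit_pointP lA.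
  apply/(@limit_pointP kQ) => U; rewrite k_rat_openE => /(_ _ KKK)[V oV UV] Us.
  have Vs : V s by have : (U `&` K) s by []; rewrite UV => -[].
  have [y [ys Ay Vy]] := lA V oV Vs; exists y; split=> //; first by exists y.
  have : (V `&` K) y by split=> //; exact: AK.
  by rewrite -UV => -[].
apply: (@stage_map _ kQ rat^o id) => // A s AK Ks' /(@limit_pointP kQ) lA.
apply/limit_pointP => U oU Us; have [y [ys Ay Uy]] := lA U (k_rat_open oU) Us.
by exists y; split=> //; exists y.
Qed.

(** By [stageU], a finite union survives to no stage at which all of its members have vanished. *)
Lemma k_rat_ranks : ranks (Ks : nat -> set (k_rat KK)) =
  [set w | exists2 K, KK K & stage (K : set rat^o) w !=set0].
Proof.
rewrite predeqE => w; split=> [[n [t]]|[K /KKE[i <-] [t wt]]]; last first.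
  exists i.+1, t; apply: (@stageS _ kQ (E i)); first by move=> x Ex; exists i.
  exact/rat_k_stage.
elim: n => [/stage_sub[]//|n IH]; rewrite finite_unionsS.
move=> /(@stageU _ kQ)[||/IH//|nt].
- by apply: k_rat_closed; exact: finite_unions_closed.
- by apply: k_rat_closed; exact: E_closed.
- by exists (E n) => //; exists t; exact/rat_k_stage.
Qed.

End KRat.

(** * Sierpinski's characterization of the rationals *)

Lemma clopen_base (X : topologicalType) (x0 : X) : countable [set: X] ->
  zdim X -> first_countable_space X ->
  exists C : nat -> set X, [/\ forall i, open (C i), forall i, closed (C i) &
    forall U x, open U -> U x -> exists N, [set y | agree C N x y] `<=` U].
Proof.
move=> X_count X0 X1; have [e _ eP] := countable_enum X_count (Logic.I : [set: X] x0).
have [N NP] := choice X1.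
have [|C [oC cC CP]] := @clopen_pairs X (fun i n A => A (e i) /\ A `<=` N (e i) n).
  move=> i n; have [/(_ n)[oN Nx] _] := NP (e i).
  by have [A [oA cA Ax AN]] := X0 _ _ oN Nx; exists A.
exists C; split=> // U x oU Ux; have [i xi] := eP x Logic.I; subst x.
have [_ /(_ U oU Ux)[n NU]] := NP (e i); have [c [Ci CN]] := CP i n.
by exists c.+1 => y xy; apply: NU; apply: CN; exact: (xy c (ltnSn _)).1 Ci.
Qed.

(** A tree of clopen sets in which the left child of [U s] keeps the center of
    [U s]; every point is a center, so the points are coded by the eventually
    zero binary sequences. *)
Record center_tree (X : topologicalType) (U : seq bool -> set X) (c : seq bool -> X) : Prop := {
  tree_top : U [::] = setT;
  tree_split : forall s, U s = U (rcons s false) `|` U (rcons s true);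
  tree_disj : forall s x, U (rcons s false) x -> ~ U (rcons s true) x;
  tree_left : forall s, c (rcons s false) = c s;
  tree_center : forall s, U s (c s);
  tree_onto : forall x, exists s, c s = x;
  tree_open : forall s, open (U s);
  tree_base : forall V x, open V -> V x -> exists s, U s x /\ U s `<=` V
}.

Section TreePoints.
Variables (X : topologicalType) (U : seq bool -> set X) (c : seq bool -> X).
Hypothesis X_T1 : accessible_space X.
Hypothesis tr : center_tree U c.

Lemma tree_unique s t x : size s = size t -> U s x -> U t x -> s = t.
Proof.
elim/last_ind: s t => [|s a IH] t; first by case: t.
case/lastP: t => [|t b]; first by rewrite size_rcons.
rewrite !size_rcons => -[st] sx tx.
have up v d : U (rcons v d) x -> U v x.
  by rewrite (tree_split tr v); case: d; [right|left].
have E := IH t st (up _ _ sx) (up _ _ tx); subst t; congr rcons.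
case: a b sx tx => -[] // sx tx; first by case: (tree_disj tr tx).
by case: (tree_disj tr sx).
Qed.

Lemma tree_take s n x : U s x -> U (take n s) x.
Proof.
elim/last_ind: s => [//|s a IH] sx.
have [ns|ns] := leqP n (size s).
  rewrite -cats1 take_cat; case: ltngtP ns => // [ns _|-> _].
    by apply: IH; rewrite (tree_split tr s); case: (a) sx; [right|left].
  by rewrite subnn take0 cats0 (tree_split tr s); case: (a) sx; [right|left].
by rewrite take_oversize // size_rcons.
Qed.

Lemma tree_lefts s n : c (s ++ nseq n false) = c s.
Proof.
elim: n => [|n IH]; first by rewrite cats0.
by rewrite -addn1 nseqD /= catA cats1 (tree_left tr).
Qed.

(** A center persists in all left descendants, so the nodes containing it are the prefixes of its
    code followed by zeros. The criterion mentions codes only, so any two center trees can be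
    matched. *)
Lemma tree_centerP s t : U t (c s) <-> t = take (size t) (s ++ nseq (size t) false).
Proof.
have h n : U (take n (s ++ nseq n false)) (c s).
  apply: tree_take; rewrite -(tree_lefts s n); exact: (tree_center tr).
split=> [tc|->]; last exact: h.
apply: tree_unique tc (h (size t)).
by rewrite size_takel // size_cat size_nseq leq_addl.
Qed.

Lemma tree_sep x y : (forall s, U s x -> U s y) -> x = y.
Proof.
move=> xy; apply: contrapT => nxy.
have [s [sx sU]] := tree_base tr (@T1_open_neq _ X_T1 y) nxy.
exact: sU (xy s sx) erefl.
Qed.

End TreePoints.

Lemma tree_homeomorphic (X Y : topologicalType) U c V d :
  accessible_space X -> accessible_space Y ->
  @center_tree X U c -> @center_tree Y V d -> homeomorphic X Y.
Proof.
move=> X_T1 Y_T1 tX tY.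
have half (X' Y' : topologicalType) U' c' V' d' : @center_tree X' U' c' -> @center_tree Y' V' d' ->
    exists f : X' -> Y', forall t x, U' t x <-> V' t (f x).
  move=> tX' tY'; have /choice[s sP] := tree_onto tX'; exists (d' \o s) => t x.
  by rewrite -{1}(sP x) (tree_centerP tX') (tree_centerP tY').
have [f fP] := half _ _ _ _ _ _ tX tY; have [g gP] := half _ _ _ _ _ _ tY tX.
have cont (X' Y' : topologicalType) U' c' V' d' (h : X' -> Y') : @center_tree X' U' c' ->
    @center_tree Y' V' d' -> (forall t x, U' t x <-> V' t (h x)) -> continuous h.
  move=> tX' tY' hP; apply/continuousP => O oO; rewrite openE => x Ox.
  have [t [tx tO]] := tree_base tY' oO Ox.
  rewrite /interior nbhsE; exists (U' t); first by split; [exact: tree_open tX' t|exact/hP].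
  by move=> y /hP/tO.
exists f, g; split.
- by move=> x; apply: (tree_sep X_T1 tX) => s /gP/fP.
- by move=> y; apply: (tree_sep Y_T1 tY) => s /fP/gP.
- exact: cont tX tY fP.
- exact: cont tY tX gP.
Qed.

Section TreeExists.
Variables (X : topologicalType) (x0 : X).
Hypothesis X_count : countable [set: X].
Hypothesis X_T1 : accessible_space X.
Hypothesis X_zdim : zdim X.
Hypothesis X_first : first_countable_space X.
Hypothesis X_crowded : forall x : X, ~ open [set x].

(** The center of a node is its element of least [r]. The left child is a clopen neighborhood of the
    center on which the first sets [C i], as many as the depth, are constant; the right child is the
    nonempty rest. *)
Lemma center_tree_exists : exists U c, @center_tree X U c.
Proof.
have [C [oC cC baseC]] := clopen_base x0 X_count X_zdim X_first.
have [r rI] := countable_rank X_count.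
have /choice[ctr ctrP] : forall A : set X, exists c, A !=set0 ->
    A c /\ forall x, A x -> (r c <= r x)%N.
  move=> A; have [[x Ax]|nA] := pselect (A !=set0); last by exists x0.
  have exA : exists n, `[< exists2 y, A y & r y = n >] by exists (r x); apply/asboolP; exists x.
  case: (ex_minnP exA) => n /asboolP[y Ay <-] nP; exists y => _; split=> // z Az.
  by apply: nP; apply/asboolP; exists z.
have /choice[lft lftP] : forall An : set X * nat, exists W, open An.1 -> An.1 !=set0 ->
    [/\ open W, closed W, W (ctr An.1), W `<=` An.1 `&` [set y | agree C An.2 (ctr An.1) y] &
       An.1 `\` W !=set0].
  move=> [A n] /=; have [[oA A0]|nA] := pselect (open A /\ A !=set0); last first.
    by exists set0 => oA A0; case: nA.
  have [Ac _] := ctrP A A0; set x := ctr A in Ac *.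
  have oB : open (A `&` [set y | agree C n x y]) by apply: openI => //; exact: clopen_agree_open.
  have Bx : (A `&` [set y | agree C n x y]) x by split=> //; exact: agree_refl.
  have [y [[Ay xy] yx]] : exists y, (A `&` [set y | agree C n x y]) y /\ y <> x.
    apply: contrapT => ny; apply: (@X_crowded x); rewrite (_ : [set x] = A `&` [set y | agree C n x y]) //.
    rewrite predeqE => y; split=> [->//|By]; apply: contrapT => yx.
    by apply: ny; exists y.
  have [|W [oW cW Wx WB]] := X_zdim (openI oB (@T1_open_neq _ X_T1 y)) (x := x).
    by split=> // xyE; apply: yx.
  exists W => _ _; split=> //; first by move=> z /WB[].
  by exists y; split=> // /WB[_]; apply.
pose st (An : set X * nat) (b : bool) := (if b then An.1 `\` lft An else lft An, An.2.+1).
pose S (s : seq bool) := foldl st (setT, 0%N) s.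
pose U s := (S s).1; pose c s := ctr (U s).
have SE s b : S (rcons s b) = st (S s) b by rewrite /S foldl_rcons.
have S2 s : (S s).2 = size s.
  by elim/last_ind: s => // s b IH; rewrite SE size_rcons /= IH.
have Uinv s : [/\ open (U s), closed (U s) & U s !=set0].
  elim/last_ind: s => [|s b [oU cU U0]]; first by split; [exact: openT|exact: closedT|exists x0].
  have [oW cW Wc _ W0] := lftP (S s) oU U0; rewrite /U SE; case: b => /=; last first.
    by split=> //; exists (c s).
  by rewrite setDE; split=> //; [apply: openI => //; rewrite openC|apply: closedI => //; rewrite closedC].
have LP s : [/\ U (rcons s false) (c s), U (rcons s false) `<=` U s &
    U (rcons s false) `<=` [set y | agree C (size s) (c s) y]].
  have [oU cU U0] := Uinv s; have [oW cW Wc WU _] := lftP (S s) oU U0.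
  by rewrite /U SE /=; split=> // y /WU[] //; rewrite S2.
have RE s : U (rcons s true) = U s `\` U (rcons s false) by rewrite /U !SE.
have cU s : U s (c s) by have [_ _ U0] := Uinv s; have [] := ctrP _ U0.
have cmin s x : U s x -> (r (c s) <= r x)%N.
  by have [_ _ U0] := Uinv s; have [_] := ctrP _ U0; exact.
have cL s : c (rcons s false) = c s.
  have [Lc LU _] := LP s; apply: rI; apply/eqP; rewrite eqn_leq cmin //=.
  by apply: cmin; apply: LU; exact: cU.
have cLn s n : c (s ++ nseq n false) = c s.
  elim: n => [|n IH]; first by rewrite cats0.
  by rewrite -addn1 nseqD /= catA cats1 cL.
have Lag s n x : U (s ++ nseq n.+1 false) x -> agree C n (c s) x.
  rewrite -addn1 nseqD /= catA cats1; have [_ _ h] := LP (s ++ nseq n false).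
  move=> /h /=; rewrite cLn; apply: agree_le.
  by rewrite size_cat size_nseq leq_addl.
have sub_lefts s n : U (s ++ nseq n false) `<=` U s.
  elim: n => [|n IH]; first by rewrite cats0.
  rewrite -addn1 nseqD /= catA cats1; apply: subset_trans IH.
  by have [] := LP (s ++ nseq n false).
have neq_agree x y : x <> y -> exists N, ~ agree C N x y.
  move=> xy; have [N NP] := baseC _ _ (@T1_open_neq _ X_T1 y) xy.
  by exists N => /NP.
(* A point that is never a center leaves every left branch, and each turn to the right strictly
   raises the least value of [r] in the node; but that value is at most [r x]. *)
have onto x : exists s, c s = x.
  apply: contrapT => nx.
  have climb m : exists s, U s x /\ (m <= r (c s))%N.
    elim: m => [|m [s [sx ms]]]; first by exists [::].
    have [N nN] : exists N, ~ agree C N (c s) x.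
      by apply: neq_agree => sE; apply: nx; exists s.
    have exk : exists k, `[< ~ U (s ++ nseq k false) x >].
      by exists N.+1; apply/asboolP => /Lag.
    case: (ex_minnP exk) => -[|k] /asboolP nk kP; first by rewrite cats0 in nk.
    have Uk : U (s ++ nseq k false) x.
      by apply: contrapT => nU; have := kP k (asboolT nU); rewrite ltnn.
    move: nk; rewrite -addn1 nseqD /= catA cats1 => nk.
    exists (rcons (s ++ nseq k false) true); split; first by rewrite RE.
    have := cU (rcons (s ++ nseq k false) true); rewrite RE => -[ck nck].
    have ckU : U s (c (rcons (s ++ nseq k false) true)) by exact: sub_lefts ck.
    rewrite (leq_ltn_trans ms) // ltn_neqAle cmin // andbT.
    apply/eqP => /rI sc; apply: nck; rewrite -sc -(cLn s k).
    by have [] := LP (s ++ nseq k false).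
  have [s [sx]] := climb (r x).+1; rewrite ltnNge => /negP; apply; exact: cmin.
exists U, c; split=> //.
- by move=> s; rewrite RE; have [_ LU _] := LP s; rewrite setDUK.
- by move=> s x Lx; rewrite RE => -[].
- by move=> s; have [] := Uinv s.
- move=> V x oV Vx; have [N NV] := baseC V x oV Vx.
  have [s sx] := onto x; subst x; exists (s ++ nseq N.+1 false); split.
    by rewrite -(cLn s N.+1); exact: cU.
  by move=> y /Lag/NV.
Qed.

End TreeExists.

(** * Ordinals *)

Definition initial (a b : Ord) (f : a -> b) :=
  (forall x y, olt x y -> olt (f x) (f y)) /\ (forall x z, olt z (f x) -> exists y, f y = z).

Section Initial.
Variables (a b : Ord).

Lemma mono_olt (f : a -> b) : (forall x y, olt x y -> olt (f x) (f y)) ->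
  forall x y, olt (f x) (f y) -> olt x y.
Proof.
move=> fm x y fxy; apply: contrapT => /olt_nle[E|/fm yx].
  by move: fxy; rewrite E; exact: olt_irr.
exact: olt_irr (olt_trans fxy yx).
Qed.

Lemma mono_inj (f : a -> b) : (forall x y, olt x y -> olt (f x) (f y)) -> injective f.
Proof.
move=> fm x y E; have [/fm|[//|/fm]] := olt_total x y; rewrite E; move/olt_irr; by [].
Qed.

Lemma initial_unique (f g : a -> b) : initial f -> initial g -> f =1 g.
Proof.
move=> [fm fi] [gm gi] x; elim: (olt_wf x) => {}x _ IH.
have [fg|[//|gf]] := olt_total (f x) (g x).
  have [y yE] := gi x _ fg; have yx : olt y x by apply: (mono_olt gm); rewrite yE.
  by have := fm _ _ yx; rewrite IH // yE => /olt_irr.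
have [y yE] := fi x _ gf; have yx : olt y x by apply: (mono_olt fm); rewrite yE.
by have := gm _ _ yx; rewrite -IH // yE => /olt_irr.
Qed.

End Initial.

Lemma initial_comp (a b c : Ord) (f : a -> b) (g : b -> c) :
  initial f -> initial g -> initial (g \o f).
Proof.
move=> [fm fi] [gm gi]; split=> [x y /fm/gm//|x z /= zg].
have [y yE] := gi _ _ zg; subst z; have [x' <-] := fi _ _ (mono_olt gm zg).
by exists x'.
Qed.

Lemma initial_id (a : Ord) : initial (@id a).
Proof. by split=> // x z _; exists z. Qed.

Lemma ord_le_trans (a b c : Ord) : ord_le a b -> ord_le b c -> ord_le a c.
Proof. by move=> [f fi] [g gi]; exists (g \o f); exact: initial_comp. Qed.

Lemma ord_le_anti (a b : Ord) : ord_le a b -> ord_le b a -> ord_eq a b.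
Proof.
move=> [f fi] [g gi]; exists f.
  exists g => x.
    exact: (initial_unique (initial_comp fi gi) (@initial_id a)).
  exact: (initial_unique (initial_comp gi fi) (@initial_id b)).
by move=> x y; split; [exact: fi.1|exact: mono_olt fi.1 _ _].
Qed.

Lemma ord_eq_le (a b : Ord) : ord_eq a b -> ord_le a b /\ ord_le b a.
Proof.
move=> [f [g fK gK] fm]; split; [exists f|exists g]; split.
- by move=> x y /fm.
- by move=> x z _; exists (g z).
- by move=> x y xy; apply/fm; rewrite !gK.
- by move=> x z _; exists (f z).
Qed.

Lemma ord_eq_sym (a b : Ord) : ord_eq a b -> ord_eq b a.
Proof. by move=> /ord_eq_le[ab ba]; exact: ord_le_anti. Qed.

Lemma ord_eq_trans (a b c : Ord) : ord_eq a b -> ord_eq b c -> ord_eq a c.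
Proof.
move=> /ord_eq_le[ab ba] /ord_eq_le[bc cb].
by apply: ord_le_anti; [exact: ord_le_trans bc|exact: ord_le_trans ba].
Qed.

Lemma initial_le (a b c : Ord) (f : a -> c) (g : b -> c) : initial f -> initial g ->
  (forall x, exists y, g y = f x) -> ord_le a b.
Proof.
move=> [fm fi] [gm gi] /choice[h hP]; exists h; split=> [x y xy|x z zh].
  by apply: (mono_olt gm); rewrite !hP; exact: fm.
have := gm _ _ zh; rewrite hP => /fi[y yE]; exists y; apply: (mono_inj gm).
by rewrite hP.
Qed.

Section Compare.
Variables (a b : Ord).

(** [matched x y]: the segments below [x] and [y] are isomorphic. *)
Inductive matched : a -> b -> Prop :=
| matched_intro x y : (forall x', olt x' x -> exists2 y', olt y' y & matched x' y') ->
    (forall y', olt y' y -> exists2 x', olt x' x & matched x' y') -> matched x y.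

Lemma matchedP x y : matched x y ->
  (forall x', olt x' x -> exists2 y', olt y' y & matched x' y') /\
  (forall y', olt y' y -> exists2 x', olt x' x & matched x' y').
Proof. by case. Qed.

Lemma matched_fun x y y' : matched x y -> matched x y' -> y = y'.
Proof.
have half : forall x y y', matched x y -> matched x y' -> ~ olt y y'.
  move=> {y y'} {}x; elim: (olt_wf x) => {}x _ IH y y' /matchedP[xy _] /matchedP[_ xy'] yy'.
  have [x1 x1x m1] := xy' _ yy'; have [y1 y1y m2] := xy _ x1x.
  exact: IH m2 m1 y1y.
move=> m m'; have [yy'|[//|y'y]] := olt_total y y'; first by case: (half _ _ _ m m').
by case: (half _ _ _ m' m).
Qed.

Lemma matched_inj x x' y : matched x y -> matched x' y -> x = x'.
Proof.
have half : forall y x x', matched x y -> matched x' y -> ~ olt x x'.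
  move=> {x x'} {}y; elim: (olt_wf y) => {}y _ IH x x' /matchedP[_ xy] /matchedP[xy' _] xx'.
  have [y1 y1y m1] := xy' _ xx'; have [x1 x1x m2] := xy _ y1y.
  exact: IH m2 m1 x1x.
move=> m m'; have [xx'|[//|x'x]] := olt_total x x'; first by case: (half _ _ _ m m').
by case: (half _ _ _ m' m).
Qed.

(** If some element of [a] is unmatched, let [x] be the least one. Every element of [b] is then
    matched below [x], for otherwise the least exception would match [x]. *)
Lemma ord_compare : ord_le a b \/
  exists f : b -> a, initial f /\ exists y, forall x, olt (f x) y.
Proof.
have [/choice[f fP]|nall] := pselect (forall x, exists y, matched x y).
  left; exists f; split=> [x y xy|x z zf].
    have [y' y'y m] := (matchedP (fP y)).1 _ xy.
    by rewrite (matched_fun (fP x) m).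
  have [x' x'x m] := (matchedP (fP x)).2 _ zf.
  by exists x'; exact: matched_fun (fP x') m.
have [x1 nx1] : exists x, ~ exists y, matched x y.
  by apply: contrapT => nx; apply: nall => x; apply: contrapT => nm; apply: nx; exists x.
have [x nx xmin] := ord_min (P := fun x => ~ exists y, matched x y) nx1.
have /choice[f fP] : forall y, exists x', olt x' x /\ matched x' y.
  move=> y; apply: contrapT => ny.
  have {y ny}[y ny ymin] := ord_min (P := fun y => ~ exists x', olt x' x /\ matched x' y) ny.
  apply: nx; exists y; constructor=> [x' x'x|y' y'y]; last first.
    by have /contrapT[x' [? ?]] := ymin _ y'y; exists x'.
  have /contrapT[y' m] := xmin _ x'x; exists y' => //.
  have [//|[E|yy']] := olt_total y' y; case: ny; first by exists x'; rewrite -E.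
  have [x2 x2x' m2] := (matchedP m).2 _ yy'; exists x2; split=> //.
  exact: olt_trans x'x.
right; exists f; split; last by exists x => y; have [] := fP y.
split=> [y y' yy'|y z zf].
  have [x' x'f m] := (matchedP (fP y').2).2 _ yy'.
  by rewrite (matched_inj (fP y).2 m).
have [y' y'y m] := (matchedP (fP y).2).1 _ zf.
by exists y'; exact: matched_inj (fP y').2 m.
Qed.

End Compare.

Definition below (a : Ord) (x : a) : Ord := @ord_restrict a (fun y => olt y x).

Definition restrict_val (a : Ord) (P : a -> Prop) (x : ord_restrict P) : a := sval x.

Lemma restrict_val_initial (a : Ord) (P : a -> Prop) :
  (forall x y, olt y x -> P x -> P y) -> initial (@restrict_val a P).
Proof.
by move=> dP; split=> // -[x Px] z /= zx; exists (exist P z (dP _ _ zx Px)).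
Qed.

(** Inclusions of initial segments are initial maps, hence unique; so equal order types of sets of
    ranks give equal sets. *)
Lemma restrict_eq (a : Ord) (P Q : a -> Prop) : (forall x y, olt y x -> P x -> P y) ->
  (forall x y, olt y x -> Q x -> Q y) -> ord_eq (ord_restrict P) (ord_restrict Q) ->
  forall x, P x -> Q x.
Proof.
move=> dP dQ /ord_eq_le[[f fi] _] x Px.
have := initial_unique (initial_comp fi (restrict_val_initial dQ)) (restrict_val_initial dP).
move=> /(_ (exist P x Px)) /= <-.
exact: (svalP (f (exist P x Px))).
Qed.

Section PushForward.
Variables (a b : Ord) (g : b -> a).
Hypothesis g_init : initial g.

Let g_inj : injective g := mono_inj g_init.1.

Let push_fun (h : b -> nat) (z : a) : nat :=
  if pselect (exists y, g y = z) is left e then h (sval (cid e)) else 0%N.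

Let push_fun_g h y : push_fun h (g y) = h y.
Proof.
rewrite /push_fun; case: pselect => [e|n]; last by case: n; exists y.
by congr h; apply: g_inj; case: (cid e).
Qed.

Let push_fun0 h z : ~ (exists y, g y = z) -> push_fun h z = 0%N.
Proof. by move=> n; rewrite /push_fun; case: pselect. Qed.

Let push_finite (h : omega_pow b) : finite_set [set z | push_fun (sval h) z <> 0%N].
Proof.
apply: (@sub_finite_set _ _ (g @` [set y | sval h y <> 0%N])).
  move=> z /= nz; have [[y yz]|n] := pselect (exists y, g y = z); last by rewrite push_fun0 in nz.
  by exists y => //=; rewrite -push_fun_g yz.
by apply: finite_image; exact: (svalP h).
Qed.

(** Extends a Cantor normal form by zero coefficients outside the image of [g]. *)
Definition push (h : omega_pow b) : omega_pow a :=
  exist (fun f : a -> nat => finite_set [set x | f x <> 0%N]) _ (push_finite h).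

Lemma push_val h y : sval (push h) (g y) = sval h y.
Proof. exact: push_fun_g. Qed.

Lemma push_out h z : ~ (exists y, g y = z) -> sval (push h) z = 0%N.
Proof. exact: push_fun0. Qed.

Lemma push_onto (v : omega_pow a) : (forall z, sval v z <> 0%N -> exists y, g y = z) ->
  exists h, push h = v.
Proof.
move=> vg; have fin : finite_set [set y | sval v (g y) <> 0%N].
  apply: contrapT => /infinite_seq[u uI un].
  by apply: (@inj_infinite _ (g \o u) [set z | sval v z <> 0%N]) (svalP v) => //; exact: inj_comp.
exists (exist (fun f : b -> nat => finite_set [set x | f x <> 0%N]) (sval v \o g) fin).
apply: eq_sig_hprop => /=; first by move=> f; exact: Prop_irrelevance.
apply/funext => z; have [[y <-]|n] := pselect (exists y, g y = z); first by rewrite push_fun_g.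
by rewrite push_fun0 //; apply/esym/eqP; apply: contrapT => /negP/eqP/vg.
Qed.

Lemma push_initial : initial push.
Proof.
split=> [h h' [x [xlt xgt]]|h v [x [xlt xgt]]].
  exists (g x); split=> [|z xz]; first by rewrite !push_val.
  have [[y yz]|n] := pselect (exists y, g y = z); last by rewrite !push_out.
  by rewrite -yz !push_val xgt //; apply: (mono_olt g_init.1); rewrite yz.
have gx : exists y, g y = x.
  by apply: contrapT => n; move: xlt; rewrite push_out.
apply: push_onto => z vz; have [zx|[->//|xz]] := olt_total z x.
  by have [y yx] := gx; subst x; exact: g_init.2 zx.
by apply: contrapT => n; apply: vz; rewrite xgt // push_out.
Qed.

End PushForward.

Section Delta.
Variable a : Ord.

Let delta_fun (x : a) (z : a) : nat := if pselect (z = x) then 1%N else 0%N.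

Let delta_finite x : finite_set [set z | delta_fun x z <> 0%N].
Proof.
by apply: sub_finite_set (finite_set1 x) => z /=; rewrite /delta_fun; case: pselect.
Qed.

(** The power of omega with exponent [x]. *)
Definition delta (x : a) : omega_pow a :=
  exist (fun f : a -> nat => finite_set [set x | f x <> 0%N]) _ (delta_finite x).

Lemma delta_same x : sval (delta x) x = 1%N.
Proof. by rewrite /= /delta_fun; case: pselect. Qed.

Lemma delta_neq x z : z <> x -> sval (delta x) z = 0%N.
Proof. by move=> zx; rewrite /= /delta_fun; case: pselect. Qed.

Lemma delta_inj : injective delta.
Proof.
move=> x y E; apply: contrapT => xy; have := delta_same x.
by rewrite E delta_neq.
Qed.

Lemma olt_delta x (v : omega_pow a) : olt v (delta x) <->
  forall z, ~ olt z x -> sval v z = 0%N.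
Proof.
split=> [[y [ylt yz]]|v0].
  have yx : y = x by apply: contrapT => yx; move: ylt; rewrite delta_neq.
  subst y; move=> z /olt_nle[->|xz].
    by move: ylt; rewrite delta_same; case: (sval v x).
  by rewrite yz // delta_neq // => E; subst z; exact: olt_irr xz.
exists x; split=> [|z xz]; first by rewrite delta_same v0 //; exact: olt_irr.
rewrite delta_neq; first by rewrite v0 // => zx; exact: olt_irr (olt_trans zx xz).
by move=> E; subst z; exact: olt_irr xz.
Qed.

End Delta.

(** If [b] were a segment of [a] bounded by [y], then [push] after [f] would be an initial self-map
    of [omega_pow a], hence the identity, although it moves [delta y] below itself. *)
Lemma omega_pow_le (a b : Ord) : ord_le (omega_pow a) (omega_pow b) -> ord_le a b.
Proof.
move=> [f fi]; have [//|[g [gi [y gy]]]] := ord_compare a b; exfalso.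
have pi := push_initial gi.
have E := initial_unique (initial_comp fi pi) (@initial_id _) (delta y).
have : olt (push gi (f (delta y))) (delta y).
  apply/olt_delta => z zy; apply: push_out => -[x xz]; apply: zy.
  by rewrite -xz; exact: gy.
by rewrite (E : push gi (f (delta y)) = delta y); exact: olt_irr.
Qed.

Lemma omega_pow_inj (a b : Ord) : ord_eq (omega_pow a) (omega_pow b) -> ord_eq a b.
Proof. by move=> /ord_eq_le[/omega_pow_le ab /omega_pow_le ba]; exact: ord_le_anti. Qed.

Lemma omega_pow_below (a : Ord) (x : a) : exists f : omega_pow (below x) -> omega_pow a,
  initial f /\ forall v, (exists h, f h = v) <-> olt v (delta x).
Proof.
have gi : initial (@restrict_val a (fun y => olt y x)).
  by apply: restrict_val_initial => z y yz; exact: olt_trans.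
exists (push gi); split=> [|v]; first exact: push_initial.
split=> [[h <-]|/olt_delta v0].
  apply/olt_delta => z zx; apply: push_out => -[[y yx] /= E].
  by apply: zx; rewrite -E.
apply: push_onto => z vz; have [zx|zx] := pselect (olt z x); last by case: vz; exact: v0.
by exists (exist _ z zx).
Qed.

(** An additively indecomposable countable ordinal is a power of [omega]: it is
    the segment of [omega_pow omega1] below some [w]; unless [w] is a [delta x],
    subtracting [delta x] for the leading exponent [x] of [w] yields a strictly
    increasing map from the segment of [w] to a smaller segment. *)
Lemma indecomposable_omega_pow (r : Ord) (p0 : r) : countable [set: r] ->
  (forall p, exists e : r -> r, (forall x y, olt x y -> olt (e x) (e y)) /\
     forall q, ~ olt (e q) p) ->
  exists x : omega1, ord_eq (omega_pow (below x)) r.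
Proof.
move=> r_count ind; pose W := omega_pow omega1.
have [[f fi]|[f [fi [w1 fw1]]]] := ord_compare W r.
  exfalso; apply: omega1_uncountable.
  have /countable_injP[n nI] := r_count.
  apply/countable_injP; exists (n \o f \o @delta omega1) => x y _ _ /=.
  by move=> /nI; rewrite !inE => /(_ Logic.I Logic.I)/(mono_inj fi.1)/delta_inj.
have [|w nw wmin] := ord_min (P := fun w => ~ exists q, f q = w) (x := w1).
  by move=> [q qE]; have := fw1 q; rewrite qE; exact: olt_irr.
have fw v : olt v w <-> exists q, f q = v.
  split=> [/wmin/contrapT//|[q <-]].
  have [//|[E|wf]] := olt_total (f q) w; first by case: nw; exists q.
  by case: nw; exact: fi.2 wf.
have [x [xw xtop]] : exists x, sval w x <> 0%N /\ forall z, olt x z -> sval w z = 0%N.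
  have [y yN] : exists y, sval w y <> 0%N.
    apply: contrapT => ny; have /fw[y [+ _]] : exists q, f q = f p0 by exists p0.
    have -> : sval w y = 0%N by apply: contrapT => yN; apply: ny; exists y.
    by rewrite ltn0.
  have [|m mN mmax] := finite_has_max (svalP w); first by exists y.
  by exists m; split=> // z mz; apply: contrapT => /mmax; exact.
exists x; have [f' [f'i f'P]] := omega_pow_below x.
suff wE : w = delta x.
  apply: ord_le_anti.
    apply: (initial_le f'i fi) => h; apply/fw; rewrite wE; apply/f'P.
    by exists h.
  apply: (initial_le fi f'i) => q; apply/f'P; rewrite -wE; apply/fw.
  by exists q.
apply: contrapT => wN.
have [p pE] : exists p, f p = delta x.
  apply/fw; have [//|[E|wd]] := olt_total (delta x) w; first by case: wN; rewrite -E.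
  by case: xw; have /olt_delta := wd; apply; exact: olt_irr.
have [e [em ep]] := ind p.
have top (v : W) : ~ olt w v -> forall z, olt x z -> sval v z = 0%N.
  move=> vw z xz; apply: contrapT => vz; apply: vw.
  have [||m [mN xm] mmax] := @finite_has_max omega1 [set z | sval v z <> 0%N /\ olt x z].
  - by apply: sub_finite_set (svalP v) => y [].
  - by exists z.
  exists m; split=> [|y my]; first by rewrite xtop // lt0n; apply/eqP.
  have xy := olt_trans xm my; rewrite xtop //; apply/esym; apply: contrapT => vy.
  by case: (mmax y).
have ge1 (v : W) : ~ olt v (delta x) -> ~ olt w v -> (0 < sval v x)%N.
  move=> vd vw; rewrite lt0n; apply/eqP => v0; apply: vd; apply/olt_delta => z.
  by move=> /olt_nle[->//|]; exact: top.
pose dec_fun (v : W) z := if pselect (z = x) then (sval v z).-1 else sval v z.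
have dec_finite v : finite_set [set z | dec_fun v z <> 0%N].
  apply: sub_finite_set (svalP v) => z /=; rewrite /dec_fun; case: pselect => //= _.
  by case: (sval v z).
pose dec v : W := exist (fun f : omega1 -> nat => finite_set [set x | f x <> 0%N]) _ (dec_finite v).
have decx v : sval (dec v) x = (sval v x).-1.
  by rewrite (_ : sval (dec v) x = dec_fun v x) // /dec_fun; case: pselect.
have decN v z : z <> x -> sval (dec v) z = sval v z.
  by rewrite (_ : sval (dec v) z = dec_fun v z) // /dec_fun; case: pselect.
have dec_mono (v v' : W) : (0 < sval v x)%N -> (0 < sval v' x)%N -> olt v v' -> olt (dec v) (dec v').
  move=> v1 v'1 [y [ylt ygt]]; exists y; split=> [|z yz].
    have [yx|yx] := pselect (y = x); last by rewrite !decN.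
    by subst y; rewrite !decx -ltnS !prednK.
  have [zx|zx] := pselect (z = x); last by rewrite !decN // ygt.
  by subst z; rewrite !decx ygt.
have ww : ~ olt w w by exact: olt_irr.
have w1' : (0 < sval w x)%N by rewrite lt0n; apply/eqP.
have /fw[q0 q0E] : olt (dec w) w.
  exists x; split; first by rewrite decx prednK.
  by move=> z xz; rewrite decN // => E; subst z; exact: olt_irr xz.
have fe q : (0 < sval (f (e q)) x)%N.
  apply: ge1; first by rewrite -pE => /(mono_olt fi.1); exact: ep.
  have /fw fqw : exists q', f q' = f (e q) by exists (e q).
  by move=> wf; exact: olt_irr (olt_trans fqw wf).
have few q : olt (dec (f (e q))) (dec w).
  by apply: dec_mono => //; apply/fw; exists (e q).
have /choice[h hP] : forall q, exists q', f q' = dec (f (e q)).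
  by move=> q; apply/fw; apply: olt_trans (few q) _; rewrite -q0E; apply/fw; exists q0.
have h_mono q q' : olt q q' -> olt (h q) (h q').
  by move=> /em/fi.1 qq'; apply: (mono_olt fi.1); rewrite !hP; exact: dec_mono.
have h_ge q : ~ olt (h q) q.
  elim: (olt_wf q) => {}q _ IH hq; exact: IH (h_mono _ _ hq).
by apply: (h_ge q0); apply: (mono_olt fi.1); rewrite hP q0E.
Qed.

(** * Topological invariants *)

Section Transport.
Variables (X Y : topologicalType) (f : X -> Y) (g : Y -> X).
Hypothesis fK : cancel f g.
Hypothesis gK : cancel g f.
Hypothesis fc : continuous f.
Hypothesis gc : continuous g.

Let f_open U : open U -> open (f @^-1` U).
Proof. by move=> oU; apply: open_comp => // x _; exact: fc. Qed.

Let g_open U : open U -> open (g @^-1` U).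
Proof. by move=> oU; apply: open_comp => // x _; exact: gc. Qed.

Lemma continuous_cvs u x : cvs u x -> cvs (f \o u) (f x).
Proof.
by move=> ux U oU Uf; apply: (ux (f @^-1` U) _ Uf); exact: f_open.
Qed.

Lemma seq_compact_image K : seq_compact K -> seq_compact (f @` K).
Proof.
move=> cK u uK; have [|phi [x [ip Kx ux]]] := cK (g \o u).
  by move=> i /=; have [y Ky <-] := uK i; rewrite fK.
exists phi, (f x); split=> //; have := continuous_cvs ux.
by move=> /cvs_ev; apply; apply: evT => i /=; rewrite gK.
Qed.

Lemma limit_point_image A t : limit_point A t -> limit_point (f @` A) (f t).
Proof.
move=> /limit_pointP lA; apply/limit_pointP => U oU Ut.
have [s [st As Us]] := lA (f @^-1` U) (f_open oU) Ut.
by exists (f s); split=> //; move/(can_inj fK).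
Qed.

Lemma open_point_image x : open [set x] -> open [set f x].
Proof.
move=> ox; rewrite (_ : [set f x] = g @^-1` [set x]); first exact: g_open.
by rewrite predeqE => y; split=> [->|/= <-]; rewrite /= ?fK ?gK.
Qed.

Lemma first_countable_image : first_countable_space X -> first_countable_space Y.
Proof.
move=> X1 y; have [N [NP NU]] := X1 (g y); exists (fun n => g @^-1` N n); split=> [n|U oU Uy].
  by have [oN Ny] := NP n; split=> //; exact: g_open.
have [||n nU] := NU (f @^-1` U); first exact: f_open.
  by rewrite /= gK.
by exists n => z /nU /=; rewrite gK.
Qed.

End Transport.

Definition discrete_points (X : topologicalType) := forall x : X, open [set x].
Definition crowded_space (X : topologicalType) := forall x : X, ~ open [set x].

(** A form of [ranks] free of the exhaustion, hence preserved by homeomorphisms. *)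
Definition cb_ranks (X : topologicalType) : set omega1 :=
  [set w | exists2 K : set X, seq_compact K & stage K w !=set0].

Lemma homeomorphic_sym (X Y : topologicalType) : homeomorphic X Y -> homeomorphic Y X.
Proof. by move=> [f [g [fK gK fc gc]]]; exists g, f. Qed.

Lemma homeomorphic_discrete (X Y : topologicalType) : homeomorphic X Y ->
  discrete_points X -> discrete_points Y.
Proof.
by move=> [f [g [fK gK fc gc]]] dX y; rewrite -(gK y); exact: open_point_image fK gK gc _ (dX _).
Qed.

Lemma homeomorphic_crowded (X Y : topologicalType) : homeomorphic X Y ->
  crowded_space X -> crowded_space Y.
Proof.
by move=> [f [g [fK gK fc gc]]] dX y /(open_point_image gK fK fc) /dX.
Qed.

Lemma homeomorphic_first_countable (X Y : topologicalType) : homeomorphic X Y ->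
  first_countable_space X -> first_countable_space Y.
Proof. by move=> [f [g [fK gK fc gc]]]; exact: first_countable_image gK fc gc. Qed.

Lemma homeomorphic_cb_ranks (X Y : topologicalType) : homeomorphic X Y ->
  cb_ranks X `<=` cb_ranks Y.
Proof.
move=> [f [g [fK gK fc gc]]] w [K cK [t wt]]; exists (f @` K).
  exact: (@seq_compact_image _ _ _ _ fK gK fc K cK).
exists (f t); apply: stage_map wt => [s Ks|A s _ _ lA]; first by exists s.
exact: (@limit_point_image _ _ _ _ fK fc A s lA).
Qed.

Section KomegaInvariants.
Variables (X : topologicalType) (Xs C : nat -> set X).
Hypothesis ko : komega Xs C.

Lemma komega_cb_ranks : ranks Xs = cb_ranks X.
Proof.
rewrite predeqE => w; split=> [[n nt]|[K cK [t wt]]]; first by exists (Xs n) => //; exact: ko_cpt ko n.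
have [n Kn] := seq_compact_sub ko cK; exists n, t; exact: stageS Kn _ wt.
Qed.

Lemma ranks_lt_sequence (v w : omega1) : olt v w -> ranks Xs w ->
  exists (u : nat -> X) t, injective u /\ cvs u t.
Proof.
move=> vw [n [t wt]].
have [u [uI _ _ ut]] := limit_point_seq ko (ko_cpt ko n) (@stage_sub _ _ _ v) (stage_lim vw wt).
by exists u, t.
Qed.

(** First countability would put a neighborhood [U] of [x0] inside one [Xs n]. Without isolated
    points [U] survives all derivatives of [Xs n], contrary to [empty_stage]. *)
Lemma komega_not_first_countable (x0 : X) : countable [set: X] -> crowded_space X ->
  ~ first_countable_space X.
Proof.
move=> X_count X_cr /(_ x0)[N [NP NU]].
have [n [U [oU Ux UX]]] : exists n U, [/\ open U, U x0 & U `<=` Xs n].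
  apply: contrapT => nU.
  have /choice[u uP] : forall n, exists y, (forall i, (i < n)%N -> N i y) /\ ~ Xs n y.
    move=> n; have [||V [oV Vx VN]] := @bigcap_lt_open _ N n x0.
    - by move=> i; have [] := NP i.
    - by move=> i _; have [] := NP i.
    apply: contrapT => ny; apply: nU; exists n, V; split=> // y Vy; apply: contrapT => nX.
    by apply: ny; exists y; split=> // i ik; exact: VN.
  have ux : cvs u x0.
    move=> V oV Vx; have [j jV] := NU V oV Vx; exists j.+1 => i ji; apply: jV.
    exact: (uP i).1.
  have [n [M MP]] := ko_ev ko ux; apply: (uP (maxn M n)).2.
  apply: (ko_mono ko) (MP _ (leq_maxl M n)); exact: leq_maxr.
have stU (w : omega1) : U `<=` stage (Xs n) w.
  elim: (olt_wf w) => {}w _ IH t Ut; apply/stageP; split=> [|y yw]; first exact: UX.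
  apply/limit_pointP => V oV Vt; apply: contrapT => ns; apply: (X_cr t).
  rewrite (_ : [set t] = U `&` V); first exact: openI.
  rewrite predeqE => s; split=> [->//|[Us Vs]]; apply: contrapT => st; apply: ns.
  by exists s; split=> //; exact: IH.
have [w wE] := empty_stage ko X_count n.
by have := stU w x0 Ux; rewrite wE.
Qed.

End KomegaInvariants.

(** * The ranks of the spaces [k_rat] *)

Lemma stage_initial (X : topologicalType) (K : set X) (a b : Ord) (f : a -> b) :
  initial f -> forall x t, stage K x t <-> stage K (f x) t.
Proof.
move=> [fm fi] x; elim: (olt_wf x) => {}x _ IH t; split=> /stageP[Kt H]; apply/stageP; split=> //.
  move=> z zx; have [y yz] := fi _ _ zx; subst z.
  have yx : olt y x by exact: (mono_olt fm).
  by apply: limit_pointS (H y yx) => s /(IH y yx).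
by move=> y yx; apply: limit_pointS (H (f y) (fm _ _ yx)) => s /(IH y yx).
Qed.

Lemma CB_derivativeP (X : topologicalType) (K : set X) (a : Ord) t :
  CB_derivative K a t <-> K t /\ forall x : a, stage K x t /\ limit_point (stage K x) t.
Proof.
split=> -[Kt H]; (split; first exact: Kt); move=> x; have [h1 h2] := H x; split;
  first [exact/stageE|apply: limit_pointS h2 => s hs; exact/stageE].
Qed.

Lemma CB_rank_stages (X : topologicalType) (K : set X) (w0 : omega1) : stage K w0 = set0 ->
  is_CB_rank K (ord_restrict (fun w : omega1 => stage K w !=set0)).
Proof.
move=> w0E; set P := fun w : omega1 => stage K w !=set0.
have dP (x y : omega1) : olt y x -> P x -> P y.
  by move=> yx [t xt]; exists t; exact: stage_lt xt.
have Pi := restrict_val_initial dP; split.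
  rewrite -subset0 => t /CB_derivativeP[Kt H].
  have nP0 : ~ P w0 by move=> [s]; rewrite w0E.
  have [w nP wP] := ord_min (P := fun w => ~ P w) nP0; apply: nP; exists t.
  apply/stageP; split=> // y /wP/contrapT Py.
  have [_] := H (exist _ y Py); apply: limit_pointS => s.
  by move/(stage_initial K Pi).
move=> b bE; have [//|[f [fi [y fy]]]] := ord_compare (ord_restrict P) b; exfalso.
have [t yt] := svalP y.
have yt' : stage K y t by exact/(stage_initial K Pi).
suff : CB_derivative K b t by rewrite bE.
apply/CB_derivativeP; split=> [|x]; first exact: stage_sub yt'.
have h := stage_initial K fi x; split; first by apply/h; exact: stage_lt (fy x) _ yt'.
by apply: limit_pointS (stage_lim (fy x) yt') => s /h.
Qed.

Section AdmissibleRanks.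
Variables (KK : set (set rat^o)) (b : Ord).
Hypothesis adm : admissible_family KK b.
Variable b0 : b.

Lemma admissible_nonempty : KK !=set0.
Proof.
apply/set0P/eqP => KK0; have [_ least] := adm_rank adm.
have [|f _] := least (ord_restrict (fun _ : b => False)).
  by move=> c [K]; rewrite KK0.
by have [] := f b0.
Qed.

Lemma k_rat_structure : exists Ks C : nat -> set (k_rat KK),
  [/\ komega Ks C, homogeneous Ks, sequential (k_rat KK) &
   cb_ranks (k_rat KK) = [set w | exists2 K, KK K & stage (K : set rat^o) w !=set0]].
Proof.
have [cKK nKK kKK tKK _ sKK _] := adm; have KK0 := admissible_nonempty.
have [E EKK KKE] := k_rat_family cKK KK0.
have [C ko] := k_rat_komega KK0 nKK kKK tKK EKK KKE.
exists (finite_unions E), C; split=> //.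
- exact: (k_rat_homogeneous KK0 nKK kKK tKK sKK EKK KKE).
- exact: (@k_rat_sequential _ kKK _ EKK KKE).
- by rewrite -(komega_cb_ranks ko); exact: (k_rat_ranks kKK EKK KKE).
Qed.

(** The rank of each [K] is the type of an initial segment of [omega1], and [cb_ranks] is the union
    of these segments, hence represents their supremum. *)
Lemma admissible_cb_ranks : ord_eq b (ord_restrict (cb_ranks (k_rat KK))).
Proof.
have [Ks [C [ko _ _ BE]]] := k_rat_structure.
pose B := cb_ranks (k_rat KK); pose R K := fun w : omega1 => stage (K : set rat^o) w !=set0.
have dR K (x y : omega1) : olt y x -> R K x -> R K y.
  by move=> yx [t xt]; exists t; exact: stage_lt xt.
have RB K : KK K -> forall w, R K w -> B w by move=> KKK w Rw; rewrite /B BE; exists K.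
have dB (x y : omega1) : olt y x -> B x -> B y.
  rewrite /B BE => yx [K KKK Rx]; exists K => //; exact: dR yx Rx.
have rankR K : KK K -> is_CB_rank K (ord_restrict (R K)).
  move=> KKK; have [w wB] : exists w : omega1, ~ B w.
    apply: contrapT => nw; apply: omega1_uncountable.
    have := ranks_countable ko (@k_rat_count KK); rewrite (komega_cb_ranks ko).
    apply: sub_countable; apply: subset_card_le => w _.
    by apply: contrapT => nB; apply: nw; exists w.
  apply: (@CB_rank_stages _ _ w); apply: contrapT => /eqP/set0P Rw.
  exact: wB (RB K KKK w Rw).
have [ub least] := adm_rank adm; apply: ord_le_anti.
  apply: least => c [K KKK cK]; have cR : ord_le c (ord_restrict (R K)) := cK.2 _ (rankR K KKK).1.
  apply: ord_le_trans cR _.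
  apply: (initial_le (restrict_val_initial (@dR K)) (restrict_val_initial dB)) => -[w Rw].
  by exists (exist _ w (RB K KKK w Rw)).
have [//|[f [fi [y fy]]]] := ord_compare (ord_restrict B) b; exfalso.
have [K KKK Ky] : exists2 K, KK K & R K (sval y) by case: (y) => w /=; rewrite /B BE.
have [g gi] : ord_le (ord_restrict (R K)) b by apply: ub; exists K => //; exact: rankR.
have := initial_unique (initial_comp (initial_comp gi fi) (restrict_val_initial dB))
  (restrict_val_initial (@dR K)) (exist _ (sval y) Ky).
rewrite /= /restrict_val /= => E; have : olt (sval (f (g (exist _ (sval y) Ky)))) (sval y) by exact: fy.
by rewrite E => /olt_irr.
Qed.

End AdmissibleRanks.

Lemma card_discrete_homeomorphic (X Y : topologicalType) :
  countable [set: X] -> infinite_set [set: X] -> countable [set: Y] -> infinite_set [set: Y] ->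
  discrete_points X -> discrete_points Y -> homeomorphic X Y.
Proof.
move=> cX iX cY iY dX dY.
have dc (Z W : topologicalType) (h : Z -> W) : discrete_points Z -> continuous h.
  move=> dZ; apply/continuousP => U _; rewrite (_ : h @^-1` U = \bigcup_(z in h @^-1` U) [set z]).
    by apply: bigcup_open => z _; exact: dZ.
  by rewrite predeqE => z; split=> [Uz|[z' Uz' ->//]]; exists z.
have [y _] := infinite_setN0 iY.
have enum (Z : topologicalType) : countable [set: Z] -> infinite_set [set: Z] ->
    ([set: Z] #= [set: nat])%card.
  by move=> cZ iZ; rewrite card_eq_le; apply/andP; split=> //; exact/infiniteP.
have := enum Y cY iY; rewrite card_eq_sym => /(card_eq_trans (enum X cX iX)).
move=> /card_bijP[f [g fK gK]].
pose f' x := val (f (exist _ x (mem_setT x))); pose g' z := val (g (exist _ z (mem_setT z))).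
exists f', g'; split; try exact: dc.
- by move=> x; rewrite /f' /g' /=; set u := exist _ _ _; have -> : u = f (exist _ x (mem_setT x));
    [apply: val_inj|rewrite fK].
- by move=> z; rewrite /f' /g' /=; set u := exist _ _ _; have -> : u = g (exist _ z (mem_setT z));
    [apply: val_inj|rewrite gK].
Qed.

Lemma below_le (a : Ord) (x : a) : ord_le (below x) a.
Proof.
exists (@restrict_val a _); apply: restrict_val_initial => z y yz; exact: olt_trans.
Qed.

Lemma restrict_countable (a : Ord) (P : set a) : countable P -> countable [set: ord_restrict P].
Proof.
move=> /countable_injP[f fI]; apply/countable_injP; exists (fun y => f (sval y)).
move=> [y yP] [z zP] _ _ /= E; have yz : y = z by apply: fI => //; rewrite inE.
by subst z; congr exist; exact: Prop_irrelevance.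
Qed.

Lemma below_countable (x : omega1) : countable [set: below x].
Proof. exact/restrict_countable/omega1_segment. Qed.

Lemma uncountable_omega1 (a : Ord) : ord_le a omega1 -> ~ countable [set: a] -> ord_eq a omega1.
Proof.
move=> [f fi] na; apply: ord_le_anti; first by exists f.
have [onto|nonto] := pselect (forall y, exists x, f x = y).
  exact: initial_le (@initial_id omega1) fi onto.
have [y ny] : exists y, ~ exists x, f x = y.
  by apply: contrapT => ny; apply: nonto => y; apply: contrapT => nx; apply: ny; exists y.
case: na; have /countable_injP[n nI] := @omega1_segment y.
have fy x : olt (f x) y.
  have [//|[E|lt]] := olt_total (f x) y; first by case: ny; exists x.
  by case: ny; exact: fi.2 lt.
apply/countable_injP; exists (n \o f) => x x' _ _ /= E.
by apply: (mono_inj fi.1); apply: nI => //; rewrite inE; exact: fy.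
Qed.

Definition omega_pow_zero (a : Ord) : omega_pow a.
Proof.
exists (fun=> 0%N); rewrite (_ : mkset _ = set0); first exact: finite_set0.
by rewrite predeqE => x; split.
Defined.

Lemma delta_gt0 (a : Ord) (x : a) : olt (omega_pow_zero a) (delta x).
Proof. by apply/olt_delta. Qed.

Section AdmissiblePower.
Variables (KK : set (set rat^o)) (a : Ord).
Hypothesis adm : admissible_family KK (omega_pow a).

Let b0 := omega_pow_zero a.

Lemma k_rat_sequence (x : a) : exists (u : nat -> k_rat KK) t, injective u /\ cvs u t.
Proof.
have [Ks [C [ko _ _ _]]] := k_rat_structure adm b0.
have [f _ fm] := admissible_cb_ranks adm b0.
apply: (ranks_lt_sequence ko (v := sval (f b0)) (w := sval (f (delta x)))).
  by have /fm := delta_gt0 x.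
by rewrite (komega_cb_ranks ko); exact: (svalP (f (delta x))).
Qed.

Lemma k_rat_not_discrete (x : a) : ~ discrete_points (k_rat KK).
Proof.
move=> d; have [u [t [uI ut]]] := k_rat_sequence x.
have [i _ [/= E nE]] := ev_io (ev_and (ut _ (d t) erefl) (inj_ev_neq t uI)) 0%N.
exact: nE E.
Qed.

Lemma k_rat_discrete : (a -> False) -> discrete_points (k_rat KK).
Proof.
move=> a0 x; apply: contrapT => nx.
have [Ks [C [ko hom sQ _]]] := k_rat_structure adm b0.
have [|u [t [uI _ ut _]]] := @sequentialP (k_rat KK) (~` [set x]) sQ.
  by rewrite closedC.
have [v [w [Bv Bw vw]]] := ranks_two ko uI ut.
rewrite (komega_cb_ranks ko) in Bv Bw.
have [f [g fK gK] fm] := admissible_cb_ranks adm b0.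
have : olt (g (exist _ v Bv)) (g (exist _ w Bw)) by apply/fm; rewrite !gK.
by move=> [y _]; case: (a0 y).
Qed.

End AdmissiblePower.

Lemma Q_pow_countable KK (a : Ord) : countable [set: a] -> Q_pow KK a = k_rat (KK (omega_pow a)).
Proof. by rewrite /Q_pow => ->. Qed.

Lemma Q_pow_uncountable KK (a : Ord) : ~ countable [set: a] -> Q_pow KK a = rat^o.
Proof. by rewrite /Q_pow => /negP/negPf ->. Qed.

Lemma first_countable_rat (X : topologicalType) (x0 : X) : countable [set: X] -> Tychonoff X ->
  first_countable_space X -> crowded_space X -> homeomorphic X rat^o.
Proof.
move=> cX TX X1 crX.
have [U [c tX]] := center_tree_exists x0 cX TX.1 (countable_zdim cX TX) X1 crX.
have [V [d tQ]] := center_tree_exists (0%R : rat^o) rat_count rat_Tychonoff.1 rat_zdim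
  rat_first_countable rat_crowded.
exact: tree_homeomorphic TX.1 rat_Tychonoff.1 tX tQ.
Qed.

Section KomegaCase.
Variables (X : topologicalType) (Xs C : nat -> set X) (KK : Ord -> set (set rat^o)).
Hypothesis KK_adm : forall a : Ord, countable [set: a] ->
  admissible_family (KK (omega_pow a)) (omega_pow a).
Hypothesis ko : komega Xs C.
Hypothesis X_count : countable [set: X].
Hypothesis X_seq : sequential X.
Hypothesis X_hom : homogeneous Xs.
Variables (u : nat -> X) (t : X).
Hypothesis u_inj : injective u.
Hypothesis u_t : cvs u t.

(** Closure of the ranks under [oadd] is the additive indecomposability that
    [indecomposable_omega_pow] asks for. *)
Lemma komega_omega_pow : exists x : omega1,
  ord_eq (omega_pow (below x)) (ord_restrict (cb_ranks X)).
Proof.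
rewrite -(komega_cb_ranks ko); have [v [w [Bv Bw vw]]] := ranks_two ko u_inj u_t.
apply: (@indecomposable_omega_pow (ord_restrict (ranks Xs)) (exist _ v Bv)) => [|[g Bg]].
  exact: restrict_countable (ranks_countable ko X_count).
exists (fun q => exist _ (oadd g (sval q)) (ranks_oadd X_hom Bg (svalP q))).
by split=> [x y xy|q]; [exact: oadd_lt|exact: oadd_ge].
Qed.

Lemma komega_k_rat (x : omega1) : ord_eq (omega_pow (below x)) (ord_restrict (cb_ranks X)) ->
  homeomorphic X (k_rat (KK (omega_pow (below x)))).
Proof.
move=> xE; have adm := KK_adm (below_countable x); have b0 := omega_pow_zero (below x).
have [Ks [D [koQ homQ seqQ _]]] := k_rat_structure adm b0.
have down (Y : topologicalType) (Ys E : nat -> set Y) : komega Ys E ->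
    forall v w : omega1, olt w v -> cb_ranks Y v -> cb_ranks Y w.
  by move=> koY v w wv; rewrite -(komega_cb_ranks koY); exact: ranks_lt.
have E := ord_eq_trans (ord_eq_sym xE) (admissible_cb_ranks adm b0).
have BE : cb_ranks X = cb_ranks (k_rat (KK (omega_pow (below x)))).
  rewrite predeqE => w; split; apply: restrict_eq => //; try exact: down ko; try exact: down koQ.
  exact: ord_eq_sym.
have [v [w [Bv Bw vw]]] := ranks_two ko u_inj u_t.
have [u' [t' [u'I u't']]] : exists (u : nat -> k_rat (KK (omega_pow (below x)))) t,
    injective u /\ cvs u t.
  apply: (ranks_lt_sequence koQ vw).
  by rewrite (komega_cb_ranks koQ) -BE -(komega_cb_ranks ko).
apply: (komega_homeomorphic ko koQ X_count (@k_rat_count _) X_seq seqQ (B := cb_ranks X) _ _ t t').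
  by rewrite -(komega_cb_ranks ko); exact: (ranks_rich ko X_count X_hom u_inj u_t).
rewrite BE -(komega_cb_ranks koQ).
exact: (ranks_rich koQ (@k_rat_count _) homQ u'I u't').
Qed.

End KomegaCase.

Theorem theorem21
  (KK : Ord -> set (set rat^o))
  (KK_eq : forall b b' : Ord, ord_eq b b' -> KK b = KK b')
  (KK_adm : forall a : Ord, countable [set: a] ->
    admissible_family (KK (omega_pow a)) (omega_pow a)) :
  IIA ->
  forall G : topologicalGroupType,
    Tychonoff G -> infinite_set [set: G] -> countable [set: G] ->
    sequential G ->
  exists a : Ord,
    [/\ ord_le a omega1, homeomorphic G (Q_pow KK a)
      & forall a' : Ord, ord_le a' omega1 -> homeomorphic G (Q_pow KK a') ->
          ord_eq a' a].

Proof.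
move=> iia G G_Tych G_inf G_count G_seq.
have cases (a' : Ord) : ord_le a' omega1 -> homeomorphic G (Q_pow KK a') ->
    (countable [set: a'] /\ homeomorphic G (k_rat (KK (omega_pow a')))) \/
    (ord_eq a' omega1 /\ homeomorphic G rat^o).
  move=> a'1; have [ca|na] := pselect (countable [set: a']).
    by rewrite Q_pow_countable //; left.
  by rewrite Q_pow_uncountable //; right; split=> //; exact: uncountable_omega1.
(* A discrete group has exponent 0: for nonempty [a] the space [k_rat] contains a nontrivial
   convergent sequence. *)
have [d1|nd1] := pselect (open [set (1 : G)%g]).
  have dG : discrete_points G.
    move=> x; have := open_mull (x^-1)%g d1; congr open.
    rewrite predeqE => y /=; split=> [|->]; last by rewrite mulVg.
    by move/(congr1 (fun z => (x * z)%g)); rewrite /= mulVKg mulg1.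
  have [w _] := omega1_bounded (S := set0) (finite_set_countable (finite_set0 _)).
  have [v _ vmin] := @ord_min omega1 (fun=> True) w Logic.I.
  have v0 : below v -> False by case=> y /vmin.
  have cv := below_countable v; exists (below v); split; first exact: below_le.
    rewrite Q_pow_countable //; apply: card_discrete_homeomorphic => //.
    - exact: k_rat_count.
    - exact: infinite_rat.
    - exact: (k_rat_discrete (KK_adm _ cv) v0).
  move=> a' a'1 /(cases _ a'1)[[ca hG]|[_ hG]]; last first.
    by have /(homeomorphic_discrete hG)/(_ 0%R)/rat_crowded := dG.
  have a0 (x : a') : False.
    exact: (k_rat_not_discrete (KK_adm _ ca) x (homeomorphic_discrete hG dG)).
  by apply: ord_le_anti; [exists (fun x => False_rect _ (a0 x))|
    exists (fun x => False_rect _ (v0 x))]; split=> x; case: (a0 x) || case: (v0 x).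
have crG : crowded_space G by exact: group_crowded.
have [G1|/captured_komega] := first_countable_or_captured G_Tych G_count G_seq nd1 iia.
  exists omega1; split; first by exists id; exact: initial_id.
    rewrite Q_pow_uncountable; last exact: omega1_uncountable.
    exact: (first_countable_rat (1 : G)%g).
  move=> a' a'1 /(cases _ a'1)[[ca hG]|[//]]; exfalso.
  have [Ks [C [koQ _ _ _]]] := k_rat_structure (KK_adm _ ca) (omega_pow_zero a').
  apply: (komega_not_first_countable koQ (0%R : rat^o) (@k_rat_count _)).
    exact: homeomorphic_crowded hG crG.
  exact: homeomorphic_first_countable hG G1.
move=> /(_ G_Tych G_count G_seq)[Gs [C ko]].
have hom := group_homogeneous ko.
have [u uI u1] := nontrivial_sequence G_seq nd1.
have [x xE] := komega_omega_pow ko G_count hom uI u1.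
exists (below x); split; first exact: below_le.
  rewrite Q_pow_countable; last exact: below_countable.
  exact: (komega_k_rat KK_adm ko G_count G_seq hom uI u1 xE).
move=> a' a'1 /(cases _ a'1)[[ca hG]|[_ hG]]; last first.
  case: (komega_not_first_countable ko (1 : G)%g G_count crG).
  exact: homeomorphic_first_countable (homeomorphic_sym hG) rat_first_countable.
(* Homeomorphic spaces have the same ranks, whose order type is [omega_pow a']; injectivity of the
   power recovers the exponent. *)
apply: omega_pow_inj; apply: ord_eq_trans (ord_eq_sym xE).
have -> : cb_ranks G = cb_ranks (k_rat (KK (omega_pow a'))).
  rewrite predeqE => w; split; apply: homeomorphic_cb_ranks => //.
  exact: homeomorphic_sym.
exact: (admissible_cb_ranks (KK_adm _ ca) (omega_pow_zero a')).
Qed.
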